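(* Let $\mathcal{B}$ be a finite base class and $\mathcal{H}$ a hypothesis class of functions $\mathcal{X}\to\{\pm1\}$, let $\mathcal{D}\in\Delta(\mathcal{X}\times\{\pm1\})$, and let $\gamma\in(0,1]$. Choose any $\varepsilon,\delta>0$. There exists a choice of the parameters $\eta,\sigma,T,\tau,S_0,S,m$ of the Boosting Algorithm (described in the context) satisfying $$T=\mathcal{O}\!\left(\frac{1}{\gamma^2\varepsilon^2}\right),\quad \eta=\mathcal{O}(\gamma^2\varepsilon),\quad \sigma=\frac{\eta}{\gamma},\quad \tau=\mathcal{O}(\gamma\varepsilon),\quad S=\mathcal{O}\!\left(\frac{\log|\mathcal{B}|}{\gamma\varepsilon}+(\log|\mathcal{B}|)^3\right),\quad S_0=\mathcal{O}\!\left(\frac1{\varepsilon^2}\right),\quad m=m(\varepsilon_0,\delta_0)+\mathcal{O}\!\left(\frac{1}{\gamma^2\varepsilon^2}\right)$$ such that for any $\gamma$-agnostic weak learning oracle with respect to $\mathcal{H}$ and $\mathcal{B}$, with sample complexity $m(\cdot,\cdot)$, fixed tolerance $\varepsilon_0$ and failure probability $\delta_0$, the Boosting Algorithm run with the potential $\phi$ produces a hypothesis $\overline{h}$ such that with probability at least $1-10\delta_0T-10\delta T$, $$\mathrm{corr}_{\mathcal{D}}(\overline{h})\ \ge\ \max_{h\in\mathcal{H}}\mathrm{corr}_{\mathcal{D}}(h)-\frac{2\varepsilon_0}{\gamma}-\varepsilon,$$ while making $T=\mathcal{O}(1/(\gamma^2\varepsilon^2))$ calls to the weak learning oracle and sampling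 $TS+S_0=\mathcal{O}\big((\log|\mathcal{B}|)/(\gamma^3\varepsilon^3)+(\log|\mathcal{B}|)^3/(\gamma^2\varepsilon^2)\big)$ labeled examples from $\mathcal{D}$. Here $\mathcal{O}$ suppresses absolute constants and polylogarithmic factors.
   Context: Correlation. For a distribution $\mathcal{D}'$ on $\mathcal{X}\times\{\pm1\}$ and $h:\mathcal{X}\to\{\pm1\}$, $\mathrm{corr}_{\mathcal{D}'}(h)=\mathbb{E}_{(x,y)\sim\mathcal{D}'}[y h(x)]$; for a finite dataset $\widehat D$, $\mathrm{corr}_{\widehat D}(h)$ is the empirical average of $yh(x)$ over $\widehat D$. Weak learner. A learning algorithm $\mathcal{W}$ is a $\gamma$-agnostic weak learner with sample complexity $m:\mathbb{R}_+\times\mathbb{R}_+\to\mathbb{N}\cup\{+\infty\}$ with respect to $\mathcal{H}$ and base class $\mathcal{B}$ if for any $\varepsilon_0,\delta_0>0$, given $m(\varepsilon_0,\delta_0)$ IID samples from any distribution $\mathcal{D}'\in\Delta(\mathcal{X}\times\{\pm1\})$, it outputs $W\in\mathcal{B}$ such that with probability at least $1-\delta_0$, $\mathrm{corr}_{\mathcal{D}'}(W)\ge\gamma\max_{h\in\mathcal{H}}\mathrm{corr}_{\mathcal{D}'}(h)-\varepsilon_0$. ''Fixed tolerance $\varepsilon_0$ and failure probability $\delta_0$'' means it is used with these values. Potential. $\phi(z)=2-z$ for $z\le0$ and $\phi(z)=(z+2)e^{-z}$ for $z>0$. It is $C^2$. Sign. $\mathrm{sign}(f)(x)=+1$ if $f(x)\ge0$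 and $-1$ if $f(x)<0$. Boosting Algorithm. Inputs: sampling oracle for $\mathcal{D}$, $\gamma$-agnostic weak learner $\mathcal{W}$, step size $\eta$, mixing parameter $\sigma$, number of iterations $T$, per-iteration sample size $S$, resampling parameter $m$, branching tolerance $\tau$, post-selection sample size $S_0$, potential $\phi$. Initialize $H_1=\mathbf{0}$. For $t=1,\dots,T$: (1) Draw $S$ IID examples from $\mathcal{D}$ to form $\widehat D_t$. (2) Define a sampling distribution $\mathcal{D}_t$ on $\mathcal{X}\times\{\pm1\}$. If $t=1$, $\mathcal{D}_1$ is uniform on $\widehat D_1$. If $t>1$, a sample from $\mathcal{D}_t$ is generated as follows: with probability $1-\sigma$ return a sample from $\mathcal{D}_{t-1}$; with probability $\sigma$, draw $\eta'\sim\mathrm{Unif}[0,\eta]$ and $(x,y)$ uniformly from $\widehat D_t$, and return $(x,\hat y)$ where $\hat y=+1$ with probability $p_t(x,y,\eta')$ and $\hat y=-1$ with probability $1-p_t(x,y,\eta')$, with $$p_t(x,y,\eta')=\frac12-\frac{\sigma\,\phi'(yH_{t-1}(x))\,y+\eta\,\phi''\big(y(H_{t-1}(x)+\eta'h_{t-1}(x))\big)\,h_{t-1}(x)}{2(\eta+\sigma)}.$$ (3) Draw $m$ samples from $\mathcal{D}_t$ to form $\widehat D'_t$ (this uses no new examples from $\mathcal{D}$), and call the weak learner to get $W_t=\mathcal{W}(\widehat D'_t)$. (4) If $\mathrm{corr}_{\widehat D'_t}(W_t)>\tau$ set $h_t=W_t/\gamma$; otherwise set $h_t=-\mathrm{sign}(H_t)$.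 (5) Set $H_{t+1}=H_t+\eta h_t$. Finally draw $S_0$ IID examples from $\mathcal{D}$ to form $\widehat D_0$ and output $\overline h\in\arg\max_{h\in\{\mathrm{sign}(H_t):t\in[T]\}}\sum_{(x,y)\in\widehat D_0}yh(x)$.
   Formalization: For small γ, p_t can leave [0,1], so D_t is undefined; the guarantee covers runs where all p_t are in [0,1] (always if γ≥1/e). The weak learner's guarantee is read for every sample size ≥ m(ε0,δ0), and the extra O(1/(γ²ε²)) in m may hide powers of log|B|. *)

(* Defs.v *)
From HB Require Import structures.
From mathcomp Require Import all_boot all_order all_algebra.
From mathcomp Require Import finmap all_classical all_reals all_analysis.
Set Implicit Arguments.
Unset Strict Implicit.
Unset Printing Implicit Defensive.
Import Order.TTheory GRing.Theory Num.Theory.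
Import numFieldNormedType.Exports.
Local Open Scope classical_set_scope.
Local Open Scope ring_scope.

(* {±1} is represented by bool: true is +1 and false is -1. *)
Definition pm (R : realType) (b : bool) : R := if b then 1 else -1.

Definition corr (R : realType) d (X : measurableType d)
    (D : probability (X * bool)%type R) (h : X -> bool) : R :=
  (\int[D]_z (pm R z.2 * pm R (h z.1)))%R.

Definition corr_sum (R : realType) (X : Type) (s : seq (X * bool))
    (h : X -> bool) : R :=
  \sum_(z <- s) pm R z.2 * pm R (h z.1).

Definition emp_corr (R : realType) (X : Type) (s : seq (X * bool))
    (h : X -> bool) : R :=
  (size s)%:R^-1 * corr_sum R s h.

Definition opt_corr (R : realType) d (X : measurableType d)
    (D : probability (X * bool)%type R) (H : set (X -> bool)) : R :=
  sup [set corr D h | h in H].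

(* A sampling procedure is given by its expectation operator: [P f] is the
   expectation of [f z] for an outcome [z] of [P].  A sequence of draws, each
   depending on the earlier ones, is an iterated expectation, so draws are
   independent unless a dependence is written explicitly. *)
Definition sampler (R : realType) (Z : Type) := (Z -> \bar R) -> \bar R.

Section sampler.
Variable R : realType.

Definition ret (Z : Type) (z : Z) : sampler R Z := fun f => f z.

Definition bind (Y Z : Type) (P : sampler R Y) (k : Y -> sampler R Z) :
    sampler R Z :=
  fun f => P (fun y => k y f).

Definition from d (Z : measurableType d) (P : probability Z R) : sampler R Z :=
  fun f => (\int[P]_z f z)%E.

Fixpoint iid (Z : Type) (P : sampler R Z) (n : nat) :
    sampler R (n.-tuple Z) :=
  match n with
  | 0 => ret [tuple]
  | n'.+1 => bind P (fun z => bind (@iid Z P n')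
                              (fun s => ret [tuple of z :: s]))
  end.

(* [P] with probability [p], [Q] with probability [1 - p] *)
Definition mix (Z : Type) (p : R) (P Q : sampler R Z) : sampler R Z :=
  fun f => (p%:E * P f + (1 - p)%:E * Q f)%E.

Definition uniform_seq (Z : Type) (s : seq Z) : sampler R Z :=
  fun f => (((size s)%:R^-1)%:E * \sum_(z <- s) f z)%E.

Definition uniform_itv (a b : R) : sampler R R :=
  fun f => (((b - a)^-1)%:E *
            \int[@lebesgue_measure R]_(u in `[a, b]) f u)%E.

Definition pmf (B : finType) (q : B -> R) : sampler R B :=
  fun f => (\sum_(b : B) (q b)%:E * f b)%E.

Definition Pr (Z : Type) (P : sampler R Z) (A : set Z) : \bar R :=
  P (fun z => (\1_A z)%:E).

End sampler.

Arguments ret {R Z} z _.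
Arguments bind {R Y Z} P k _.
Arguments from {R d Z} P _.
Arguments iid {R Z} P n _.
Arguments mix {R Z} p P Q _.
Arguments uniform_seq {R Z} s _.
Arguments uniform_itv {R} a b _.
Arguments pmf {R B} q _.
Arguments Pr {R Z} P A.

(* A (possibly randomized) learning algorithm with outputs in [B]: it gets the
   tolerance, the failure probability and a dataset, and [learn] is the law of
   its output. *)
Record learner (R : realType) d (X : measurableType d)
    (B : {fset (X -> bool)}) := Learner {
  learn : R -> R -> forall n, n.-tuple (X * bool) -> B -> R ;
  learn_ge0 : forall e0 d0 n (s : n.-tuple (X * bool)) b,
    0 <= learn e0 d0 s b ;
  learn_sum1 : forall e0 d0 n (s : n.-tuple (X * bool)),
    \sum_(b : B) learn e0 d0 s b = 1 ;
  learn_measurable : forall e0 d0 n b,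
    measurable_fun [set: n.-tuple (X * bool)]
      (fun s : n.-tuple (X * bool) => learn e0 d0 s b)
}.

(* [m e0 d0 = None] stands for an infinite sample complexity. As usual for a
   sample complexity, the guarantee holds for every sample size at least
   [m e0 d0]. *)
Definition weak_learner (R : realType) d (X : measurableType d)
    (B : {fset (X -> bool)}) (gamma : R) (H : set (X -> bool))
    (m : R -> R -> option nat) (W : learner R B) : Prop :=
  forall (e0 d0 : R) (m0 n : nat), 0 < e0 -> 0 < d0 ->
    m e0 d0 = Some m0 -> (m0 <= n)%N ->
    forall D' : probability (X * bool)%type R,
      ((1 - d0)%:E <=
        Pr (bind (iid (from D') n) (fun s => pmf (learn W e0 d0 s)))
           [set w | (gamma * opt_corr D' H - e0 <= corr D' (val w))%R])%E.

Definition phi (R : realType) (z : R) : R :=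
  if z <= 0 then 2 - z else (z + 2) * expR (- z).

Record params (R : realType) := Params {
  eta : R ;
  sigma : R ;
  tau : R ;
  rounds : nat ;   (* T *)
  fresh : nat ;    (* S *)
  resample : nat ; (* m *)
  post : nat       (* S_0 *)
}.

Section boosting.
Variables (R : realType) (d : measure_display) (X : measurableType d).
Variables (pot : R -> R) (gamma : R) (q : params R).
Variable D : probability (X * bool)%type R.

(* The history before round t lists (Dhat_s, h_s) for s = t-1, ..., 1, the
   most recent round first. *)
Definition history := seq (seq (X * bool) * (X -> R)).

Fixpoint ensemble (past : history) (x : X) : R :=
  if past is (_, h) :: past' then ensemble past' x + eta q * h x else 0.

Definition sign (f : X -> R) (x : X) : bool := 0 <= f x.

(* p_t(x, y, eta') with H = H_(t-1) and h = h_(t-1) *)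
Definition label_prob (H h : X -> R) (x : X) (y : bool) (eta' : R) : R :=
  2^-1 - (sigma q * derive1 pot (pm R y * H x) * pm R y
          + eta q * derive1 (derive1 pot) (pm R y * (H x + eta' * h x)) * h x)
         / (2 * (eta q + sigma q)).

(* p_t(x, y, eta') can leave [0, 1] when gamma < 1/e: for gamma close to 0,
   y H_(t-1)(x) = 1/2 and h_(t-1)(x) = - y / gamma it is close to
   1/2 + y exp(-1/2), which is > 1 or < 0.  The sampler then uses its truncation to
   [0, 1], and [labels_valid] below says that this never happened.  For
   gamma >= 1/e and sigma = eta / gamma it never does, since
   -1 <= phi' <= 0 <= phi'' <= 1/e and |h_(t-1)(x)| <= 1 / gamma. *)
Definition clip01 (p : R) : R := Num.max 0 (Num.min 1 p).

(* The distribution D_t, given the past rounds and the fresh dataset Dhat_t *)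
Fixpoint relabeled (past : history) (Dhat : seq (X * bool)) :
    sampler R (X * bool) :=
  match past with
  | [::] => uniform_seq Dhat
  | (Dhat', h) :: past' =>
      mix (1 - sigma q)
        (relabeled past' Dhat')
        (bind (uniform_itv 0 (eta q)) (fun eta' =>
         bind (uniform_seq Dhat) (fun z =>
         mix (clip01 (label_prob (ensemble past') h z.1 z.2 eta'))
           (ret (z.1, true)) (ret (z.1, false)))))
  end.

(* Every label probability used to define D_1, ..., D_T lies in [0, 1]. *)
Fixpoint labels_valid (hist : history) : Prop :=
  match hist with
  | (Dhat, _) :: (((_, h) :: past') as past) =>
      (forall x y eta', (x, y) \in Dhat -> 0 <= eta' <= eta q ->
         0 <= label_prob (ensemble past') h x y eta' <= 1)
      /\ labels_valid past
  | _ => True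
  end.

Definition next_hyp (past : history) (Dres : seq (X * bool)) (w : X -> bool) :
    X -> R :=
  fun x => if tau q < emp_corr R Dres w then pm R (w x) / gamma
           else - pm R (sign (ensemble past) x).

Variables (B : {fset (X -> bool)}) (W : learner R B) (e0 d0 : R).

Fixpoint run_rounds (n : nat) (past : history) : sampler R history :=
  match n with
  | 0 => ret past
  | n'.+1 =>
      bind (iid (from D) (fresh q)) (fun Dhat =>
      bind (iid (relabeled past Dhat) (resample q)) (fun Dres =>
      bind (pmf (learn W e0 d0 Dres)) (fun w =>
      run_rounds n' ((tval Dhat, next_hyp past Dres (val w)) :: past))))
  end.

Definition boost : sampler R (history * seq (X * bool)) :=
  bind (run_rounds (rounds q) [::]) (fun hist =>
  bind (iid (from D) (post q)) (fun Dhat0 =>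
  ret (hist, tval Dhat0))).

(* sign(H_1), ..., sign(H_T): [drop k hist] with 1 <= k <= T is the history
   before round T + 1 - k. *)
Definition candidates (hist : history) : set (X -> bool) :=
  [set h | exists k, (0 < k <= size hist)%N
                     /\ h = sign (ensemble (drop k hist))].

(* The admissible outputs: all maximizers, however ties are broken. *)
Definition outputs (hist : history) (Dhat0 : seq (X * bool)) :
    set (X -> bool) :=
  [set h | candidates hist h /\
     forall h', candidates hist h' ->
       corr_sum R Dhat0 h' <= corr_sum R Dhat0 h].

End boosting.

(* The logarithm bounded below by 1, so that bounds involving logarithms do not
   degenerate to 0, for instance at log 1. *)
Definition lg (R : realType) (x : R) : R := Num.max 1 (ln x).

(* The suppressed polylogarithmic factor. It does not involve |B|, so that
   explicit powers of log |B| in a bound keep their meaning. *)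
Definition polylog (R : realType) (k : nat) (gamma eps delta : R) : R :=
  (lg gamma^-1 * lg eps^-1 * lg delta^-1) ^+ k.

(* Main.v *)
(* Write [G_t g] for the mean of [- phi'(y H_t(x)) y g(x)], the slope of the
   potential at [H_t] in direction [g].  Averaging [phi''] over [eta'] turns the
   label bias of a relabeled example into a difference of slopes, so that a round
   replaces [corr_t] by [(1 - sigma) corr_t] plus [sigma / (eta + sigma)] times
   [G_(t+1) - (1 - sigma) G_t], up to sampling noise.  Hence
   [corr_t = G_t / (1 + gamma) + noise_t + O((1 - sigma) ^ t)] for every fixed
   hypothesis, where [noise_t] is a geometrically damped sum of martingale
   increments; an exponential supermartingale and a union bound over the base
   class keep it below [gamma eps / 128] once [S] is about
   [log |B| / (gamma eps)].

   After a burn-in of about [log(1 / (gamma eps)) / sigma] rounds, during which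
   the potential grows only logarithmically, each round lowers the potential by
   [eta eps / 32], or else neither the weak learner nor [- sign H_t] has a large
   slope.  In the latter case [G_t h <= 2 e0 / gamma + O(eps)] for the best [h],
   while [G_t (sign H_t) >= - O(eps)], and [corr h - corr (sign H_t)] is at most
   [G_t h - G_t (sign H_t)], so [sign H_t] is nearly optimal.  The potential being
   nonnegative, this happens within [T] rounds, and the post-selection finds such
   a round.

   Expectations over [D] are integrals of functions that need not be measurable,
   that is, lower integrals.  Failure probabilities are therefore bounded through
   measurable majorants, see [upper] below. *)
Require Import Defs.
From HB Require Import structures.
From mathcomp Require Import all_boot all_order all_algebra.
From mathcomp Require Import finmap all_classical all_reals all_analysis.
From mathcomp Require Import measurable_realfun ring lra.
Import Order.TTheory GRing.Theory Num.Theory.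
Import numFieldNormedType.Exports.
Import Defs.
Local Open Scope classical_set_scope.
Local Open Scope ring_scope.

(** * Upper bounds on expectations under a sampler *)

(** All accuracies are multiples of [a = gamma * eps / 128]: [tau] is [8 * a] and [sigma] is
    [2 * a]. The noise is damped at rate [1 - sigma] and has variance of order [sigma / S], so
    keeping it below [a] takes [S] of order [sigma / a ^ 2], that is [1 / (gamma * eps)]; a plain
    empirical mean would take [1 / a ^ 2]. This is the gain from mixing the relabeled data of all
    earlier rounds. The noise is defined from the untruncated label formula, so its moment bounds
    hold along every run; validity of the labels enters only in the pathwise relation between noise
    and correlations. Two kinds of randomness are kept apart. Draws from [D] are lower integrals,
    bounded only from above. Given the past and the fresh dataset, averaging over [eta'] turns
    relabeling into a finitely supported law: its expectations are additive, and it comes from a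
    probability measure to which the weak learner's guarantee applies. The class may be infinite, so
    the union bound ranges over the base class and one near-optimal [hstar]; the guarantee against
    the supremum for the relabeled law implies the one against [hstar]. *)

Definition monotone_sampler {R : realType} {Z : Type} (P : sampler R Z) :=
  forall f g : Z -> \bar R, (forall z, 0 <= f z)%E ->
    (forall z, f z <= g z)%E -> (P f <= P g)%E.

Definition nonneg_sampler {R : realType} {Z : Type} (P : sampler R Z) :=
  forall f : Z -> \bar R, (forall z, 0 <= f z)%E -> (0 <= P f)%E.

(* [v] bounds the expectation of [V] under [P].  Adding the arbitrary [f] lets
   such bounds be summed and composed along [bind] although the expectation of
   a nonmeasurable function is not additive. *)
Definition upper {R : realType} {Z : Type} (P : sampler R Z)
    (V : Z -> R) (v : R) :=
  forall f : Z -> \bar R, (forall z, 0 <= f z)%E ->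
    (P (fun z => f z + (V z)%:E) <= P f + v%:E)%E.

Section upper_theory.
Context {R : realType}.

Lemma upper_le {Z : Type} (P : sampler R Z) (V V' : Z -> R) (v v' : R) :
  monotone_sampler P -> (forall z, 0 <= V' z) -> (forall z, V' z <= V z) ->
  v <= v' -> upper P V v -> upper P V' v'.
Proof.
move=> mP V0 VV vv PV f f0; apply: (@le_trans _ _ (P f + v%:E)%E).
  apply: le_trans (PV f f0); apply: mP => z.
    by rewrite adde_ge0// lee_fin.
  by rewrite leeD2l// lee_fin.
by rewrite leeD2l// lee_fin.
Qed.

Lemma upperD {Z : Type} (P : sampler R Z) (V W : Z -> R) (v w : R) :
  (forall z, 0 <= V z) -> upper P V v -> upper P W w ->
  upper P (fun z => V z + W z) (v + w).
Proof.
move=> V0 PV PW f f0.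
under eq_fun do rewrite EFinD addeA.
rewrite EFinD addeA.
apply: (@le_trans _ _ (P (fun z => f z + (V z)%:E) + w%:E)%E).
  by apply: PW => z; rewrite adde_ge0// lee_fin.
by rewrite leeD2r// PV.
Qed.

Lemma upper0 {Z : Type} (P : sampler R Z) : upper P (fun=> 0) 0.
Proof. by move=> f f0; under eq_fun do rewrite adde0; rewrite adde0. Qed.

Lemma upper_sum {Z : Type} {I : Type} (r : seq I) (P : sampler R Z)
    (V : I -> Z -> R) (v : I -> R) :
  (forall i z, 0 <= V i z) -> (forall i, upper P (V i) (v i)) ->
  upper P (fun z => \sum_(i <- r) V i z) (\sum_(i <- r) v i).
Proof.
move=> V0 PV; elim: r => [|i r IH].
  by rewrite big_nil; under eq_fun do rewrite big_nil; exact: upper0.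
rewrite big_cons; under eq_fun do rewrite big_cons.
exact: upperD.
Qed.

(** Tower rule. The arbitrary function in [upper] makes it work: after the inner bound, [k y f]
    takes its place in the outer one. *)
Lemma upper_bind {Y Z : Type} (P : sampler R Y) (k : Y -> sampler R Z)
    (V : Z -> R) (v' : Y -> R) (v : R) :
  monotone_sampler P -> (forall y, nonneg_sampler (k y)) ->
  (forall z, 0 <= V z) ->
  (forall y, upper (k y) V (v' y)) -> upper P v' v -> upper (bind P k) V v.
Proof.
move=> mP k0 V0 kV Pv f f0; rewrite /bind.
apply: (@le_trans _ _ (P (fun y => k y f + (v' y)%:E)%E)).
  apply: mP => y; last exact: kV.
  by apply: k0 => z; rewrite adde_ge0// lee_fin.
by apply: Pv => y; exact: k0.
Qed.

Lemma monotone_bind {Y Z : Type} (P : sampler R Y) (k : Y -> sampler R Z) :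
  monotone_sampler P -> (forall y, nonneg_sampler (k y)) ->
  (forall y, monotone_sampler (k y)) -> monotone_sampler (bind P k).
Proof.
move=> mP k0 mk f g f0 fg; apply: mP => y; first exact: k0.
exact: mk.
Qed.

Lemma nonneg_bind {Y Z : Type} (P : sampler R Y) (k : Y -> sampler R Z) :
  nonneg_sampler P -> (forall y, nonneg_sampler (k y)) ->
  nonneg_sampler (bind P k).
Proof. by move=> P0 k0 f f0; apply: P0 => y; exact: k0. Qed.

Lemma monotone_ret {Z : Type} (z : Z) : monotone_sampler (@ret R Z z).
Proof. by move=> f g f0 fg; exact: fg. Qed.

Lemma nonneg_ret {Z : Type} (z : Z) : nonneg_sampler (@ret R Z z).
Proof. by move=> f f0; exact: f0. Qed.

Lemma upper_ret {Z : Type} (z : Z) (V : Z -> R) : upper (@ret R Z z) V (V z).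
Proof. by move=> f f0. Qed.

Lemma monotone_iid {Z : Type} (P : sampler R Z) n :
  monotone_sampler P -> nonneg_sampler P -> monotone_sampler (iid P n)
  /\ nonneg_sampler (iid P n).
Proof.
move=> mP P0; elim: n => [|n [IHm IH0]] /=.
  by split; [exact: monotone_ret|exact: nonneg_ret].
split.
  apply: monotone_bind => // y.
    by apply: nonneg_bind => // s; exact: nonneg_ret.
  apply: monotone_bind => // s; [exact: nonneg_ret|exact: monotone_ret].
apply: nonneg_bind => // y; apply: nonneg_bind => // s; exact: nonneg_ret.
Qed.

(** The constant [c] is a parameter so that the factor of the first draw can be absorbed into the
    constant for the remaining draws. *)
Lemma upper_iid_prod {Z : Type} (P : sampler R Z) n (u : Z -> R) (kappa : R) :
  monotone_sampler P -> nonneg_sampler P -> (forall z, 0 <= u z) ->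
  0 <= kappa ->
  (forall c, 0 <= c -> upper P (fun z => c * u z) (c * kappa)) ->
  forall c, 0 <= c ->
  upper (iid P n) (fun s => c * \prod_(z <- s) u z) (c * kappa ^+ n).
Proof.
move=> mP P0 u0 k0 Pu; elim: n => [|n IH] c c0 /=.
  have := @upper_ret _ [tuple] (fun s : 0.-tuple Z => c * \prod_(z <- s) u z).
  by rewrite /= big_nil expr0.
have [mI I0] := @monotone_iid _ P n mP P0.
apply: (@upper_bind _ _ _ _ _ (fun z => c * u z * kappa ^+ n)) => //.
- by move=> y; apply: nonneg_bind => // s; exact: nonneg_ret.
- move=> s; rewrite mulr_ge0//.
  by apply: prodr_ge0.
- move=> z; apply: (@upper_bind _ _ _ _ _
    (fun s : n.-tuple Z => c * u z * \prod_(z <- s) u z)) => //.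
  + by move=> s; exact: nonneg_ret.
  + by move=> s; rewrite mulr_ge0// prodr_ge0.
  + move=> s f f0; rewrite /ret /= big_cons mulrA.
    exact: lexx.
  + by apply: IH; rewrite mulr_ge0.
- rewrite exprSr mulrA.
  under [X in upper P X _]eq_fun do rewrite mulrAC.
  by apply: Pu; rewrite mulr_ge0// exprn_ge0.
Qed.

End upper_theory.

(** * Lower integrals under a probability measure *)

Section from_theory.
Import HBNNSimple.
Context {R : realType} {d : measure_display} {Z : measurableType d}.
Variable P : probability Z R.

(** Holds without measurability: the integral of a nonnegative function is a supremum over the
    simple functions below it. *)
Lemma le_integral_nonneg (f g : Z -> \bar R) :
  (forall z, 0 <= f z)%E -> (forall z, f z <= g z)%E ->
  (\int[P]_z f z <= \int[P]_z g z)%E.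
Proof.
move=> f0 fg.
have g0 z : (0 <= g z)%E := le_trans (f0 z) (fg z).
rewrite !ge0_integralTE//; apply: le_ereal_sup => _ [h /= hf <-].
by exists h => //= z; exact: le_trans (hf z) (fg z).
Qed.

Lemma monotone_from : monotone_sampler (from P).
Proof. by move=> f g f0 fg; exact: le_integral_nonneg. Qed.

Lemma nonneg_from : nonneg_sampler (from P).
Proof. by move=> f f0; exact: integral_ge0. Qed.

(* The integral of a possibly nonmeasurable [f >= 0] is a lower integral; it
   is still subadditive when one of the summands is measurable. *)
Lemma upper_from (V : Z -> R) (v : R) :
  measurable_fun [set: Z] V -> (forall z, 0 <= V z) ->
  (\int[P]_z (V z)%:E <= v%:E)%E -> upper (from P) V v.
Proof.
move=> mV V0 Vv f f0; rewrite /from.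
rewrite ge0_integralTE; last by move=> z; rewrite adde_ge0// lee_fin.
apply: ge_ereal_sup => _ [s /= sfV <-].
rewrite -integralT_nnsfun.
(* The positive part of [s - V] is measurable, lies below [f], and satisfies [s <= u + V]; the sum
   on the right consists of two measurable functions and can be split. *)
pose u z := Num.max 0 (s z - V z).
have mu : measurable_fun [set: Z] u.
  by apply: measurable_maxr => //; apply: measurable_funB.
have u0 z : 0 <= u z by rewrite le_max lexx.
apply: (@le_trans _ _ (\int[P]_z ((u z)%:E + (V z)%:E))%E).
  apply: le_integral_nonneg => z; first by rewrite lee_fin.
  by rewrite -EFinD lee_fin -lerBlDr le_max lexx orbT.
rewrite ge0_integralD//; last 4 first.
- by move=> z _; rewrite lee_fin.
- exact/measurable_EFinP.
- by move=> z _; rewrite lee_fin.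
- exact/measurable_EFinP.
apply: leeD => //; apply: le_integral_nonneg => z; first by rewrite lee_fin.
rewrite /u EFin_max ge_max f0/= EFinB leeBlDr//.
Qed.

End from_theory.

Section pmf_theory.
Context {R : realType} {B : finType}.
Variable q : B -> R.
Hypothesis q0 : forall b, 0 <= q b.

Lemma nonneg_pmf : nonneg_sampler (pmf q).
Proof.
by move=> f f0; apply: sume_ge0 => b _; rewrite mule_ge0// lee_fin.
Qed.

End pmf_theory.

(** * Samplers with finite support *)

Section discrete_measure.
Context {R : realType} {d : measure_display} {Z : measurableType d}.
Variables (l : seq (R * Z)) (p0 : R * Z).

(** The absolute value supplies a nonnegative weight before any hypothesis on [l] is available;
    under [l0] it is the weight itself. *)
Definition discrete_measure :=
  msum (fun i => mscale (`|(nth p0 l i).1|%:nng)%R (\d_((nth p0 l i).2)))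
       (size l).

HB.instance Definition _ := Measure.on discrete_measure.

Hypothesis l0 : all (fun p => 0 <= p.1) l.
Hypothesis l1 : \sum_(p <- l) p.1 = 1.

Lemma integral_discrete_measure (f : Z -> \bar R) :
  measurable_fun [set: Z] f -> (forall z, 0 <= f z)%E ->
  (\int[discrete_measure]_z f z = \sum_(p <- l) p.1%:E * f p.2)%E.
Proof.
move=> mf f0; rewrite ge0_integral_measure_sum//.
rewrite [RHS](big_nth p0) big_mkord; apply: eq_bigr => i _.
rewrite ge0_integral_mscale//= integral_dirac// diracT mul1e.
by rewrite ger0_norm// (all_nthP p0 l0).
Qed.

Lemma discrete_measureT : discrete_measure setT = 1%E.
Proof.
rewrite /discrete_measure /msum/= -l1 (big_nth p0) big_mkord -sumEFin.
apply: eq_bigr => i _; rewrite /mscale/= diracT mule1 ger0_norm//.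
by rewrite (all_nthP p0 l0).
Qed.

HB.instance Definition _ :=
  Measure_isProbability.Build _ _ _ discrete_measure discrete_measureT.

Lemma discrete_probability : exists P : probability Z R,
  forall f : Z -> \bar R, measurable_fun [set: Z] f ->
  (forall z, 0 <= f z)%E ->
  (\int[P]_z f z = \sum_(p <- l) p.1%:E * f p.2)%E.
Proof.
by exists discrete_measure => f mf f0; exact: integral_discrete_measure.
Qed.

End discrete_measure.

(** The finite sum represents [P] on all nonnegative functions, measurable or not. Expectations are
    therefore additive in this class, in contrast to lower integrals. *)
Definition discrete {R : realType} {Z : Type} (P : sampler R Z) :=
  exists l : seq (R * Z), [/\ all (fun p => 0 <= p.1) l,
    \sum_(p <- l) p.1 = 1 & forall f : Z -> \bar R, (forall z, 0 <= f z)%E ->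
      P f = (\sum_(p <- l) p.1%:E * f p.2)%E].

Section discrete_theory.
Context {R : realType}.

Lemma weighted_sum_ge0 {Z : Type} (l : seq (R * Z)) (f : Z -> \bar R) :
  all (fun p => 0 <= p.1) l -> (forall z, 0 <= f z)%E ->
  (0 <= \sum_(p <- l) p.1%:E * f p.2)%E.
Proof.
move=> l0 f0; elim: l l0 => [|p l IH] /=; first by rewrite big_nil.
by move=> /andP[p0 /IH l0]; rewrite big_cons adde_ge0// mule_ge0.
Qed.

Lemma discrete_linear {Z : Type} (P : sampler R Z) (f g : Z -> \bar R) (c : R) :
  discrete P -> (forall z, 0 <= f z)%E -> (forall z, 0 <= g z)%E -> 0 <= c ->
  (P (fun z => f z + c%:E * g z) = P f + c%:E * P g)%E.
Proof.
move=> [l [l0 _ PE]] f0 g0 c0.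
rewrite !PE//; last by move=> z; rewrite adde_ge0// mule_ge0// lee_fin.
elim: l l0 {PE} => [|p l IH] /=; first by rewrite !big_nil mule0 adde0.
move=> /andP[p0 l0'].
have f0' := weighted_sum_ge0 _ _ l0' f0.
have g0' := weighted_sum_ge0 _ _ l0' g0.
rewrite !big_cons IH// ge0_muleDr ?mule_ge0//.
rewrite [in RHS]ge0_muleDr ?mule_ge0//.
by rewrite addeACA (muleCA c%:E).
Qed.

Lemma discreteD {Z : Type} (P : sampler R Z) (f g : Z -> \bar R) :
  discrete P -> (forall z, 0 <= f z)%E -> (forall z, 0 <= g z)%E ->
  (P (fun z => f z + g z) = P f + P g)%E.
Proof.
move=> dP f0 g0; have := @discrete_linear _ P f g 1 dP f0 g0 ler01.
by under eq_fun do rewrite mul1e; rewrite mul1e.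
Qed.

Lemma discrete_cst {Z : Type} (P : sampler R Z) (c : R) :
  discrete P -> 0 <= c -> (P (fun=> c%:E) = c%:E)%E.
Proof.
move=> [l [l0 l1 PE]] c0; rewrite PE//.
rewrite -[in RHS](mul1r c) -l1 mulr_suml -sumEFin.
by apply: eq_bigr.
Qed.

Lemma monotone_discrete {Z : Type} (P : sampler R Z) :
  discrete P -> monotone_sampler P.
Proof.
move=> [l [l0 _ PE]] f g f0 fg.
have g0 z : (0 <= g z)%E := le_trans (f0 z) (fg z).
rewrite !PE//; elim: l l0 {PE} => [|p l IH] /=; first by rewrite !big_nil.
by move=> /andP[p0 /IH l0]; rewrite !big_cons leeD// lee_wpmul2l.
Qed.

Lemma nonneg_discrete {Z : Type} (P : sampler R Z) :
  discrete P -> nonneg_sampler P.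
Proof. by move=> [l [l0 _ PE]] f f0; rewrite PE// weighted_sum_ge0. Qed.

Lemma upper_discrete {Z : Type} (P : sampler R Z) (V : Z -> R) (v : R) :
  discrete P -> (forall z, 0 <= V z) -> (P (fun z => (V z)%:E) <= v%:E)%E ->
  upper P V v.
Proof.
move=> dP V0 Vv f f0; rewrite discreteD//.
exact: leeD2l.
Qed.

Lemma discrete_bind {Y Z : Type} (P : sampler R Y) (k : Y -> sampler R Z) :
  discrete P -> (forall y, discrete (k y)) -> discrete (bind P k).
Proof.
move=> [l [l0 l1 PE]] dk.
have /choice[g gP] := dk.
exists (flatten [seq [seq (p.1 * q.1, q.2) | q <- g p.2] | p <- l]); split.
- elim: l l0 {l1 PE} => [//|p l IH] /= /andP[p0 /IH l0].
  rewrite all_cat l0 andbT all_map; have [g0 _ _] := gP p.2.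
  by apply: sub_all g0 => q q0 /=; rewrite mulr_ge0.
- rewrite big_flatten/= big_map -[RHS]l1; apply: eq_bigr => p _.
  rewrite big_map/= -mulr_sumr; have [_ -> _] := gP p.2.
  by rewrite mulr1.
- move=> f f0; rewrite /bind PE; last by move=> y; exact: nonneg_discrete.
  rewrite big_flatten/= big_map.
  apply: eq_bigr => p _; rewrite big_map/=; have [g0 _ ->//] := gP p.2.
  elim: (g p.2) g0 => [|q s IH] /=; first by rewrite !big_nil mule0.
  move=> /andP[q0 s0'].
  rewrite !big_cons ge0_muleDr ?mule_ge0// ?weighted_sum_ge0//.
  by rewrite IH//= EFinM muleA.
Qed.

Lemma discrete_ret {Z : Type} (z : Z) : discrete (@ret R Z z).
Proof.
exists [:: (1, z)]; split.
- by rewrite /= ler01.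
- by rewrite big_seq1.
- by move=> f f0; rewrite big_seq1/= mul1e.
Qed.

Lemma discrete_mix {Z : Type} (p : R) (P Q : sampler R Z) :
  0 <= p <= 1 -> discrete P -> discrete Q -> discrete (mix p P Q).
Proof.
move=> /andP[p0 p1] dP dQ.
pose coin : sampler R bool := fun f => (p%:E * f true + (1 - p)%:E * f false)%E.
have dcoin : discrete coin.
  exists [:: (p, true); (1 - p, false)]; split.
  - by rewrite /= p0 subr_ge0 p1.
  - by rewrite !big_cons big_nil/= addr0 subrKC.
  - by move=> f f0; rewrite !big_cons big_nil/= adde0.
apply: (@discrete_bind _ _ coin (fun b => if b then P else Q)) => //.
by case.
Qed.

Lemma discrete_uniform_seq {Z : Type} (s : seq Z) :
  (0 < size s)%N -> discrete (@uniform_seq R Z s).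
Proof.
move=> s0; exists [seq ((size s)%:R^-1, z) | z <- s]; split.
- by rewrite all_map; elim: (s) (size s) => //= z t IH k; rewrite IH invr_ge0 ler0n.
- rewrite big_map/= big_const_seq count_predT iter_addr_0.
  by rewrite -[LHS]mulr_natr mulVf// pnatr_eq0 -lt0n.
- move=> f f0; rewrite big_map/= /uniform_seq.
  move: (size s) => k; elim: (s) => [|z t IH]; first by rewrite !big_nil mule0.
  by rewrite !big_cons -IH ge0_muleDr// sume_ge0.
Qed.

Lemma discrete_iid {Z : Type} (P : sampler R Z) n :
  discrete P -> discrete (iid P n).
Proof.
move=> dP; elim: n => [|n IH] /=; first exact: discrete_ret.
apply: discrete_bind => // z; apply: discrete_bind => // s.
exact: discrete_ret.
Qed.

Section measure_of_discrete.
Context {d : measure_display} {Z : measurableType d}.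
Variable P : sampler R Z.
Hypothesis dP : discrete P.

(** The weak learner's guarantee is stated for probability measures; this provides one for a
    relabeled sampler. *)
Lemma discrete_from : exists P' : probability Z R,
  forall f : Z -> \bar R, measurable_fun [set: Z] f ->
  (forall z, 0 <= f z)%E -> from P' f = P f.
Proof.
have [l [l0 l1 PE]] := dP.
case: l l0 l1 PE => [|p0 l] l0 l1 PE.
  by move: l1; rewrite big_nil => /esym/eqP; rewrite oner_eq0.
have [P' P'E] := discrete_probability (p0 :: l) p0 l0 l1.
by exists P' => f mf f0; rewrite /from P'E// PE.
Qed.

Lemma measurable_iid_discrete n {d'} {Y : measurableType d'}
    (F : Y -> n.-tuple Z -> \bar R) :
  measurable_fun [set: Y * n.-tuple Z] (fun p => F p.1 p.2) ->
  (forall y s, 0 <= F y s)%E ->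
  measurable_fun [set: Y] (fun y => iid P n (F y)).
Proof.
have [l [l0 l1 PE]] := dP.
elim: n d' Y F => [|n IH] d' Y F mF F0.
  apply: (measurableT_comp mF (g := fun y => (y, [tuple]))).
  exact: measurable_fun_pair.
under [X in measurable_fun _ X]eq_fun => y.
  rewrite /= {1}/bind PE; last first.
    move=> z; apply: nonneg_bind; first exact/nonneg_discrete/discrete_iid.
      by move=> s; exact: nonneg_ret.
    by move=> s; exact: F0.
  over.
apply: emeasurable_sum => p; apply: measurable_funeM.
apply: (IH _ _ (fun y s => F y [tuple of p.2 :: s])) => //.
have mg : measurable_fun [set: Y * n.-tuple Z]
    (fun q => (q.1, [the n.+1.-tuple Z of p.2 :: q.2])).
  by apply: measurable_fun_pair => //; exact: measurable_cons.
exact: (measurableT_comp mF mg).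
Qed.

(** [P'] and [P] are known to agree only on measurable functions, so every inner expectation of the
    iterated draw has to be measurable in the points already drawn. *)
Lemma iid_discrete_from (P' : probability Z R) :
  (forall f : Z -> \bar R, measurable_fun [set: Z] f ->
    (forall z, 0 <= f z)%E -> from P' f = P f) ->
  forall n (F : n.-tuple Z -> \bar R), measurable_fun [set: n.-tuple Z] F ->
  (forall s, 0 <= F s)%E -> iid (from P') n F = iid P n F.
Proof.
move=> P'E; elim=> [//|n IH] F mF F0 /=; rewrite /bind.
have mFc : measurable_fun [set: Z * n.-tuple Z]
    (fun p => F [tuple of p.1 :: p.2]).
  have mg : measurable_fun [set: Z * n.-tuple Z]
      (fun q => [the n.+1.-tuple Z of q.1 :: q.2]) by exact: measurable_cons.
  exact: (measurableT_comp mF mg).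
rewrite -P'E; last 2 first.
- exact: (measurable_iid_discrete n (fun z s => F [tuple of z :: s])).
- move=> z; rewrite /bind /ret.
  apply: (nonneg_discrete (iid P n)); first exact: discrete_iid.
  by move=> s; exact: F0.
congr (from P' _); apply/funext => z.
apply: (IH (fun s => F [tuple of z :: s])) => //.
have mg : measurable_fun [set: n.-tuple Z]
    (fun s => [the n.+1.-tuple Z of z :: s]) by exact: measurable_cons.
exact: (measurableT_comp mF mg).
Qed.

End measure_of_discrete.
End discrete_theory.

(** * The potential phi *)

Section glue_at_zero.
Context {R : realType}.

Lemma cvg_glue (f g : R -> R) (l : R) :
  f z @[z --> (0:R)] --> l -> g z @[z --> (0:R)] --> l ->
  (if z <= 0 then f z else g z) @[z --> (0:R)] --> l.
Proof.
move=> fl gl A Al.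
have fA : \forall z \near (0:R), A (f z) := fl A Al.
have gA : \forall z \near (0:R), A (g z) := gl A Al.
suff : \forall z \near (0:R), A (if z <= 0 then f z else g z) by [].
by near=> z; case: ifP => _; near: z; [exact: fA|exact: gA].
Unshelve. all: by end_near. Qed.

(** By Caratheodory's criterion, differentiability at 0 is continuity at 0 of a slope function, and
    the two slope functions glue just as [f] and [g] do because [f 0 = g 0]. *)
Lemma is_derive_glue (f g : R -> R) (l : R) : f 0 = g 0 ->
  is_derive (0:R) 1 f l -> is_derive (0:R) 1 g l ->
  is_derive (0:R) 1 (fun z => if z <= 0 then f z else g z) l.
Proof.
move=> fg0 /is_derive1_caratheodory[f' [fE cf f'0]].
move=> /is_derive1_caratheodory[g' [gE cg g'0]].
apply/is_derive1_caratheodory.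
exists (fun z => if z <= 0 then f' z else g' z); split.
- by move=> z; rewrite lexx; case: ifP => _; rewrite ?fE// fg0 gE.
- rewrite /prop_for /continuous_at lexx f'0; apply: cvg_glue.
    by rewrite -f'0; exact: cf.
  by rewrite -g'0; exact: cg.
- by rewrite lexx.
Qed.

Lemma is_derive_glue_at (f g : R -> R) (z l : R) :
  (z <= 0 -> is_derive z 1 f l) -> (0 <= z -> is_derive z 1 g l) ->
  f 0 = g 0 ->
  is_derive z 1 (fun z => if z <= 0 then f z else g z) l.
Proof.
move=> fl gl fg0; have [z0|z0|z0] := ltgtP z 0.
- apply: (@near_eq_is_derive _ _ _ f); last by apply: fl; exact: ltW.
  near=> x; rewrite ifT//; near: x.
  by apply: filterS (lt_nbhsl z0) => x; exact: ltW.
- apply: (@near_eq_is_derive _ _ _ g); last by apply: gl; exact: ltW.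
  near=> x; rewrite ifF//; apply/negbTE; rewrite -ltNge; near: x.
  exact: lt_nbhsr.
- by subst z; apply: is_derive_glue => //; [exact: fl|exact: gl].
Unshelve. all: by end_near. Qed.

Lemma continuous_glue (f g : R -> R) : continuous f -> continuous g ->
  f 0 = g 0 -> continuous (fun z : R => if z <= 0 then f z else g z).
Proof.
move=> cf cg fg0 z; rewrite /continuous_at.
have [z0|z0|z0] := ltgtP (z : R) (0 : R).
- apply: (cvg_trans _ (cf z)); apply: near_eq_cvg; near=> x.
  by rewrite ifT//; near: x; apply: filterS (lt_nbhsl z0) => x; exact: ltW.
- apply: (cvg_trans _ (cg z)); apply: near_eq_cvg; near=> x.
  by rewrite ifF//; apply/negbTE; rewrite -ltNge; near: x; exact: lt_nbhsr.
- subst z; apply: cvg_glue; first exact: cf.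
  by rewrite fg0; exact: cg.
Unshelve. all: by end_near. Qed.

Lemma mean_value (f df : R -> R) (a b : R) :
  (forall x : R, is_derive x 1 f (df x)) ->
  exists c, (a <= c <= b \/ b <= c <= a) /\ f b - f a = df c * (b - a).
Proof.
move=> fdf.
have cf x : {for x, continuous f}.
  apply/differentiable_continuous/derivable1_diffP.
  by have [] := fdf x.
have H u v : u <= v -> exists2 c, c \in `[u, v] & f v - f u = df c * (v - u).
  move=> uv; apply: MVT_segment => //.
  by apply: continuous_subspaceT => x; exact: cf.
have [ab|/ltW ba] := leP a b.
  by have [c] := H _ _ ab; rewrite in_itv/= => cab ->; exists c; split; [left|].
have [c] := H _ _ ba; rewrite in_itv/= => cab E; exists c; split; first by right.
by rewrite -opprB E -mulrN opprB.
Qed.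

End glue_at_zero.

Section potential.
Context {R : realType}.
Implicit Types a b z u : R.

Definition phi1 z : R := if z <= 0 then -1 else - ((z + 1) * expR (- z)).
Definition phi2 z : R := if z <= 0 then 0 else z * expR (- z).

Lemma is_derive_affine_expN (a : R) z :
  is_derive z 1 (fun z => (z + a) * expR (- z)) ((1 - a - z) * expR (- z)).
Proof.
have d1 : is_derive z 1 (fun x : R => expR (- x)) (- expR (- z)).
  have := @is_derive1_comp _ expR -%R z _ _ (is_derive_expR _) (is_deriveNid z 1).
  by rewrite mulrN1.
have d2 : is_derive z 1 (fun x : R => x + a) 1.
  have := is_deriveD (is_derive_id z (1:R)) (is_derive_cst a z (1:R)).
  by rewrite addr0.
have := is_deriveM d2 d1.
move=> /is_derive_eq; apply.
by rewrite /GRing.scale/=; ring.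
Qed.

Lemma is_derive_phi z : is_derive z 1 (@phi R) (phi1 z).
Proof.
apply: (@is_derive_glue_at _ (fun z => 2 - z) (fun z => (z + 2) * expR (- z))).
- move=> z0; rewrite /phi1 z0.
  have := is_deriveB (is_derive_cst (2:R) z (1:R)) (is_derive_id z (1:R)).
  by rewrite sub0r.
- move=> z0; apply: is_derive_eq (is_derive_affine_expN 2 z) _.
  rewrite /phi1; case: ifPn => [z0'|_]; last by ring.
  have -> : z = 0 by apply/eqP; rewrite eq_le z0 z0'.
  by rewrite oppr0 expR0; ring.
- by rewrite oppr0 expR0; ring.
Qed.

Lemma is_derive_phi1 z : is_derive z 1 phi1 (phi2 z).
Proof.
apply: (@is_derive_glue_at _ (fun=> -1) (fun z => - ((z + 1) * expR (- z)))).
- by move=> z0; rewrite /phi2 z0; exact: is_derive_cst.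
- move=> z0; have := is_deriveN (is_derive_affine_expN 1 z).
  move=> /is_derive_eq; apply.
  rewrite /phi2; case: ifPn => [z0'|_]; last by ring.
  have -> : z = 0 by apply/eqP; rewrite eq_le z0 z0'.
  by rewrite oppr0 expR0; ring.
- by rewrite oppr0 expR0; ring.
Qed.

Lemma derive1_phi : derive1 (@phi R) = phi1.
Proof. by apply/funext => z; rewrite derive1E; have [_ ->] := is_derive_phi z. Qed.

Lemma derive1_phi1 : derive1 phi1 = phi2.
Proof. by apply/funext => z; rewrite derive1E; have [_ ->] := is_derive_phi1 z. Qed.

Lemma continuous_phi : continuous (@phi R).
Proof.
move=> z; apply/differentiable_continuous/derivable1_diffP.
by have [] := is_derive_phi z.
Qed.

Lemma continuous_phi1 : continuous phi1.
Proof.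
move=> z; apply/differentiable_continuous/derivable1_diffP.
by have [] := is_derive_phi1 z.
Qed.

Lemma continuous_phi2 : continuous phi2.
Proof.
have cg : continuous (fun z : R => z * expR (- z)).
  move=> z; apply/differentiable_continuous/derivable1_diffP.
  have := is_derive_affine_expN 0 z.
  by under eq_fun do rewrite addr0; case.
apply: continuous_glue => //; first by move=> z; exact: cvg_cst.
by rewrite mul0r.
Qed.

Lemma phi1_bound z : -1 <= phi1 z <= 0.
Proof.
rewrite /phi1; case: ifPn; first by rewrite lexx; lra.
rewrite -ltNge => z0; rewrite lerN2 oppr_le0 expRN; apply/andP; split.
  by rewrite ler_pdivrMr ?expR_gt0// mul1r addrC expR_ge1Dx.
by rewrite divr_ge0 ?expR_ge0// addr_ge0// ltW.
Qed.

Lemma phi2_bound z : 0 <= phi2 z <= 1.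
Proof.
rewrite /phi2; case: ifPn; first by rewrite lexx; lra.
rewrite -ltNge => z0; rewrite expRN; apply/andP; split.
  by rewrite divr_ge0 ?expR_ge0// ltW.
rewrite ler_pdivrMr ?expR_gt0// mul1r.
by apply: le_trans (expR_ge1Dx z); rewrite lerDr.
Qed.

Lemma phi_ge0 z : 0 <= phi z.
Proof.
rewrite /phi; case: ifPn; first by move=> z0; lra.
by rewrite -ltNge => z0; rewrite mulr_ge0 ?expR_ge0// addr_ge0// ltW.
Qed.

Lemma phi1_lipschitz a b : `|phi1 b - phi1 a| <= `|b - a|.
Proof.
have [c [_ ->]] := mean_value phi1 phi2 a b is_derive_phi1.
rewrite normrM ler_piMl//; have /andP[c0 c1] := phi2_bound c.
by rewrite ger0_norm.
Qed.

Lemma phi_lipschitz a b : `|phi b - phi a| <= `|b - a|.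
Proof.
have [c [_ ->]] := mean_value (@phi R) phi1 a b is_derive_phi.
rewrite normrM ler_piMl//; have /andP[c0 c1] := phi1_bound c.
by rewrite ler0_norm// lerNl.
Qed.

(** Because [phi2 <= 1], subtracting [(x - z) ^+ 2 / 2] and the linear term leaves a function whose
    derivative has the sign opposite to [x - z]; it is thus largest at [z]. *)
Lemma phi_smooth z u : phi (z + u) <= phi z + phi1 z * u + u ^+ 2 / 2.
Proof.
pose f x := phi x - phi1 z * x - (x - z) ^+ 2 / 2.
pose df x := phi1 x - phi1 z - (x - z).
have fdf (x : R) : is_derive x 1 f (df x).
  have dz : is_derive x 1 (fun x : R => x - z) 1.
    have := is_deriveB (is_derive_id x (1:R)) (is_derive_cst z x (1:R)).
    by rewrite subr0.
  have d1 := is_deriveZ (phi1 z) (is_derive_id x (1:R)).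
  have d2 := is_deriveZ (2^-1) (is_deriveX 2 dz).
  have := is_deriveB (is_deriveB (is_derive_phi x) d1) d2.
  rewrite /f /df /GRing.scale/= => H.
  have -> : (fun x0 => phi x0 - phi1 z * x0 - (x0 - z) ^+ 2 / 2) =
    (@phi R - (fun x0 => phi1 z * x0) - (fun x0 => 2^-1 * (x0 - z) ^+ 2)).
    by apply/funext => y /=; rewrite -[RHS]/(_ - _ - _); ring.
  by apply: is_derive_eq H _; field.
have [c [czu E]] := mean_value f df z (z + u) fdf.
have /andP[_ _] := phi1_bound c.
have : df c * u <= 0.
  rewrite /df; have [d [dzc dE]] := mean_value phi1 phi2 z c is_derive_phi1.
  have /andP[d0 d1] := phi2_bound d; rewrite dE.
  rewrite (_ : _ * u = (phi2 d - 1) * ((c - z) * u)); last by ring.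
  rewrite mulr_le0_ge0// ?subr_le0//.
  case: czu => /andP[h1 h2].
    by rewrite mulr_ge0//; lra.
  by rewrite mulr_le0//; lra.
move: E; rewrite [z + u - z]addrC addKr => <-.
rewrite /f [z + u - z]addrC addKr subrr expr0n/= => H; lra.
Qed.

Lemma continuous_affine_phi2 (A B y a h : R) :
  continuous (fun u => A + B * (phi2 (y * (a + u * h)) * h)).
Proof.
move=> u; apply: cvgD; first exact: cvg_cst.
apply: cvgM; first exact: cvg_cst.
apply: cvgM; last exact: cvg_cst.
apply: (continuous_comp (f := fun u => y * (a + u * h)) (g := phi2)).
  by apply: cvgM; [exact: cvg_cst|apply: cvgD; [exact: cvg_cst|
    apply: cvgM; [exact: cvg_id|exact: cvg_cst]]].
exact: continuous_phi2.
Qed.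

Lemma integral_affine_phi2 (eta A B y a h : R) : 0 < eta -> y * y = 1 ->
  (\int[@lebesgue_measure R]_(u in `[0%R, eta])
     (A + B * (phi2 (y * (a + u * h)) * h))%:E =
   (A * eta + B * (y * (phi1 (y * (a + eta * h)) - phi1 (y * a))))%:E)%E.
Proof.
move=> eta0 yy.
(* The outer factor [y] meets the [y] of the inner derivative, and [y * y = 1] leaves exactly
   [phi2 (..) * h]. *)
pose F u := A * u + B * (y * phi1 (y * (a + u * h))).
have dF (u : R) : is_derive u 1 F (A + B * (phi2 (y * (a + u * h)) * h)).
  have dl : is_derive u 1 (fun u => y * (a + u * h)) (y * h).
    have := is_deriveZ y (is_deriveD (is_derive_cst a u (1:R))
      (is_deriveZ h (is_derive_id u (1:R)))).
    rewrite /GRing.scale/= mulr1 add0r => H.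
    rewrite (_ : (fun u => _) = (y \*: (cst a + h \*: id)))//.
    by apply/funext => v/=; rewrite -[RHS]/(y * (a + h * v)); ring.
  have dp := is_deriveZ B (is_deriveZ y
    (@is_derive1_comp _ phi1 _ u _ _ (is_derive_phi1 _) dl)).
  have := is_deriveD (is_deriveZ A (is_derive_id u (1:R))) dp.
  move=> /is_derive_eq; apply.
  rewrite /GRing.scale/= mulr1; congr (_ + B * _).
  rewrite mulrC -mulrA; congr (_ * _).
  by rewrite mulrAC yy mul1r.
have cF u : {for u, continuous F}.
  apply/differentiable_continuous/derivable1_diffP.
  by have [] := dF u.
rewrite (@continuous_FTC2 _ _ F 0 eta)//.
- rewrite /F mul0r mulr0 addr0 add0r -EFinB; congr EFin; ring.
- by apply: continuous_subspaceT => u; exact: continuous_affine_phi2.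
- split.
  + by move=> u _; have [] := dF u.
  + exact/cvg_at_right_filter/cF.
  + exact/cvg_at_left_filter/cF.
- by move=> u _; rewrite derive1E; have [_ ->] := dF u.
Qed.

End potential.

(** * Expectations and deviation bounds *)

Section expectation.
Context {R : realType} {d : measure_display} {Z : measurableType d}.
Variable P : probability Z R.

Definition bounded_measurable (f : Z -> R) :=
  measurable_fun [set: Z] f /\ exists M : R, forall z, `|f z| <= M.

Lemma bounded_measurable_integrable (f : Z -> R) :
  bounded_measurable f -> P.-integrable [set: Z] (EFin \o f).
Proof.
move=> [mf [M fM]]; apply: (@measurable_bounded_integrable _ _ _ P) => //.
  by rewrite (le_lt_trans (probability_le1 _ _))// ltry.
exists M; split; first exact: num_real.
by move=> x Mx z _; apply: le_trans (fM z) (ltW Mx).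
Qed.

Lemma bounded_measurable_cst (c : R) : bounded_measurable (fun=> c).
Proof. by split => //; exists `|c|. Qed.

Lemma bounded_measurableD (f g : Z -> R) :
  bounded_measurable f -> bounded_measurable g ->
  bounded_measurable (fun z => f z + g z).
Proof.
move=> [mf [M fM]] [mg [N gN]]; split; first exact: measurable_funD.
by exists (M + N) => z; rewrite (le_trans (ler_normD _ _))// lerD.
Qed.

Lemma bounded_measurableM (f g : Z -> R) :
  bounded_measurable f -> bounded_measurable g ->
  bounded_measurable (fun z => f z * g z).
Proof.
move=> [mf [M fM]] [mg [N gN]]; split; first exact: measurable_funM.
by exists (M * N) => z; rewrite normrM ler_pM.
Qed.

Lemma bounded_measurableZ (c : R) (f : Z -> R) :
  bounded_measurable f -> bounded_measurable (fun z => c * f z).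
Proof. exact/bounded_measurableM/bounded_measurable_cst. Qed.

Lemma bounded_measurableB (f g : Z -> R) :
  bounded_measurable f -> bounded_measurable g ->
  bounded_measurable (fun z => f z - g z).
Proof.
move=> [mf [M fM]] [mg [N gN]]; split; first exact: measurable_funB.
by exists (M + N) => z; rewrite (le_trans (ler_normB _ _))// lerD.
Qed.

Local Notation E f := (\int[P]_z f z)%R.

Lemma expectationD (f g : Z -> R) :
  bounded_measurable f -> bounded_measurable g ->
  E (fun z => f z + g z) = E f + E g.
Proof. by move=> bf bg; rewrite RintegralD//; exact: bounded_measurable_integrable. Qed.

Lemma expectationB (f g : Z -> R) :
  bounded_measurable f -> bounded_measurable g ->
  E (fun z => f z - g z) = E f - E g.
Proof. by move=> bf bg; rewrite RintegralB//; exact: bounded_measurable_integrable. Qed.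

Lemma expectationZ (c : R) (f : Z -> R) : bounded_measurable f ->
  E (fun z => c * f z) = c * E f.
Proof. by move=> bf; rewrite RintegralZl//; exact: bounded_measurable_integrable. Qed.

Lemma expectation_cst (c : R) : E (fun=> c) = c.
Proof.
have P1 : fine (P [set: Z]) = 1 by rewrite probability_setT.
rewrite Rintegral_cst// -[RHS]mulr1; congr (c * _); exact: P1.
Qed.

Lemma expectation_le (f g : Z -> R) :
  bounded_measurable f -> bounded_measurable g -> (forall z, f z <= g z) ->
  E f <= E g.
Proof. by move=> bf bg fg; apply: le_Rintegral => //; exact: bounded_measurable_integrable. Qed.

Lemma expectation_norm_le (f : Z -> R) (M : R) :
  measurable_fun [set: Z] f -> (forall z, `|f z| <= M) -> `|E f| <= M.
Proof.
move=> mf fM; have bf : bounded_measurable f by split => //; exists M.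
rewrite ler_norml -{1}(expectation_cst (- M)) -{2}(expectation_cst M).
apply/andP; split; apply: expectation_le => //;
  try exact: bounded_measurable_cst.
all: by move=> z; have := fM z; rewrite ler_norml => /andP[].
Qed.

Lemma integral_expectation (f : Z -> R) : bounded_measurable f ->
  (\int[P]_z (f z)%:E = (E f)%:E)%E.
Proof.
move=> /bounded_measurable_integrable/(integrable_fin_num measurableT) H.
by rewrite /Rintegral fineK.
Qed.

End expectation.

(** * Exponential moments and deviations of empirical means *)

Section deviation.
Context {R : realType}.

(** The quotient [(1 + x + x ^+ 2) * expR (- x)] has derivative [x * (1 - x) * expR (- x)], so on
    [x <= 1] its minimum is its value 1 at 0. *)
Lemma expR_le_quadratic (x : R) : x <= 1 -> expR x <= 1 + x + x ^+ 2.
Proof.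
move=> x1; pose g (x : R) := (1 + x + x ^+ 2) * expR (- x).
have dg (t : R) : is_derive t 1 g (t * (1 - t) * expR (- t)).
  have d1 : is_derive t 1 (fun x : R => expR (- x)) (- expR (- t)).
    have := @is_derive1_comp _ expR -%R t _ _ (is_derive_expR _)
      (is_deriveNid t 1).
    by rewrite mulrN1.
  have d2 := is_deriveD (is_deriveD (is_derive_cst (1:R) t (1:R))
    (is_derive_id t (1:R))) (is_deriveX 2 (is_derive_id t (1:R))).
  have := is_deriveM d2 d1; move=> /is_derive_eq; apply.
  rewrite /GRing.scale/= -[X in X * - _]/(1 + t + t ^+ 2); ring.
have [c [cx E]] := mean_value g _ 0 x dg.
have e0 := expR_gt0 (- c).
have : 0 <= g x - g 0.
  rewrite E subr0 mulrAC mulr_ge0 ?expR_ge0//.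
  case: cx => /andP[h1 h2].
    by rewrite !mulr_ge0//; lra.
  rewrite -mulrA (mulrC (1 - c)) mulrA mulr_ge0 ?mulr_le0//; lra.
have -> : g 0 = 1 by rewrite /g oppr0 expR0 mulr1 expr0n/= !addr0.
rewrite /g expRN subr_ge0.
by rewrite ler_pdivlMr ?expR_gt0// mul1r.
Qed.

Context {d : measure_display} {Z : measurableType d}.

(** A common interface for the two uses of the deviation bounds: draws from [D], whose expectation
    is a lower integral, and draws from a relabeled sampler, which agrees with a measure on
    measurable functions. *)
Definition dominated_by (P : sampler R Z) (mu : probability Z R) :=
  [/\ monotone_sampler P, nonneg_sampler P &
    forall (V : Z -> R) (v : R), measurable_fun [set: Z] V ->
      (forall z, 0 <= V z) -> (\int[mu]_z (V z)%:E <= v%:E)%E -> upper P V v].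

Lemma dominated_from (mu : probability Z R) : dominated_by (from mu) mu.
Proof.
split; [exact: monotone_from|exact: nonneg_from|].
by move=> V v; exact: upper_from.
Qed.

Lemma dominated_discrete (P : sampler R Z) (mu : probability Z R) :
  discrete P -> (forall f : Z -> \bar R, measurable_fun [set: Z] f ->
    (forall z, 0 <= f z)%E -> from mu f = P f) -> dominated_by P mu.
Proof.
move=> dP muE; split; [exact: monotone_discrete|exact: nonneg_discrete|].
move=> V v mV V0 Vv; apply: upper_discrete => //.
by rewrite -muE//; exact/measurable_EFinP.
Qed.

Variables (P : sampler R Z) (mu : probability Z R).
Hypothesis Pmu : dominated_by P mu.
Variable v : Z -> R.
Hypothesis mv : measurable_fun [set: Z] v.
Hypothesis v2 : forall z, `|v z| <= 2.
Let m := (\int[mu]_z v z)%R.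

(** From [|v| <= 2] follows [|v - m| <= 4], so [|t| <= 1/4] keeps the exponent at most 1, where the
    quadratic bound on [expR] is valid. The linear term has mean zero and the square is at most
    16. *)
Lemma mgf_bound (t : R) : `|t| <= 4^-1 ->
  (\int[mu]_z (expR (t * (v z - m)))%:E <= (expR (16 * t ^+ 2))%:E)%E.
Proof.
move=> t4.
have bv : bounded_measurable v by split => //; exists 2.
have m2 : `|m| <= 2 by exact: expectation_norm_le.
have w4 z : `|v z - m| <= 4.
  by rewrite (le_trans (ler_normB _ _))// (le_trans (lerD (v2 z) m2))//; lra.
have bw : bounded_measurable (fun z => t * (v z - m)).
  apply/bounded_measurableZ/bounded_measurableB => //.
  exact: bounded_measurable_cst.
have tw z : t * (v z - m) <= 1.
  rewrite (le_trans (ler_norm _))// normrM (le_trans (ler_pM _ _ t4 (w4 z)))//.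
  by rewrite mulVf.
have be : bounded_measurable (fun z => expR (t * (v z - m))).
  split; first by apply: measurableT_comp => //; case: bw.
  exists (expR 1) => z; rewrite ger0_norm ?expR_ge0// ler_expR//.
rewrite integral_expectation// lee_fin.
have bq : bounded_measurable (fun z => 1 + 16 * t ^+ 2 + t * (v z - m)).
  exact/bounded_measurableD/bw/bounded_measurable_cst.
apply: (@le_trans _ _ (\int[mu]_z (1 + 16 * t ^+ 2 + t * (v z - m)))%R).
  apply: expectation_le => // z.
  apply: le_trans (expR_le_quadratic _ (tw z)) _.
  rewrite [leRHS]addrAC lerD2l exprMn mulrC ler_wpM2r ?sqr_ge0//.
  have : `|v z - m| ^+ 2 <= 4 ^+ 2 by rewrite lerXn2r// nnegrE.
  by rewrite real_normK ?num_real// => /le_trans; apply; lra.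
rewrite expectationD//; last exact: bounded_measurable_cst.
rewrite expectation_cst expectationZ; last first.
  exact/bounded_measurableB/bounded_measurable_cst.
rewrite expectationB//; last exact: bounded_measurable_cst.
by rewrite expectation_cst subrr mulr0 addr0 expR_ge1Dx.
Qed.

Lemma upper_iid_mgf (n : nat) (t c : R) : `|t| <= 4^-1 -> 0 <= c ->
  upper (iid P n) (fun s => c * expR (t * \sum_(z <- s) (v z - m)))
    (c * expR (16 * t ^+ 2 * n%:R)).
Proof.
move=> t4 c0; have [mP P0 PV] := Pmu.
rewrite expRM_natr.
have := @upper_iid_prod _ _ P n (fun z => expR (t * (v z - m)))
  (expR (16 * t ^+ 2)) mP P0 (fun=> expR_ge0 _) (expR_ge0 _).
under [X in _ -> upper _ X _]eq_fun do rewrite mulr_sumr expR_sum.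
apply => // k k0; apply: PV.
- apply: measurable_funM => //; apply: measurableT_comp => //.
  by apply: measurable_funM => //; exact: measurable_funB.
- by move=> z; rewrite mulr_ge0// expR_ge0.
- under eq_integral do rewrite EFinM.
  rewrite ge0_integralZl_EFin//; last first.
    apply/measurable_EFinP; apply: measurableT_comp => //.
    by apply: measurable_funM => //; exact: measurable_funB.
  rewrite [leRHS]EFinM; apply: lee_wpmul2l; first by rewrite lee_fin.
  exact: mgf_bound.
Qed.

Lemma upper_deviation (n : nat) (a : R) : (0 < n)%N -> 0 < a <= 8 ->
  upper (iid P n)
    (fun s => ((a < `|n%:R^-1 * \sum_(z <- s) v z - m|)%R)%:R)
    (2 * expR (- (n%:R * a ^+ 2 / 64))).
Proof.
move=> n0 /andP[a0 a8]; have [mP P0 PV] := Pmu.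
have [mI I0] := @monotone_iid _ _ P n mP P0.
(* Minimizes [- t * a + 16 * t ^ 2], with value [- a ^ 2 / 64]; the hypothesis [a <= 8] is
   [t <= 1/4]. *)
pose t := a / 32.
have t4 : `|t| <= 4^-1 by rewrite ger0_norm /t; lra.
have nR : 0 < n%:R :> R by rewrite ltr0n.
pose c := expR (- (t * a * n%:R)).
have U := @upper_iid_mgf n t c t4 (expR_ge0 _).
have t4' : `|- t| <= 4^-1 by rewrite normrN.
have U' := @upper_iid_mgf n (- t) c t4' (expR_ge0 _).
apply: (upper_le _ _ _ _ _ mI _ _ _ (upperD _ _ _ _ _ _ U U')).
- by move=> s.
- move=> s; case: (ltP a) => [|_]; last by rewrite addr_ge0// mulr_ge0// expR_ge0.
  have -> : n%:R^-1 * \sum_(z <- s) v z - m =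
            n%:R^-1 * \sum_(z <- s) (v z - m).
    rewrite sumrB big_const_seq count_predT size_tuple iter_addr_0.
    by rewrite -[m *+ _]mulr_natl mulrBr mulrA mulVf ?mul1r// gt_eqF.
  set S := \sum_(z <- s) _.
  rewrite normrM gtr0_norm ?invr_gt0// ltr_pdivlMl//.
  rewrite /c -!expRD.
  have t0 : 0 < t by rewrite /t; lra.
  have [S0|S0] := ler0P S; rewrite ?ler0_norm ?gtr0_norm// => aS.
  + rewrite -[1%:R]add0r lerD ?expR_ge0//.
    apply: le_trans (expR_ge1Dx _); rewrite lerDl.
    have : 0 <= t * (- S - n%:R * a) by rewrite mulr_ge0 ?subr_ge0 ?ltW.
    by lra.
  + rewrite -[1%:R]addr0 lerD ?expR_ge0//.
    apply: le_trans (expR_ge1Dx _); rewrite lerDl.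
    have : 0 <= t * (S - n%:R * a) by rewrite mulr_ge0 ?subr_ge0 ?ltW.
    by lra.
- rewrite sqrrN (_ : forall x, x + x = 2 * x); last by move=> x; ring.
  rewrite ler_pM2l// /c -expRD ler_expR /t.
  by rewrite le_eqVlt; apply/orP; left; apply/eqP; field.
- by move=> s; rewrite mulr_ge0// expR_ge0.
Qed.

End deviation.

(** * Relabeled distributions and their correlations *)

Section averaged_label.
Context {R : realType} {X : Type}.
Variables (eta : R) (c : X * bool -> R -> R).
Hypothesis eta0 : 0 < eta.
Hypothesis mc : forall z, measurable_fun [set: R] (c z).
Hypothesis c01 : forall z u, 0 <= c z u <= 1.

Definition flip (p : R) (z : X * bool) : sampler R (X * bool) :=
  mix p (ret (z.1, true)) (ret (z.1, false)).

Definition mean_label (z : X * bool) : R :=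
  eta^-1 * fine (\int[@lebesgue_measure R]_(u in `[0%R, eta]) (c z u)%:E)%E.

Let mEc z (A : set R) : measurable_fun A (fun u => (c z u)%:E).
Proof. by apply/measurable_EFinP; exact: measurable_funTS. Qed.

Let mEc1 z (A : set R) : measurable_fun A (fun u => (1 - c z u)%:E).
Proof.
apply/measurable_EFinP; apply: measurable_funB; first exact: measurable_cst.
exact: measurable_funTS.
Qed.

Let c0 z u : (0 <= (c z u)%:E)%E.
Proof. by rewrite lee_fin; case/andP: (c01 z u). Qed.

Let c1 z u : (0 <= (1 - c z u)%:E)%E.
Proof. by rewrite lee_fin subr_ge0; case/andP: (c01 z u). Qed.

(** Two nonnegative integrals with a finite sum are both finite, which is what undoes the [fine] in
    [mean_label]. *)
Lemma integral_label_compl z :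
  (\int[@lebesgue_measure R]_(u in `[0%R, eta]) (c z u)%:E +
   \int[@lebesgue_measure R]_(u in `[0%R, eta]) (1 - c z u)%:E = eta%:E)%E.
Proof.
rewrite -ge0_integralD//; [|exact: mEc|exact: mEc1].
under eq_integral do rewrite -EFinD subrKC.
rewrite integral_cst//= lebesgue_measure_itv/= lte_fin eta0.
by rewrite -EFinB subr0 mul1e.
Qed.

Lemma integral_label z :
  (\int[@lebesgue_measure R]_(u in `[0%R, eta]) (c z u)%:E =
   (eta * mean_label z)%:E)%E /\
  (\int[@lebesgue_measure R]_(u in `[0%R, eta]) (1 - c z u)%:E =
   (eta * (1 - mean_label z))%:E)%E.
Proof.
have H := integral_label_compl z.
have I0 : (0 <= \int[@lebesgue_measure R]_(u in `[0%R, eta]) (c z u)%:E)%E.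
  exact: integral_ge0.
have I1 : (0 <= \int[@lebesgue_measure R]_(u in `[0%R, eta]) (1 - c z u)%:E)%E.
  exact: integral_ge0.
rewrite /mean_label.
move: H I0 I1.
set A := (\int[@lebesgue_measure R]_(u in `[0%R, eta]) (c z u)%:E)%E.
set B := (\int[@lebesgue_measure R]_(u in `[0%R, eta]) (1 - c z u)%:E)%E.
move: A B => [a| |] [b| |]//.
rewrite -EFinD => -[ab] a0 b0; rewrite /=; split; congr EFin.
  by rewrite mulrA mulfV ?mul1r// gt_eqF.
rewrite mulrBr mulr1 mulrA mulfV ?mul1r ?gt_eqF//.
by rewrite -ab addrC addKr.
Qed.

Lemma mean_label01 z : 0 <= mean_label z <= 1.
Proof.
have [E1 E2] := integral_label z.
have : (0 <= (eta * mean_label z)%:E)%E by rewrite -E1; exact: integral_ge0.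
have : (0 <= (eta * (1 - mean_label z))%:E)%E.
  by rewrite -E2; exact: integral_ge0.
by rewrite !lee_fin !(pmulr_rge0 _ eta0) subr_ge0 => -> ->.
Qed.

(** A flipped label depends on [u] only through its probability, which enters linearly, so drawing
    [u] amounts to flipping with the mean probability. This removes the only continuous draw from
    relabeling. *)
Lemma uniform_itv_flip (s : seq (X * bool)) (f : X * bool -> \bar R) :
  (forall z, 0 <= f z)%E ->
  bind (uniform_itv 0 eta)
    (fun u => bind (uniform_seq s) (fun z => flip (c z u) z)) f =
  bind (uniform_seq s) (fun z => flip (mean_label z) z) f.
Proof.
move=> f0; rewrite /bind /uniform_itv /uniform_seq /flip /mix /ret subr0.
have s0 : 0 <= (size s)%:R^-1 :> R by rewrite invr_ge0.
have mr z k : measurable_fun `[0, eta]%classic (fun u : R => (c z u)%:E * k)%E.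
  rewrite (_ : (fun u => _) = (fun u => k * (c z u)%:E)%E).
    exact: measurable_funeM.
  by apply/funext => u; rewrite muleC.
have mr1 z k :
    measurable_fun `[0, eta]%classic (fun u : R => (1 - c z u)%:E * k)%E.
  rewrite (_ : (fun u => _) = (fun u => k * (1 - c z u)%:E)%E).
    exact: measurable_funeM.
  by apply/funext => u; rewrite muleC.
have mterm z : measurable_fun `[0, eta]%classic (fun u : R =>
    (c z u)%:E * f (z.1, true) + (1 - c z u)%:E * f (z.1, false))%E.
  by apply: emeasurable_funD; [exact: mr|exact: mr1].
have term0 z u :
    (0 <= (c z u)%:E * f (z.1, true) + (1 - c z u)%:E * f (z.1, false))%E.
  by rewrite adde_ge0// mule_ge0.
rewrite ge0_integralZl_EFin//; last 2 first.
- by move=> u _; exact: sume_ge0.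
- exact: emeasurable_sum.
rewrite muleCA; congr (_ * _)%E.
rewrite ge0_integral_sum//.
rewrite ge0_sume_distrr; last by move=> z _; exact: integral_ge0.
apply: eq_bigr => z _.
rewrite ge0_integralD//; last 4 first.
- by move=> u _; rewrite mule_ge0.
- exact: mr.
- by move=> u _; rewrite mule_ge0.
- exact: mr1.
have [E1 E2] := integral_label z; have /andP[m0 m1] := mean_label01 z.
rewrite !ge0_integralZr//; [|exact: mEc1|exact: mEc].
transitivity ((eta^-1)%:E * ((eta * mean_label z)%:E * f (z.1, true) +
    (eta * (1 - mean_label z))%:E * f (z.1, false)))%E.
  by congr (_ * (_ * _ + _ * _))%E; [exact: E1|exact: E2].
rewrite ge0_muleDr; last 2 first.
- by rewrite mule_ge0// lee_fin mulr_ge0// ltW.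
- by rewrite mule_ge0// lee_fin mulr_ge0 ?subr_ge0// ltW.
by rewrite !muleA -!EFinM !mulrA mulVf ?mul1r// gt_eqF.
Qed.

End averaged_label.

Lemma discrete_flip {R : realType} {X : Type} (p : R) (z : X * bool) :
  0 <= p <= 1 -> discrete (flip p z).
Proof. by move=> p01; apply: discrete_mix => //; exact: discrete_ret. Qed.

Section relabeling.
Context {R : realType} {d : measure_display} {X : measurableType d}.
Variables (gamma : R) (q : params R).
Hypothesis gamma0 : 0 < gamma.
Hypothesis eta0 : 0 < eta q.
Hypothesis sigmaE : sigma q = eta q / gamma.
Hypothesis sigma1 : sigma q <= 1.
Hypothesis fresh0 : (0 < fresh q)%N.
Implicit Types (H h : X -> R) (g : X -> bool).

Lemma sigma_gt0 : 0 < sigma q.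
Proof. by rewrite sigmaE divr_gt0. Qed.

Lemma label_probE H h x y u : label_prob (@phi R) q H h x y u =
  (2^-1 - sigma q * phi1 (pm R y * H x) * pm R y / (2 * (eta q + sigma q)))
  + - (eta q / (2 * (eta q + sigma q))) * (phi2 (pm R y * (H x + u * h x)) * h x).
Proof. by rewrite /label_prob derive1_phi derive1_phi1; ring. Qed.

Definition clipped_label H h (z : X * bool) (u : R) : R :=
  clip01 (label_prob (@phi R) q H h z.1 z.2 u).

Lemma clipped_label01 H h z u : 0 <= clipped_label H h z u <= 1.
Proof. by rewrite /clipped_label /clip01 le_max lexx ge_max ler01 ge_min lexx. Qed.

Lemma measurable_clipped_label H h z :
  measurable_fun [set: R] (clipped_label H h z).
Proof.
apply: measurable_maxr; first exact: measurable_cst.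
apply: measurable_minr; first exact: measurable_cst.
suff : measurable_fun [set: R] (label_prob (@phi R) q H h z.1 z.2) by [].
rewrite (funext (label_probE H h z.1 z.2)).
apply: continuous_measurable_fun => u; exact: continuous_affine_phi2.
Qed.

Definition relabel_mean H h := mean_label (eta q) (clipped_label H h).

Lemma relabeled_cons Dh h (past : history R X) Dhat (f : X * bool -> \bar R) :
  (forall z, 0 <= f z)%E ->
  relabeled (@phi R) q ((Dh, h) :: past) Dhat f =
  mix (1 - sigma q) (relabeled (@phi R) q past Dh)
    (bind (uniform_seq Dhat)
       (fun z => flip (relabel_mean (ensemble q past) h z) z)) f.
Proof.
move=> f0; rewrite [LHS]/=  /mix; congr (_ + _ * _)%E.
have := @uniform_itv_flip R X (eta q) (clipped_label (ensemble q past) h) eta0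
  (measurable_clipped_label _ _) (clipped_label01 _ _) Dhat f f0.
by [].
Qed.

(** The invariant of the histories that a run reaches; the type [history] itself allows arbitrary
    functions. With [gamma <= 1], the bound [gamma^-1] covers both [W / gamma] and [- sign H]. *)
Fixpoint admissible (past : history R X) : Prop :=
  match past with
  | [::] => True
  | (Dh, h) :: past' =>
      [/\ size Dh = fresh q, measurable_fun [set: X] h,
          forall x, `|h x| <= gamma^-1 & admissible past']
  end.

Lemma discrete_relabeled (past : history R X) Dhat :
  admissible past -> (0 < size Dhat)%N -> discrete (relabeled (@phi R) q past Dhat).
Proof.
elim: past Dhat => [|[Dh h] past IH] Dhat.
  by move=> _; exact: discrete_uniform_seq.
move=> [sD _ _ ap] D0.
have s0 := sigma_gt0.
have [l [l0 l1 lE]] : discrete (mix (1 - sigma q) (relabeled (@phi R) q past Dh)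
    (bind (uniform_seq Dhat)
       (fun z => flip (relabel_mean (ensemble q past) h z) z))).
  apply: discrete_mix; first by rewrite subr_ge0 sigma1/= gerBl ltW.
    by apply: IH => //; rewrite sD.
  apply: discrete_bind; first exact: discrete_uniform_seq.
  move=> z; apply: discrete_flip; apply: mean_label01 => //.
    exact: measurable_clipped_label.
  exact: clipped_label01.
by exists l; split => // f f0; rewrite relabeled_cons// lE.
Qed.

Lemma measurable_ensemble (past : history R X) :
  admissible past -> measurable_fun [set: X] (ensemble q past).
Proof.
elim: past => [|[Dh h] past IH] /=; first by move=> _; exact: measurable_cst.
move=> [_ mh _ ap]; apply: measurable_funD; first exact: IH.
exact: measurable_funM.
Qed.

Lemma ensemble_bound (past : history R X) x :
  admissible past -> `|ensemble q past x| <= (size past)%:R * sigma q.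
Proof.
elim: past => [|[Dh h] past IH] /=; first by rewrite normr0 mul0r.
move=> [_ _ hg ap]; rewrite -natr1 mulrDl mul1r.
rewrite (le_trans (ler_normD _ _))// lerD ?IH//.
by rewrite normrM gtr0_norm// sigmaE ler_pM2l.
Qed.

End relabeling.

Section agreement.
Context {R : realType} {d : measure_display} {X : measurableType d}.
Implicit Types (g : X -> bool).

Lemma measurable_pm : measurable_fun [set: bool] (@pm R).
Proof. by []. Qed.

Lemma pm_sqr (b : bool) : pm R b * pm R b = 1.
Proof. by case: b; rewrite /= ?mulr1 ?mulrNN ?mulr1. Qed.

Lemma norm_pm (b : bool) : `|pm R b| = 1.
Proof. by case: b; rewrite /= ?normrN normr1. Qed.

Definition agreement g (z : X * bool) : R := pm R z.2 * pm R (g z.1).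

Lemma norm_agreement g z : `|agreement g z| = 1.
Proof. by rewrite /agreement normrM !norm_pm mulr1. Qed.

Lemma agreement_ge0 g z : 0 <= 1 + agreement g z.
Proof.
by have := lexx `|agreement g z|; rewrite {2}norm_agreement ler_norml; lra.
Qed.

Lemma measurable_label : measurable_fun [set: X * bool] (fun z => pm R z.2).
Proof. exact: measurableT_comp measurable_pm measurable_snd. Qed.

Lemma measurable_pm_comp g : measurable_fun [set: X] g ->
  measurable_fun [set: X * bool] (fun z => pm R (g z.1)).
Proof.
move=> mg; apply: measurableT_comp measurable_pm _.
exact: measurableT_comp mg measurable_fst.
Qed.

Lemma bounded_measurable_agreement g : measurable_fun [set: X] g ->
  bounded_measurable (agreement g).
Proof.
move=> mg; split; last by exists 1 => z; rewrite norm_agreement.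
apply: measurable_funM; first exact: measurable_label.
exact: measurable_pm_comp.
Qed.

Lemma corr_norm (D : probability (X * bool)%type R) g :
  measurable_fun [set: X] g -> `|corr D g| <= 1.
Proof.
move=> mg; apply: expectation_norm_le.
  by case: (bounded_measurable_agreement _ mg).
by move=> z; rewrite -/(agreement g z) norm_agreement.
Qed.

(** Samplers are controlled on nonnegative functions, hence the shift by 1 before taking the
    expectation. *)
Definition sampler_corr (P : sampler R (X * bool)) g : R :=
  fine (P (fun z => (1 + agreement g z)%:E)) - 1.

Lemma sampler_corrE (P : sampler R (X * bool)) g : discrete P ->
  (P (fun z => (1 + agreement g z)%:E) = (1 + sampler_corr P g)%:E)%E /\
  `|sampler_corr P g| <= 1.
Proof.
move=> dP; rewrite /sampler_corr.
have f0 z : (0 <= (1 + agreement g z)%:E)%E by rewrite lee_fin agreement_ge0.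
have := nonneg_discrete _ dP _ f0.
have : (P (fun z => (1 + agreement g z)%:E) <= 2%:E)%E.
  rewrite -(discrete_cst P 2 dP)//; apply: monotone_discrete => // z.
  rewrite lee_fin; have := lexx `|agreement g z|.
  by rewrite {2}norm_agreement ler_norml; lra.
case: (P _) => [r| |]//; rewrite !lee_fin /= => r2 r0; split.
  by congr EFin; ring.
by rewrite ler_norml; lra.
Qed.

Lemma corr_discrete (P : sampler R (X * bool)) (D : probability (X * bool)%type R) g :
  discrete P -> (forall f : X * bool -> \bar R,
    measurable_fun [set: X * bool] f -> (forall z, 0 <= f z)%E ->
    from D f = P f) ->
  measurable_fun [set: X] g -> corr D g = sampler_corr P g.
Proof.
move=> dP DP mg; have [PE _] := sampler_corrE P g dP.
have ba := bounded_measurable_agreement g mg.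
have b1 : bounded_measurable (fun z : X * bool => 1 : R).
  exact: bounded_measurable_cst.
have := integral_expectation D _ (bounded_measurableD _ _ b1 ba).
rewrite expectationD// expectation_cst -/(corr D g) => DE.
have : (1 + corr D g)%:E = (1 + sampler_corr P g)%:E.
  rewrite -DE -PE; apply: DP; last by move=> z; rewrite lee_fin agreement_ge0.
  by apply/measurable_EFinP; case: (bounded_measurableD _ _ b1 ba).
by move=> [] /addrI.
Qed.

End agreement.

(** * The recursion for correlations of relabeled distributions *)

Section correlation.
Context {R : realType} {d : measure_display} {X : measurableType d}.
Variables (gamma : R) (q : params R).
Variable D : probability (X * bool)%type R.
Hypothesis gamma0 : 0 < gamma.
Hypothesis eta0 : 0 < eta q.
Hypothesis sigmaE : sigma q = eta q / gamma.
Hypothesis sigma1 : sigma q <= 1.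
Hypothesis fresh0 : (0 < fresh q)%N.
Implicit Types (H h : X -> R) (g : X -> bool).

Let s0 : 0 < sigma q. Proof. exact: (sigma_gt0 gamma). Qed.

Let es0 : 0 < eta q + sigma q. Proof. exact: addr_gt0. Qed.

Definition slope H g (z : X * bool) : R :=
  - phi1 (pm R z.2 * H z.1) * pm R z.2 * pm R (g z.1).

Definition mean_slope H g : R := (\int[D]_z slope H g z)%R.

(* The expectation of a relabeled example, seen as a telescoping increment:
   the fundamental theorem of calculus turns the average of phi'' over eta'
   into a difference of slopes. *)
Definition increment H h g (z : X * bool) : R :=
  (slope (fun x => H x + eta q * h x) g z - (1 - sigma q) * slope H g z)
  / (eta q + sigma q).

Definition dataset_mean (s : seq (X * bool)) (v : X * bool -> R) : R :=
  (size s)%:R^-1 * \sum_(z <- s) v z.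

(* The first dataset is left out: its weight [(1 - sigma) ^ (t - 1)] is
   negligible after the burn-in rounds. *)
Fixpoint noise g (hist : history R X) : R :=
  match hist with
  | (Dhat, _) :: (((_, h) :: past') as past) =>
      (1 - sigma q) * noise g past
      + sigma q * (dataset_mean Dhat (increment (ensemble q past') h g)
                   - \int[D]_z increment (ensemble q past') h g z)%R
  | _ => 0
  end.

Lemma norm_slope H g z : `|slope H g z| <= 1.
Proof.
rewrite /slope !normrM !norm_pm !mulr1 normrN.
by have := phi1_bound (pm R z.2 * H z.1); rewrite ler_norml; lra.
Qed.

Lemma measurable_slope H g :
  measurable_fun [set: X] H -> measurable_fun [set: X] g ->
  measurable_fun [set: X * bool] (slope H g).
Proof.
move=> mH mg; apply: measurable_funM; last exact: measurable_pm_comp.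
apply: measurable_funM; last exact: measurable_label.
apply: (@measurable_funN _ _ _ _ (fun z : X * bool => phi1 (pm R z.2 * H z.1))).
apply: measurableT_comp.
  by apply: continuous_measurable_fun => u; exact: continuous_phi1.
apply: measurable_funM; first exact: measurable_label.
exact: measurableT_comp mH measurable_fst.
Qed.

Lemma bounded_measurable_slope H g :
  measurable_fun [set: X] H -> measurable_fun [set: X] g ->
  bounded_measurable (slope H g).
Proof.
move=> mH mg; split; first exact: measurable_slope.
by exists 1 => z; exact: norm_slope.
Qed.

(** The reason for [sigma = eta / gamma]: the numerator is [sigma] times a slope plus a change of
    slope, and as [phi1] is 1-Lipschitz the change is at most [eta * |h| <= eta / gamma = sigma].
    Dividing [2 * sigma] by [eta + sigma] leaves at most 2. *)
Lemma norm_increment H h g z : `|h z.1| <= gamma^-1 ->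
  `|increment H h g z| <= 2.
Proof.
move=> hg; rewrite /increment normrM normfV (gtr0_norm es0) ler_pdivrMr//.
set H' := fun x => _.
have -> : slope H' g z - (1 - sigma q) * slope H g z =
    sigma q * slope H g z + (slope H' g z - slope H g z) by ring.
rewrite (le_trans (ler_normD _ _))// normrM (gtr0_norm s0).
have : `|slope H' g z - slope H g z| <= sigma q.
  rewrite /slope -!mulrBl normrM norm_pm mulr1 normrM norm_pm mulr1.
  rewrite opprK addrC.
  apply: le_trans (phi1_lipschitz _ _) _.
  rewrite -mulrBr normrM norm_pm mul1r distrC /H' addrC addKr normrM gtr0_norm//.
  by rewrite sigmaE ler_pM2l.
have : sigma q * `|slope H g z| <= sigma q.
  by rewrite -[leRHS]mulr1 ler_pM2l// norm_slope.
by have := eta0; lra.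
Qed.

Lemma mean_increment H h g :
  measurable_fun [set: X] H -> measurable_fun [set: X] h ->
  measurable_fun [set: X] g ->
  bounded_measurable (increment H h g) /\
  (\int[D]_z increment H h g z)%R =
    (mean_slope (fun x => H x + eta q * h x) g
      - (1 - sigma q) * mean_slope H g) / (eta q + sigma q).
Proof.
move=> mH mh mg; pose H' x := H x + eta q * h x.
have mH' : measurable_fun [set: X] H'.
  by apply: measurable_funD => //; exact: measurable_funM.
have b1 := bounded_measurable_slope H g mH mg.
have b2 := bounded_measurable_slope H' g mH' mg.
have b3 := bounded_measurableB _ _ b2 (bounded_measurableZ (1 - sigma q) _ b1).
have iE z : increment H h g z = (eta q + sigma q)^-1 *
    (slope H' g z - (1 - sigma q) * slope H g z) by rewrite mulrC.
have -> : increment H h g = (fun z => (eta q + sigma q)^-1 *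
    (slope H' g z - (1 - sigma q) * slope H g z)) by apply/funext.
split; first exact: bounded_measurableZ.
rewrite expectationZ// expectationB//; last exact: bounded_measurableZ.
by rewrite expectationZ// mulrC.
Qed.

(** The label bias is [2 * p - 1]. Validity removes the truncation, so that the integrand is affine
    in [phi2] and integrates in closed form. *)
Lemma relabel_mean_valid H h z :
  (forall u, 0 <= u <= eta q ->
    0 <= label_prob (@phi R) q H h z.1 z.2 u <= 1) ->
  forall g, (2 * relabel_mean q H h z - 1) * pm R (g z.1) = increment H h g z.
Proof.
move=> valid g; rewrite /relabel_mean /mean_label.
set A := 2^-1 - sigma q * phi1 (pm R z.2 * H z.1) * pm R z.2 /
  (2 * (eta q + sigma q)).
have -> : (\int[@lebesgue_measure R]_(u in `[0%R, eta q])
    (clipped_label q H h z u)%:E = \int[@lebesgue_measure R]_(u in `[0%R, eta q])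
    (A + - (eta q / (2 * (eta q + sigma q))) *
      (phi2 (pm R z.2 * (H z.1 + u * h z.1)) * h z.1))%:E)%E.
  apply: eq_integral => u; rewrite inE/= in_itv/= => ui.
  rewrite -label_probE /clipped_label /clip01; have /andP[p0 p1] := valid u ui.
  by congr EFin; rewrite (min_idPr p1) (max_idPr p0).
rewrite integral_affine_phi2 ?pm_sqr//= /increment /slope /A.
field; rewrite ?gt_eqF//.
Qed.

Lemma sampler_corr_relabeled Dh h (past : history R X) Dhat g :
  admissible gamma q ((Dh, h) :: past) -> (0 < size Dhat)%N ->
  sampler_corr (relabeled (@phi R) q ((Dh, h) :: past) Dhat) g =
  (1 - sigma q) * sampler_corr (relabeled (@phi R) q past Dh) g +
  sigma q * dataset_mean Dhat (fun z =>
    (2 * relabel_mean q (ensemble q past) h z - 1) * pm R (g z.1)).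
Proof.
move=> ap D0; have [sD mh hg ap'] := ap.
have f0 z : (0 <= (1 + agreement g z)%:E :> \bar R)%E.
  by rewrite lee_fin agreement_ge0.
have d1 : discrete (relabeled (@phi R) q past Dh).
  by apply: (discrete_relabeled gamma) => //; rewrite sD.
have d2 : discrete (relabeled (@phi R) q ((Dh, h) :: past) Dhat).
  exact: (discrete_relabeled gamma).
have [E1 _] := sampler_corrE _ g d1.
have [E2 _] := sampler_corrE _ g d2.
have : (1 + sampler_corr (relabeled (@phi R) q ((Dh, h) :: past) Dhat) g)%:E =
   ((1 - sigma q) * (1 + sampler_corr (relabeled (@phi R) q past Dh) g) +
    sigma q * (1 + dataset_mean Dhat (fun z =>
    (2 * relabel_mean q (ensemble q past) h z - 1) * pm R (g z.1))))%:E.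
  rewrite -E2 relabeled_cons// /mix E1 subKr.
  rewrite [RHS]EFinD; congr (_ + _)%E; rewrite [RHS]EFinM//; congr (_ * _)%E.
  rewrite /bind /uniform_seq /flip /mix /ret /agreement/= /dataset_mean.
  under eq_bigr do rewrite -!EFinM -EFinD.
  rewrite sumEFin -EFinM; congr EFin.
  transitivity ((size Dhat)%:R^-1 * ((size Dhat)%:R + \sum_(z <- Dhat)
      (2 * relabel_mean q (ensemble q past) h z - 1) * pm R (g z.1))); last first.
    by rewrite mulrDr mulVf// pnatr_eq0 -lt0n.
  congr (_ * _).
  have -> : (size Dhat)%:R = \sum_(z <- Dhat) 1 :> R.
    by rewrite big_const_seq count_predT iter_addr_0.
  by rewrite -big_split/=; apply: eq_bigr => z _; ring.
move=> [] E; lra.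
Qed.

(** A round multiplies the signed error by exactly [1 - sigma]: the mean of the increment, which
    [noise] subtracts, supplies the new slope and cancels the damped old one. The 2 is the error of
    the first round, where a correlation and a weighted slope are each at most 1. *)
Lemma corr_decomposition g Dhat h0 (past : history R X) :
  measurable_fun [set: X] g ->
  admissible gamma q past -> size Dhat = fresh q ->
  labels_valid (@phi R) q ((Dhat, h0) :: past) ->
  `|sampler_corr (relabeled (@phi R) q past Dhat) g
    - sigma q / (eta q + sigma q) * mean_slope (ensemble q past) g
    - noise g ((Dhat, h0) :: past)| <= 2 * (1 - sigma q) ^+ size past.
Proof.
move=> mg; elim: past Dhat h0 => [|[Dh h] past IH] Dhat h0 ap sD valid.
  rewrite expr0 mulr1 /= subr0 (le_trans (ler_normB _ _))//.
  rewrite (_ : 2 = 1 + 1)// lerD//.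
    have d1 : discrete (relabeled (@phi R) q [::] Dhat).
      by apply: discrete_uniform_seq; rewrite sD.
    by have [] := sampler_corrE _ g d1.
  have k0 : 0 <= sigma q / (eta q + sigma q) by rewrite divr_ge0// ltW.
  rewrite normrM (ger0_norm k0) mulr_ile1//.
    by rewrite ler_pdivrMr// mul1r lerDr ltW.
  apply: expectation_norm_le; last by move=> z; exact: norm_slope.
  by apply: measurable_slope => //; exact: measurable_cst.
have [sD' mh hg ap'] := ap; have [vD vp] := valid.
rewrite sampler_corr_relabeled ?sD//=.
have mH := measurable_ensemble gamma q past ap'.
have [bi ->] := mean_increment _ _ _ mH mh mg.
have -> : dataset_mean Dhat (fun z =>
    (2 * relabel_mean q (ensemble q past) h z - 1) * pm R (g z.1)) =
    dataset_mean Dhat (increment (ensemble q past) h g).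
  congr (_ * _); rewrite !big_seq; apply: eq_bigr => -[x y] zD.
  by apply: relabel_mean_valid => u ui; exact: vD.
have := IH Dh h ap' sD' vp.
set m1 := mean_slope _ g; set m2 := mean_slope _ g.
set c := sampler_corr _ g; set N := noise _ _; set V := dataset_mean _ _ => IH'.
have -> : (1 - sigma q) * c + sigma q * V
    - sigma q / (eta q + sigma q) * m2
    - ((1 - sigma q) * N + sigma q *
       (V - (m2 - (1 - sigma q) * m1) / (eta q + sigma q))) =
  (1 - sigma q) * (c - sigma q / (eta q + sigma q) * m1 - N) by ring.
rewrite normrM ger0_norm ?subr_ge0// exprS mulrCA.
by rewrite ler_wpM2l// subr_ge0.
Qed.

End correlation.

(** * Decrease of the potential *)

Section potential_argument.
Context {R : realType} {d : measure_display} {X : measurableType d}.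
Variables (gamma : R) (q : params R).
Variable D : probability (X * bool)%type R.
Hypothesis gamma0 : 0 < gamma.
Hypothesis gamma1 : gamma <= 1.
Hypothesis eta0 : 0 < eta q.
Hypothesis sigmaE : sigma q = eta q / gamma.
Hypothesis sigma1 : sigma q <= 1.
Hypothesis fresh0 : (0 < fresh q)%N.
Implicit Types (H h : X -> R) (g : X -> bool).

Definition potential H : R := (\int[D]_z phi (pm R z.2 * H z.1))%R.

Lemma bounded_measurable_phi H (M : R) : measurable_fun [set: X] H ->
  (forall x, `|H x| <= M) ->
  bounded_measurable (fun z : X * bool => phi (pm R z.2 * H z.1)).
Proof.
move=> mH HM; split.
  apply: measurableT_comp.
    by apply: continuous_measurable_fun => u; exact: continuous_phi.
  apply: measurable_funM; first exact: measurable_label.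
  exact: measurableT_comp mH measurable_fst.
exists (2 + M) => z; rewrite ger0_norm ?phi_ge0//.
have := phi_lipschitz 0 (pm R z.2 * H z.1).
rewrite [phi 0]/phi lexx !subr0 normrM norm_pm mul1r => L.
rewrite -lerBlDl (le_trans (ler_norm _))// (le_trans L)//.
Qed.

Lemma potential_ge0 H : 0 <= potential H.
Proof. by apply: Rintegral_ge0 => z _; exact: phi_ge0. Qed.

Lemma potential0 : potential (fun=> 0) = 2.
Proof.
rewrite /potential -[RHS](expectation_cst D).
by apply: eq_Rintegral => z _; rewrite mulr0 /phi lexx subr0.
Qed.

(** The scalar [k] is [gamma^-1] for an accepted weak hypothesis and [-1] for the fallback
    direction. Squares of signs are 1, so the quadratic term of [phi_smooth] is the same for every
    example. *)
Lemma potential_step H g (k M : R) : measurable_fun [set: X] H ->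
  (forall x, `|H x| <= M) -> measurable_fun [set: X] g ->
  potential (fun x => H x + eta q * (k * pm R (g x))) <=
  potential H - eta q * k * mean_slope D H g + (eta q * k) ^+ 2 / 2.
Proof.
move=> mH HM mg; pose H' x := H x + eta q * (k * pm R (g x)).
have mpg : measurable_fun [set: X] (fun x => pm R (g x)).
  exact: measurableT_comp measurable_pm mg.
have mH' : measurable_fun [set: X] H'.
  by apply: measurable_funD => //; do 2 apply: measurable_funM => //.
have H'M x : `|H' x| <= M + `|eta q * k|.
  rewrite (le_trans (ler_normD _ _))// lerD// mulrA normrM norm_pm mulr1.
  exact: lexx.
have b1 := bounded_measurable_phi H M mH HM.
have b2 := bounded_measurable_phi H' _ mH' H'M.
have b3 := bounded_measurable_slope H g mH mg.
rewrite -(expectation_cst D ((eta q * k) ^+ 2 / 2)) /potential /mean_slope.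
have bc := bounded_measurable_cst ((eta q * k) ^+ 2 / 2 : R) (Z := (X * bool)%type).
have b4 := bounded_measurableB _ _ b1 (bounded_measurableZ (eta q * k) _ b3).
rewrite -expectationZ// -expectationB//; last exact: bounded_measurableZ.
rewrite -expectationD//; apply: expectation_le => //.
  exact: bounded_measurableD.
move=> z; rewrite mulrDr.
apply: le_trans (phi_smooth _ _) _.
rewrite /slope le_eqVlt; apply/orP; left; apply/eqP.
rewrite (_ : (pm R z.2 * (eta q * (k * pm R (g z.1)))) ^+ 2 =
  (eta q * k) ^+ 2 * (pm R z.2 * pm R z.2) * (pm R (g z.1) * pm R (g z.1)))%R;
  last by ring.
by rewrite !pm_sqr; ring.
Qed.

(** The crude bound for burn-in rounds: with [K = gamma^-1] the potential rises by at most
    [eta / gamma = sigma]. *)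
Lemma potential_lipschitz H h (M K : R) : measurable_fun [set: X] H ->
  (forall x, `|H x| <= M) -> measurable_fun [set: X] h ->
  (forall x, `|h x| <= K) ->
  potential (fun x => H x + eta q * h x) <= potential H + eta q * K.
Proof.
move=> mH HM mh hK; pose H' x := H x + eta q * h x.
have mH' : measurable_fun [set: X] H'.
  by apply: measurable_funD => //; exact: measurable_funM.
have hK' x : `|eta q * h x| <= eta q * K.
  by rewrite normrM gtr0_norm// ler_pM2l.
have H'M x : `|H' x| <= M + eta q * K.
  by rewrite (le_trans (ler_normD _ _))// lerD.
have b1 := bounded_measurable_phi H M mH HM.
have b2 := bounded_measurable_phi H' _ mH' H'M.
rewrite -(expectation_cst D (eta q * K)) /potential.
have bc := bounded_measurable_cst (eta q * K : R) (Z := (X * bool)%type).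
rewrite -expectationD//; apply: expectation_le => //.
  exact: bounded_measurableD.
move=> z; rewrite -lerBlDl (le_trans (ler_norm _))//.
rewrite (le_trans (phi_lipschitz _ _))// -mulrBr normrM norm_pm mul1r.
by rewrite addrC addKr.
Qed.

Lemma measurable_sign H : measurable_fun [set: X] H ->
  measurable_fun [set: X] (sign H).
Proof. by move=> mH; apply: measurable_fun_ler => //; exact: measurable_cst. Qed.

(* Where [g] and [sign H] disagree, the label agrees with only one of them:
   if with [sign H], then [- phi' <= 1] is enough; if with [g], then
   [y H x <= 0] and [- phi' = 1]. *)
Lemma corr_gap H g : measurable_fun [set: X] H -> measurable_fun [set: X] g ->
  corr D g - corr D (sign H) <= mean_slope D H g - mean_slope D H (sign H).
Proof.
move=> mH mg; have ms := measurable_sign H mH.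
have b1 := bounded_measurable_slope H g mH mg.
have b2 := bounded_measurable_slope H _ mH ms.
have b3 := bounded_measurable_agreement (R := R) g mg.
have b4 := bounded_measurable_agreement (R := R) _ ms.
rewrite /corr -/(\int[D]_z agreement g z)%R -expectationB// -expectationB//.
apply: expectation_le; [exact: bounded_measurableB|exact: bounded_measurableB|].
move=> [x y]; rewrite /slope /agreement /sign/=.
have := phi1_bound (pm R y * H x).
case: (leP 0 (H x)) => Hx; case: (g x); case: y => /=; rewrite ?mul1r ?mulN1r;
  rewrite /phi1 ?oppr_le0 ?oppr_ge0 ?Hx ?(ltW Hx); by [lra|case: ifP; lra].
Qed.

Lemma edge_ratio : sigma q / (eta q + sigma q) = (1 + gamma)^-1.
Proof.
have s0 := sigma_gt0 gamma q gamma0 eta0 sigmaE.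
have -> : eta q = gamma * sigma q by rewrite sigmaE mulrCA mulfV ?mulr1// gt_eqF.
rewrite (_ : gamma * sigma q + sigma q = sigma q * (1 + gamma)); last by ring.
by rewrite invfM mulrA mulfV ?mul1r// gt_eqF.
Qed.

Variables (eps e0 : R) (B : {fset (X -> bool)}) (hstar : X -> bool).
Hypothesis eps0 : 0 < eps.
Hypothesis e00 : 0 < e0.
Hypothesis etaE : eta q = gamma ^+ 2 * eps / 64.
Hypothesis tauE : tau q = gamma * eps / 16.
Hypothesis mB : forall g, g \in B -> measurable_fun [set: X] g.
Hypothesis mhstar : measurable_fun [set: X] hstar.

(** What a call to the weak learner certifies when empirical and true correlations under the
    relabeled law differ by at most [a]: either an accepted hypothesis with correlation nearly above
    [tau], or a rejection, which bounds the correlation of [hstar] through the guarantee. *)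
Definition learned (a : R) (hist : history R X) : Prop :=
  if hist is (Dhat, h) :: past then
    let P := relabeled (@phi R) q past Dhat in
    (exists2 w, w \in B & h = (fun x => gamma^-1 * pm R (w x)) /\
       tau q - a <= sampler_corr P w) \/
    (h = (fun x => -1 * pm R (sign (ensemble q past) x)) /\
       gamma * sampler_corr P hstar - e0 <= tau q + a)
  else True.

Definition quiet (a : R) (hist : history R X) : Prop :=
  forall g, g \in B \/ g = hstar -> `|noise q D g hist| <= a.

(** The total error [eps] is spent in quarters: the suboptimality of [hstar], the margin here, and
    one post-selection error each for this candidate and for the selected one. *)
Definition near_optimal g : Prop :=
  corr D hstar - 2 * e0 / gamma - eps / 4 <= corr D g.

Definition progress (hist : history R X) : Prop :=
  if hist is (Dhat, h) :: past then
    near_optimal (sign (ensemble q past)) \/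
    potential (ensemble q hist) <=
      potential (ensemble q past) - eta q * eps / 32
  else True.

Lemma round_progress (hist : history R X) : (0 < size hist)%N ->
  admissible gamma q hist -> labels_valid (@phi R) q hist ->
  2 * (1 - sigma q) ^+ (size hist).-1 <= gamma * eps / 128 ->
  quiet (gamma * eps / 128) hist -> learned (gamma * eps / 128) hist ->
  progress hist.
Proof.
case: hist => [//|[Dhat h] past] _ ap valid small qt.
set a := gamma * eps / 128 in small qt *.
have a0 : 0 < a by rewrite /a divr_gt0// mulr_gt0.
have [sD mh hg ap'] := ap.
have mH := measurable_ensemble gamma q past ap'.
have HM x := ensemble_bound gamma q eta0 sigmaE past x ap'.
have dec g (mg : measurable_fun [set: X] g) (gB : g \in B \/ g = hstar) :
    `|sampler_corr (relabeled (@phi R) q past Dhat) g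
       - (1 + gamma)^-1 * mean_slope D (ensemble q past) g| <= 2 * a.
  have := corr_decomposition gamma q D gamma0 eta0 sigmaE sigma1 fresh0
    g Dhat h past mg ap' sD valid.
  rewrite edge_ratio => /le_trans/(_ small) L.
  have N := qt g gB; move: L N; rewrite !ler_norml; lra.
have kappa0 : 0 < (1 + gamma)^-1 by rewrite invr_gt0 addr_gt0.
have kappa1 : (1 + gamma)^-1 <= 1.
  by rewrite invf_le1 ?addr_gt0// lerDl ltW.
have egE : eta q / gamma = gamma * eps / 64.
  by rewrite etaE; field; rewrite gt_eqF.
case=> [[w wB [hE cw]]|[hE cs]].
- right; rewrite /= hE.
  apply: le_trans (potential_step _ w gamma^-1 _ mH HM (mB w wB)) _.
  have G5 : 5 * a <= mean_slope D (ensemble q past) w.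
    have := dec w (mB w wB) (or_introl wB); rewrite ler_norml => /andP[_ L].
    have kG : 5 * a <= (1 + gamma)^-1 * mean_slope D (ensemble q past) w.
      by move: L cw; rewrite tauE /a; lra.
    have G0 : 0 < mean_slope D (ensemble q past) w.
      by rewrite -(pmulr_rgt0 _ kappa0); apply: lt_le_trans kG; rewrite mulr_gt0.
    apply: le_trans kG _; rewrite -[leRHS]mul1r ler_wpM2r// ltW//.
  have : eta q / gamma * (5 * a) <=
      eta q / gamma * mean_slope D (ensemble q past) w.
    by rewrite ler_wpM2l// divr_ge0// ltW.
  (* The first-order gain is five units of [eta * eps / 128] and the second-order loss one unit;
     four units are [eta * eps / 32]. *)
  have -> : (eta q / gamma) ^+ 2 / 2 = eta q * eps / 128.
    by rewrite etaE; field; rewrite gt_eqF.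
  have -> : eta q / gamma * (5 * a) = 5 * (eta q * eps / 128).
    by rewrite /a; field; rewrite gt_eqF.
  by lra.
- have mhs := measurable_sign _ mH.
  (* Here [9 * a] is [tau + a], and multiplying by [1 + gamma <= 2] gives [18 * eps / 128] plus at
     most [4 * eps / 128]. *)
  have Gs : mean_slope D (ensemble q past) hstar <= 2 * e0 / gamma + 22 * eps / 128.
    have := dec _ mhstar (or_intror erefl); rewrite ler_norml => /andP[L _].
    have cs' : sampler_corr (relabeled (@phi R) q past Dhat) hstar <=
        (9 * a + e0) / gamma.
      by rewrite ler_pdivlMr// mulrC; move: cs; rewrite tauE /a; lra.
    have kG : (1 + gamma)^-1 * mean_slope D (ensemble q past) hstar <=
        (9 * a + e0) / gamma + 2 * a by lra.
    have g2 : 0 < 1 + gamma by rewrite addr_gt0.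
    have : mean_slope D (ensemble q past) hstar <=
        (1 + gamma) * ((9 * a + e0) / gamma + 2 * a).
      by rewrite -ler_pdivrMl.
    move=> /le_trans; apply.
    have c0 : 0 <= (9 * a + e0) / gamma + 2 * a.
      by rewrite addr_ge0 ?mulr_ge0 ?invr_ge0 ?addr_ge0 ?mulr_ge0// ltW.
    apply: (@le_trans _ _ (2 * ((9 * a + e0) / gamma + 2 * a))).
      by apply: ler_wpM2r => //; have := gamma1; lra.
    have -> : 2 * ((9 * a + e0) / gamma + 2 * a) =
        2 * e0 / gamma + 18 * eps / 128 + 4 * (gamma * eps) / 128.
      by rewrite /a; field; rewrite gt_eqF.
    have : gamma * eps <= eps by rewrite -[leRHS]mul1r ler_pM2r.
    by lra.
  (* At slope [- 5 * eps / 128] the step against the sign gains five units of [eta * eps / 128] and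
     loses at most one. Above it, the gap to [hstar] is at most
     [2 * e0 / gamma + (22 + 5) * eps / 128], within the allowed [eps / 4]. *)
  have [G0|G0] := leP (mean_slope D (ensemble q past) (sign (ensemble q past)))
    (- (5 * eps / 128)).
  + right; rewrite /= hE.
    apply: le_trans (potential_step _ _ (-1) _ mH HM mhs) _.
    have : eta q * mean_slope D (ensemble q past) (sign (ensemble q past)) <=
      eta q * (- (5 * eps / 128)) by rewrite ler_pM2l.
    have : eta q * eta q <= eta q * (eps / 64).
      rewrite ler_pM2l// etaE -mulrA -[leRHS]mul1r ler_pM2r ?divr_gt0//.
      by rewrite exprn_ile1// ltW.
    rewrite mulrN1 sqrrN expr2. lra.
  + left; rewrite /near_optimal.
    have := corr_gap _ _ mH mhstar; have := eps0; lra.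
Qed.

Lemma admissible_drop k (hist : history R X) :
  admissible gamma q hist -> admissible gamma q (drop k hist).
Proof.
elim: k hist => [|k IH] hist; first by rewrite drop0.
by case: hist => [//|[Dh h] p] [_ _ _] /IH.
Qed.

Lemma labels_valid_drop k (hist : history R X) :
  labels_valid (@phi R) q hist -> labels_valid (@phi R) q (drop k hist).
Proof.
elim: k hist => [|k IH] hist; first by rewrite drop0.
case: hist => [//|[Dh h] p] valid; apply: IH.
by case: p valid => [//|[Dh' h'] p'] [].
Qed.

(** The potential starts at [phi 0 = 2], rises by at most [sigma] in each of the first [T0] rounds
    and falls in the later ones unless a near-optimal sign occurs. [minn] and truncated subtraction
    let one induction cover both phases. *)
Lemma good_candidate (T0 : nat) (hist : history R X) :
  admissible gamma q hist ->
  (forall k, (T0 + k < size hist)%N -> progress (drop k hist)) ->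
  (exists2 k, (0 < k <= size hist)%N &
     near_optimal (sign (ensemble q (drop k hist)))) \/
  potential (ensemble q hist) <= 2 + (minn (size hist) T0)%:R * sigma q
    - (size hist - T0)%:R * (eta q * eps / 32).
Proof.
elim: hist => [|[Dh h] past IH] ap prog.
  right; rewrite min0n sub0n !mul0r subr0 addr0.
  by rewrite -[leRHS]potential0.
have [sD mh hg ap'] := ap.
have mH := measurable_ensemble gamma q past ap'.
have HM x := ensemble_bound gamma q eta0 sigmaE past x ap'.
have [k kT|[k /andP[k0 ks] nk]|IH'] := IH ap'.
- by have := prog k.+1; rewrite /= addnS ltnS => /(_ kT).
- by left; exists k.+1.
have [Tp|pT] := leqP T0 (size past).
  have [|no|drp] := prog 0%N; first by rewrite addn0 ltnS.
    by left; exists 1%N => //=; rewrite drop0.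
  right; apply: le_trans drp _; apply: le_trans (lerB IH' (lexx _)) _.
  rewrite /= (minn_idPr Tp) (minn_idPr (leqW Tp)) subSn//.
  rewrite -[(size past - T0).+1%:R]natr1.
  by rewrite mulrDl mul1r; lra.
right; rewrite /=.
apply: le_trans (potential_lipschitz _ _ _ _ mH HM mh hg) _.
rewrite -sigmaE; move: IH'.
rewrite (minn_idPl (ltnW pT)) (minn_idPl pT).
rewrite -[(size past).+1%:R]natr1 mulrDl mul1r.
have -> : (size past - T0)%N = 0%N by apply/eqP; rewrite subn_eq0 ltnW.
have -> : ((size past).+1 - T0)%N = 0%N by apply/eqP; rewrite subn_eq0.
by rewrite mul0r; lra.
Qed.

End potential_argument.

(** * The random run *)

Lemma discrete_pmf {R : realType} {B : finType} (w : B -> R) :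
  (forall b, 0 <= w b) -> \sum_b w b = 1 -> discrete (pmf w).
Proof.
move=> w0 w1; exists [seq (w b, b) | b <- index_enum B]; split.
- by rewrite all_map; apply/allP => b _ /=.
- by rewrite big_map.
- by move=> f f0; rewrite big_map.
Qed.

Lemma upper_markov {R : realType} {Z : Type} (P : sampler R Z) (V : Z -> R) (v : R) :
  discrete P -> (forall z, 0 <= V z) -> upper P V v ->
  (P (fun z => (V z)%:E) <= v%:E)%E.
Proof.
move=> dP V0 Pv; have := Pv (fun=> 0%E) (fun=> lexx _).
rewrite (discrete_cst P 0 dP)// add0e.
by under [X in (P X <= _)%E -> _]eq_fun do rewrite add0e.
Qed.

Lemma iid_from_mass {R : realType} {d : measure_display} {Z : measurableType d}
    (D : probability Z R) n : (iid (from D) n (fun=> 1) = 1)%E.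
Proof.
elim: n => [//|n IH] /=; rewrite /bind /ret IH /from.
by rewrite integral_cst//= probability_setT mule1.
Qed.

Section boosting_run.
Context {R : realType} {d : measure_display} {X : measurableType d}.
Variables (gamma : R) (q : params R).
Variable D : probability (X * bool)%type R.
Hypothesis gamma0 : 0 < gamma.
Hypothesis gamma1 : gamma <= 1.
Hypothesis eta0 : 0 < eta q.
Hypothesis sigmaE : sigma q = eta q / gamma.
Hypothesis sigma1 : sigma q <= 1.
Hypothesis fresh0 : (0 < fresh q)%N.
Variables (B : {fset (X -> bool)}) (W : learner R B) (e0 d0 : R).
Hypothesis mB : forall g, g \in B -> measurable_fun [set: X] g.
Notation run n past := (run_rounds (@phi R) gamma q D W e0 d0 n past).
Notation adm := (admissible gamma q).

(** Separated from the draw of [Dhat] because, for an admissible past and a dataset of the right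
    size, this part is finitely supported and has additive expectations. *)
Definition learning_step (past : history R X) (Dhat : seq (X * bool)) :
    sampler R (history R X) :=
  bind (iid (relabeled (@phi R) q past Dhat) (resample q)) (fun Dres =>
  bind (pmf (learn W e0 d0 Dres)) (fun w =>
  ret ((Dhat, next_hyp gamma q past Dres (val w)) :: past))).

Definition boosting_round (past : history R X) : sampler R (history R X) :=
  bind (iid (from D) (fresh q)) (fun Dhat => learning_step past (tval Dhat)).

Lemma run_roundsS n past :
  run n.+1 past = bind (boosting_round past) (fun hist => run n hist).
Proof. by []. Qed.

Lemma run_roundsD n k past :
  run (n + k) past = bind (run n past) (fun hist => run k hist).
Proof.
elim: n past => [|n IH] past //.
rewrite addSn !run_roundsS; apply/funext => f; rewrite /bind.
by congr (boosting_round past _); apply/funext => hist; rewrite IH.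
Qed.

Lemma admissible_next past Dhat n (Dres : n.-tuple (X * bool)) (w : B) :
  adm past -> size Dhat = fresh q ->
  adm ((Dhat, next_hyp gamma q past Dres (val w)) :: past).
Proof.
move=> ap sD; split => //.
- rewrite /next_hyp; case: (ltP (tau q) _) => _.
    apply: measurable_funM => //.
    exact: measurableT_comp measurable_pm (mB _ (valP w)).
  apply: (@measurable_funN _ _ _ _ (fun x => pm R (sign (ensemble q past) x))).
  apply: measurableT_comp measurable_pm _; apply: measurable_sign.
  exact: measurable_ensemble ap.
- move=> x; rewrite /next_hyp; case: (ltP (tau q) _) => _.
    by rewrite normrM norm_pm mul1r normfV gtr0_norm.
  by rewrite normrN norm_pm invf_ge1.
Qed.

Lemma discrete_learning_step past Dhat : adm past -> size Dhat = fresh q ->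
  discrete (learning_step past Dhat).
Proof.
move=> ap sD; apply: discrete_bind.
  by apply/discrete_iid/(discrete_relabeled gamma) => //; rewrite sD.
move=> Dres; apply: discrete_bind; last by move=> w; exact: discrete_ret.
by apply: discrete_pmf; [exact: learn_ge0|exact: learn_sum1].
Qed.

Lemma nonneg_boosting_round past : adm past -> nonneg_sampler (boosting_round past).
Proof.
move=> ap; apply: nonneg_bind.
  by have [] := monotone_iid (from D) (fresh q) (monotone_from D) (nonneg_from D).
move=> Dhat; apply: nonneg_discrete; apply: discrete_learning_step => //.
exact: size_tuple.
Qed.

Lemma eq_boosting_round past (f g : history R X -> \bar R) : adm past ->
  (forall e, adm (e :: past) -> f (e :: past) = g (e :: past)) ->
  boosting_round past f = boosting_round past g.
Proof.
move=> ap fg; congr (iid (from D) (fresh q) _); apply/funext => Dhat.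
congr (iid _ _ _); apply/funext => Dres; congr (pmf _ _); apply/funext => w.
by apply: fg; apply: admissible_next => //; exact: size_tuple.
Qed.

Lemma monotone_boosting_round past :
  adm past -> monotone_sampler (boosting_round past).
Proof.
move=> ap; have [mI nI] :=
  monotone_iid (from D) (fresh q) (monotone_from D) (nonneg_from D).
have dL (Dhat : (fresh q).-tuple (X * bool)) :
    discrete (learning_step past (tval Dhat)).
  by apply: discrete_learning_step => //; exact: size_tuple.
apply: monotone_bind => // Dhat; first exact: nonneg_discrete.
exact: monotone_discrete.
Qed.

(** Monotonicity of a sampler asks for inequalities at every history, but here they are known at
    admissible ones only. A round reaches no others, so both functions may be replaced by maxima
    that are ordered everywhere. *)
Lemma boosting_round_le past (f g : history R X -> \bar R) : adm past ->
  (forall hist, adm hist -> 0 <= f hist)%E ->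
  (forall hist, adm hist -> f hist <= g hist)%E ->
  (boosting_round past f <= boosting_round past g)%E.
Proof.
move=> ap f0 fg.
rewrite (eq_boosting_round past f (fun hist => maxe 0%E (f hist)))//; last first.
  by move=> e ae; rewrite max_r// f0.
rewrite (eq_boosting_round past g
  (fun hist => maxe (maxe 0%E (f hist)) (g hist)))//; last first.
  by move=> hist ah; rewrite max_r// ge_max fg// (le_trans (f0 _ ah)) ?fg.
apply: monotone_boosting_round => // hist; first by rewrite le_max lexx.
by rewrite le_max lexx.
Qed.

Lemma run_ge0 n past (f : history R X -> \bar R) : adm past ->
  (forall hist, adm hist -> 0 <= f hist)%E -> (0 <= run n past f)%E.
Proof.
elim: n past => [|n IH] past ap f0; first exact: f0.
rewrite run_roundsS /bind.
rewrite (eq_boosting_round past _ (fun hist => maxe 0%E (run n hist f)))//.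
  by apply: nonneg_boosting_round => // hist; rewrite le_max lexx.
by move=> e ae; rewrite max_r// IH.
Qed.

Lemma nonneg_run n past : adm past -> nonneg_sampler (run n past).
Proof. by move=> ap f f0; apply: run_ge0. Qed.

Lemma run_le n past (f g : history R X -> \bar R) : adm past ->
  (forall hist, adm hist -> 0 <= f hist)%E ->
  (forall hist, adm hist -> f hist <= g hist)%E ->
  (run n past f <= run n past g)%E.
Proof.
elim: n past f g => [|n IH] past f g ap f0 fg; first exact: fg.
rewrite run_roundsS /bind.
apply: boosting_round_le => // hist ah; last exact: IH.
exact: run_ge0.
Qed.

Lemma monotone_run n past : adm past -> monotone_sampler (run n past).
Proof. by move=> ap f g f0 fg; apply: run_le. Qed.

(** A supermartingale argument indexed backwards: [V k] is the bound with [k] rounds still to be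
    played. *)
Lemma upper_run (V : nat -> history R X -> R) n past :
  (forall k hist, 0 <= V k hist) ->
  (forall k hist, (k < n)%N -> adm hist ->
     upper (boosting_round hist) (V k) (V k.+1 hist)) ->
  adm past -> upper (run n past) (V 0%N) (V n past).
Proof.
move=> V0; elim: n past => [|n IH] past step ap f f0; first exact: lexx.
have {}IH hist : adm hist -> upper (run n hist) (V 0%N) (V n hist).
  by apply: IH => k h kn; apply: step; exact: leqW.
rewrite run_roundsS /bind.
apply: (@le_trans _ _
  (boosting_round past (fun hist => run n hist f + (V n hist)%:E)))%E.
  apply: boosting_round_le => // hist ah; last exact: IH.
  by apply: nonneg_run => // z; rewrite adde_ge0// lee_fin.
rewrite (eq_boosting_round past _
  (fun hist => maxe 0%E (run n hist f) + (V n hist)%:E)%E)//; last first.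
  by move=> e ae; rewrite max_r// nonneg_run.
rewrite (eq_boosting_round past (fun hist => run n hist f)
  (fun hist => maxe 0%E (run n hist f))%E)//; last first.
  by move=> e ae; rewrite max_r// nonneg_run.
by apply: step => // hist; rewrite le_max lexx.
Qed.

Lemma upper_boosting_round (V : history R X -> R) (v' : seq (X * bool) -> R)
    (v : R) past : adm past -> (forall hist, 0 <= V hist) ->
  (forall Dhat, size Dhat = fresh q ->
     (learning_step past Dhat (fun hist => (V hist)%:E) <= (v' Dhat)%:E)%E) ->
  upper (iid (from D) (fresh q)) (fun Dhat => v' (tval Dhat)) v ->
  upper (boosting_round past) V v.
Proof.
move=> ap V0 VL Uv.
have [mI nI] := monotone_iid (from D) (fresh q) (monotone_from D) (nonneg_from D).
have dL (Dhat : (fresh q).-tuple (X * bool)) :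
    discrete (learning_step past (tval Dhat)).
  by apply: discrete_learning_step => //; exact: size_tuple.
apply: (upper_bind _ _ _ _ _ mI _ V0 _ Uv) => Dhat.
  exact: nonneg_discrete.
by apply: upper_discrete => //; apply: VL; exact: size_tuple.
Qed.

Lemma upper_iid_from_cst n (c : R) : 0 <= c ->
  upper (iid (from D) n) (fun=> c) c.
Proof.
move=> c0; have [mI nI] := monotone_iid (from D) n (monotone_from D) (nonneg_from D).
have H := upper_iid_prod (from D) n (fun=> 1) 1 (monotone_from D) (nonneg_from D)
  (fun=> ler01) ler01.
have : upper (iid (from D) n) (fun s => c * \prod_(z <- s) 1) (c * 1 ^+ n).
  apply: H => // k k0; apply: upper_from.
  - exact: measurable_cst.
  - by move=> z; rewrite mulr1.
  - rewrite mulr1 integral_cst//= probability_setT mule1//.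
rewrite expr1n mulr1; apply: upper_le => // s.
by rewrite big1_eq mulr1.
Qed.

Lemma upper_boosting_round_cst past (V : history R X -> R) (c : R) :
  adm past -> (forall hist, 0 <= V hist) -> 0 <= c ->
  (forall e, adm (e :: past) -> V (e :: past) = c) ->
  upper (boosting_round past) V c.
Proof.
move=> ap V0 c0 Vc.
apply: (upper_boosting_round _ (fun=> c)) => //; last exact: upper_iid_from_cst.
move=> Dhat sD; rewrite -(discrete_cst (learning_step past Dhat) c)//; last first.
  exact: discrete_learning_step.
rewrite le_eqVlt; apply/orP; left; apply/eqP.
congr (iid _ _ _); apply/funext => Dres; congr (pmf _ _); apply/funext => w.
by rewrite /ret Vc//; exact: admissible_next.
Qed.

Lemma upper_run_cst n past (c : R) : adm past -> 0 <= c ->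
  upper (run n past) (fun=> c) c.
Proof.
move=> ap c0; apply: (upper_run (fun _ _ => c)) => // k h ah.
by move=> ?; exact: upper_boosting_round_cst.
Qed.

(** Later rounds only add entries in front, so [drop k] recovers the history as it was [k] rounds
    earlier. *)
Lemma upper_run_drop (V : history R X -> R) n k past v : adm past ->
  (forall hist, 0 <= V hist) -> upper (run n past) V v ->
  upper (run (n + k) past) (fun hist => V (drop k hist)) v.
Proof.
move=> ap V0 Uv f f0; rewrite run_roundsD /bind.
have step hist : adm hist -> upper (run k hist) (fun h => V (drop k h)) (V hist).
  move=> ah.
  have := upper_run (fun j h => V (drop (k - j) h)) k hist.
  rewrite subn0 subnn drop0; apply => // j h jk ahh.
  apply: upper_boosting_round_cst => // e _.
  by rewrite -(subnSK jk).
apply: (@le_trans _ _ (run n past (fun hist => run k hist f + (V hist)%:E)))%E.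
  apply: run_le => // hist ah; last exact: step.
  by apply: nonneg_run => // z; rewrite adde_ge0// lee_fin.
apply: (@le_trans _ _
  (run n past (fun hist => maxe 0%E (run k hist f) + (V hist)%:E)))%E.
  apply: run_le => // hist ah.
    by rewrite adde_ge0 ?lee_fin//; exact: nonneg_run.
  by rewrite max_r//; exact: nonneg_run.
apply: le_trans (Uv _ _) _; first by move=> hist; rewrite le_max lexx.
rewrite leeD2r//; apply: run_le => // hist ah; first by rewrite le_max lexx.
by rewrite max_r//; exact: nonneg_run.
Qed.

Lemma upper_run_last (V : history R X -> R) n past v : adm past -> 0 <= v ->
  (forall hist, 0 <= V hist) ->
  (forall hist, adm hist -> upper (boosting_round hist) V v) ->
  upper (run n.+1 past) V v.
Proof.
move=> ap v0 V0 UV.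
apply: (upper_run (fun k => if k is 0%N then V else fun=> v)) => //.
  by case.
by move=> [|k] hist _ ah; [exact: UV|exact: upper_boosting_round_cst].
Qed.

Lemma upper_run_admissible n :
  upper (run n [::])
    (fun hist => `[< ~ (adm hist /\ size hist = n) >]%:R) 0.
Proof.
pose V k (hist : history R X) : R := `[< ~ (adm hist /\ (size hist + k)%N = n) >]%:R.
have -> : (fun hist => `[< ~ (adm hist /\ size hist = n) >]%:R) = V 0%N.
  by apply/funext => hist; rewrite /V addn0.
have -> : 0 = V n [::].
  by rewrite /V asboolF// => nh; exact: (nh (conj I erefl)).
apply: (upper_run V) => // k hist _ ah.
apply: upper_boosting_round_cst => // e ae.
rewrite /V /= addSnnS; congr ((_ : bool)%:R).
by apply/asboolP/asboolP => + [_ E]; apply.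
Qed.

Lemma run_mass n past : adm past -> (run n past (fun=> 1) = 1)%E.
Proof.
elim: n past => [//|n IH] past ap; rewrite run_roundsS /bind.
rewrite (eq_boosting_round past _ (fun=> 1%E))//; last by move=> e /IH.
transitivity (iid (from D) (fresh q) (fun=> 1%:E)).
  congr (iid _ _ _); apply/funext => Dhat.
  apply: (discrete_cst _ 1) => //; apply: discrete_learning_step => //.
  exact: size_tuple.
exact: iid_from_mass.
Qed.

End boosting_run.

(** * Exponential moments of the accumulated noise *)

Section noise_control.
Context {R : realType} {d : measure_display} {X : measurableType d}.
Variables (gamma : R) (q : params R).
Variable D : probability (X * bool)%type R.
Hypothesis gamma0 : 0 < gamma.
Hypothesis gamma1 : gamma <= 1.
Hypothesis eta0 : 0 < eta q.
Hypothesis sigmaE : sigma q = eta q / gamma.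
Hypothesis sigma1 : sigma q <= 1.
Hypothesis fresh0 : (0 < fresh q)%N.
Variables (B : {fset (X -> bool)}) (W : learner R B) (e0 d0 : R).
Hypothesis mB : forall g, g \in B -> measurable_fun [set: X] g.
Notation run n past := (run_rounds (@phi R) gamma q D W e0 d0 n past).
Notation adm := (admissible gamma q).
Notation round := (boosting_round gamma q D B W e0 d0).
Notation S := ((fresh q)%:R : R).

Let s0 : 0 < sigma q. Proof. exact: (sigma_gt0 gamma). Qed.
Let S0 : 0 < S. Proof. by rewrite ltr0n. Qed.

(** The fresh dataset is drawn once the ensemble and the last hypothesis are fixed, so given the
    past the noise moves by [sigma] times a centred mean of iid increments bounded by 2. Each
    example then carries the exponent [t * sigma / S], which the hypothesis on [t] keeps within the
    range of [mgf_bound]. *)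
Lemma noise_mgf_round g past (t c : R) : measurable_fun [set: X] g ->
  adm past -> `|t| * sigma q <= S / 4 -> 0 <= c ->
  upper (round past) (fun hist => c * expR (t * noise q D g hist))
    (c * expR (t * ((1 - sigma q) * noise q D g past)
               + 16 * t ^+ 2 * sigma q ^+ 2 / S)).
Proof.
move=> mg ap tS c0.
have V0 hist : 0 <= c * expR (t * noise q D g hist).
  by rewrite mulr_ge0// expR_ge0.
have q0 : 0 <= 16 * t ^+ 2 * sigma q ^+ 2 / S.
  by rewrite divr_ge0// mulr_ge0 ?sqr_ge0// mulr_ge0 ?sqr_ge0.
case: past ap => [|[Dh h] past] ap.
  have U : upper (round [::]) (fun hist => c * expR (t * noise q D g hist)) c.
    apply: (upper_boosting_round_cst gamma) => // -[Dhat h] _ /=.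
    by rewrite mulr0 expR0 mulr1.
  apply: upper_le _ V0 (fun=> lexx _) _ U.
    exact: (monotone_boosting_round gamma).
  rewrite /= !mulr0 add0r -[leLHS]mulr1 ler_wpM2l//.
  by apply: le_trans (expR_ge1Dx _); rewrite lerDl.
have [sD mh hg ap'] := ap.
have mH := measurable_ensemble gamma q past ap'.
pose v := increment q (ensemble q past) h g.
have [[mv _] _] := mean_increment q D _ _ _ mH mh mg.
have v2 z : `|v z| <= 2 by exact: (norm_increment gamma).
pose N := noise q D g ((Dh, h) :: past).
pose m := (\int[D]_z v z)%R.
pose V' (Dhat : seq (X * bool)) :=
  c * expR (t * ((1 - sigma q) * N + sigma q * (dataset_mean Dhat v - m))).
apply: (upper_boosting_round gamma q D gamma0 eta0 sigmaE sigma1 fresh0 B W e0 d0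
  _ V') => //.
  move=> Dhat sDhat.
  have dL := discrete_learning_step gamma q gamma0 eta0 sigmaE sigma1 fresh0
    B W e0 d0 ((Dh, h) :: past) Dhat ap sDhat.
  have V'0 : 0 <= V' Dhat by rewrite mulr_ge0// expR_ge0.
  by rewrite -(discrete_cst _ _ dL V'0); exact: lexx.
pose t' := t * sigma q / S.
have t4 : `|t'| <= 4^-1.
  rewrite /t' normrM normfV normrM (gtr0_norm s0) (gtr0_norm S0).
  by rewrite ler_pdivrMr// [leRHS]mulrC.
have := upper_iid_mgf (from D) D (dominated_from D) v mv v2 (fresh q) t'
  (c * expR (t * ((1 - sigma q) * N))) t4.
have -> : (fun s : (fresh q).-tuple (X * bool) => c * expR (t * ((1 - sigma q) * N)) *
    expR (t' * \sum_(z <- s) (v z - (\int[D]_z v z)%R))) = (fun s => V' (tval s)).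
  apply/funext => s; rewrite /V' -mulrA -expRD; congr (c * expR _).
  rewrite sumrB big_const_seq count_predT size_tuple iter_addr_0 /dataset_mean.
  by rewrite size_tuple /t' -/m -[m *+ _]mulr_natr; field; rewrite gt_eqF.
have -> : c * expR (t * ((1 - sigma q) * N)) * expR (16 * t' ^+ 2 * S) =
    c * expR (t * ((1 - sigma q) * N) + 16 * t ^+ 2 * sigma q ^+ 2 / S).
  rewrite -mulrA -expRD; congr (c * expR (_ + _)).
  by rewrite /t'; field; rewrite gt_eqF.
by apply; rewrite mulr_ge0// expR_ge0.
Qed.

Lemma noise_mgf_run g n (t c : R) : measurable_fun [set: X] g ->
  `|t| * sigma q <= S / 4 -> 0 <= c ->
  upper (run n [::]) (fun hist => c * expR (t * noise q D g hist))
    (c * expR (16 * t ^+ 2 * sigma q / S)).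
Proof.
move=> mg tS c0.
have r01 : 0 <= 1 - sigma q <= 1 by rewrite subr_ge0 sigma1/= gerBl ltW.
have /andP[r0 r1] := r01.
(* One round costs [16 * t ^ 2 * sigma ^ 2 / S]; damping makes the total a geometric sum of order
   [1 / sigma], hence a single factor [sigma]. *)
pose K := 16 * t ^+ 2 * sigma q / S.
have K0 : 0 <= K by rewrite /K divr_ge0// mulr_ge0 ?(ltW s0)// mulr_ge0 ?sqr_ge0.
(* With [k] rounds to go, a deviation is damped by [(1 - sigma) ^ k] before it
   is read off; the second term pays for the noise still to come. *)
pose V k hist := c * expR (t * (1 - sigma q) ^+ k * noise q D g hist
  + K * (1 - (1 - sigma q) ^+ k)).
have := upper_run gamma q D gamma0 gamma1 eta0 sigmaE sigma1 fresh0 B W e0 d0 mB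
  V n [::].
have -> : V 0%N = (fun hist => c * expR (t * noise q D g hist)).
  by apply/funext => hist; rewrite /V expr0 subrr mulr0 addr0 mulr1.
have Vn : V n [::] <= c * expR K.
  rewrite /V /= mulr0 add0r; apply: ler_wpM2l => //; rewrite ler_expR -[leRHS]mulr1 ler_wpM2l//.
  by rewrite gerBl exprn_ge0.
move=> H; apply: upper_le Vn (H _ _ _) => //.
- exact: (monotone_run gamma).
- by move=> hist; rewrite mulr_ge0// expR_ge0.
- by move=> k hist; rewrite mulr_ge0// expR_ge0.
move=> k hist _ ah.
have tk : `|t * (1 - sigma q) ^+ k| * sigma q <= S / 4.
  apply: le_trans tS; apply: ler_wpM2r; first exact: ltW.
  rewrite normrM -[leRHS]mulr1.
  by rewrite ler_wpM2l// ger0_norm ?exprn_ge0// exprn_ile1.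
have := noise_mgf_round g hist (t * (1 - sigma q) ^+ k)
  (c * expR (K * (1 - (1 - sigma q) ^+ k))) mg ah tk
  (mulr_ge0 c0 (expR_ge0 _)).
apply: upper_le.
- exact: (monotone_boosting_round gamma).
- by move=> z; rewrite mulr_ge0// expR_ge0.
- by move=> z; rewrite -mulrA -expRD addrC.
- rewrite -mulrA -expRD; apply: ler_wpM2l => //; rewrite ler_expR !(exprS (1 - sigma q) k).
  (* The cost of a round carries the square of the damping; bounding it by the damping itself
     matches the increment [K * sigma * (1 - sigma) ^ k] reserved in [V]. *)
  have pk : (1 - sigma q) ^+ k * (1 - sigma q) ^+ k <= (1 - sigma q) ^+ k.
    by rewrite -[leRHS]mulr1 ler_wpM2l ?exprn_ge0// exprn_ile1.
  have : K * sigma q * ((1 - sigma q) ^+ k * (1 - sigma q) ^+ k) <=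
      K * sigma q * (1 - sigma q) ^+ k.
    by rewrite ler_wpM2l// mulr_ge0// ltW.
  have -> : 16 * (t * (1 - sigma q) ^+ k) ^+ 2 * sigma q ^+ 2 / S =
      K * sigma q * ((1 - sigma q) ^+ k * (1 - sigma q) ^+ k).
    by rewrite /K; ring.
  move: ((1 - sigma q) ^+ k) (noise q D g hist) => r N. lra.
Qed.

Lemma noise_deviation g n (a : R) : measurable_fun [set: X] g -> 0 < a <= 8 ->
  upper (run n [::]) (fun hist => ((a < `|noise q D g hist|)%R)%:R)
    (2 * expR (- (a ^+ 2 * S / (64 * sigma q)))).
Proof.
move=> mg /andP[a0 a8].
(* Minimizes [- t * a + 16 * t ^ 2 * sigma / S]; [a <= 8] gives [t * sigma <= S / 4]. *)
pose t := a * S / (32 * sigma q).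
have t0 : 0 < t by rewrite /t divr_gt0// mulr_gt0.
have tS : `|t| * sigma q <= S / 4.
  rewrite gtr0_norm//.
  have -> : t * sigma q = a / 32 * S by rewrite /t; field; rewrite gt_eqF.
  by rewrite mulrC ler_pM2l//; lra.
have tS' : `|- t| * sigma q <= S / 4 by rewrite normrN.
pose v := 2 * expR (- (t * a) + 16 * t ^+ 2 * sigma q / S).
have -> : 2 * expR (- (a ^+ 2 * S / (64 * sigma q))) = v.
  by rewrite /v; congr (_ * expR _); rewrite /t; field; rewrite !gt_eqF.
pose c := expR (- (t * a)).
have U := noise_mgf_run g n t c mg tS (expR_ge0 _).
have U' := noise_mgf_run g n (- t) c mg tS' (expR_ge0 _).
have c0 (u : R) hist : 0 <= c * expR (u * noise q D g hist).
  by rewrite mulr_ge0// expR_ge0.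
apply: upper_le _ _ _ _ (upperD _ _ _ _ _ (c0 t) U U').
- exact: (monotone_run gamma).
- by move=> hist.
- move=> hist; case: (ltP a) => [|_]; last by rewrite addr_ge0.
  set N := noise _ _ _ _; rewrite /c -!expRD.
  have [N0|N0] := ler0P N => aN.
  + rewrite -[true%:R]add0r lerD ?expR_ge0//.
    apply: le_trans (expR_ge1Dx _); rewrite lerDl.
    have : 0 <= t * (- N - a) by rewrite mulr_ge0 ?subr_ge0 ?ltW.
    by lra.
  + rewrite -[true%:R]addr0 lerD ?expR_ge0//.
    apply: le_trans (expR_ge1Dx _); rewrite lerDl.
    have : 0 <= t * (N - a) by rewrite mulr_ge0 ?subr_ge0 ?ltW.
    by lra.
- by rewrite sqrrN /v expRD /c; lra.
Qed.

End noise_control.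

(** * One call to the weak learner *)

Section learning_success.
Context {R : realType} {d : measure_display} {X : measurableType d}.
Variables (gamma : R) (q : params R).
Variable D : probability (X * bool)%type R.
Hypothesis gamma0 : 0 < gamma.
Hypothesis eta0 : 0 < eta q.
Hypothesis sigmaE : sigma q = eta q / gamma.
Hypothesis sigma1 : sigma q <= 1.
Hypothesis fresh0 : (0 < fresh q)%N.
Hypothesis resample0 : (0 < resample q)%N.
Variables (B : {fset (X -> bool)}) (W : learner R B) (e0 d0 : R).
Hypothesis mB : forall g, g \in B -> measurable_fun [set: X] g.
Variables (H : set (X -> bool)) (hstar : X -> bool).
Hypothesis mH : forall g, H g -> measurable_fun [set: X] g.
Hypothesis Hstar : H hstar.
Variables (m : R -> R -> option nat) (m0 : nat).
Hypothesis learnerW : weak_learner gamma H m W.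
Hypotheses (e00 : 0 < e0) (d00 : 0 < d0).
Hypothesis mE : m e0 d0 = Some m0.
Hypothesis m0_resample : (m0 <= resample q)%N.
Notation adm := (admissible gamma q).
Notation n := (resample q).

Lemma corr_le_opt (mu : probability (X * bool)%type R) :
  corr mu hstar <= opt_corr mu H.
Proof.
rewrite /opt_corr; apply: ub_le_sup; last by exists hstar.
exists 1 => _ [g Hg <-].
by have := corr_norm mu g (mH _ Hg); rewrite ler_norml => /andP[].
Qed.

Variable a : R.
Hypothesis a08 : 0 < a <= 8.

(** A round fails to be [learned] only if the learner misses its guarantee for the relabeled law or
    some member of [B] has an inaccurate empirical correlation; the two terms bound these events. *)
Lemma learning_step_success past Dhat : adm past -> size Dhat = fresh q ->
  (learning_step gamma q B W e0 d0 past Dhat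
    (fun hist => (`[< ~ learned gamma q e0 B hstar a hist >]%:R : R)%:E)
   <= (d0 + #|` B|%:R * (2 * expR (- (n%:R * a ^+ 2 / 64))))%:E)%E.
Proof.
move=> ap sD.
pose P := relabeled (@phi R) q past Dhat.
have dP : discrete P by apply: (discrete_relabeled gamma) => //; rewrite sD.
have [mu muE] := discrete_from P dP.
have corrE g : measurable_fun [set: X] g -> corr mu g = sampler_corr P g.
  exact: corr_discrete.
pose success (w : B) := (gamma * opt_corr mu H - e0 <= corr mu (val w))%R.
pose dev (w : B) (s : n.-tuple (X * bool)) : R :=
  ((a < `|emp_corr R s (val w) - corr mu (val w)|)%R)%:R.
pose miss (b : bool) (s : n.-tuple (X * bool)) : R :=
  \sum_(w : B) learn W e0 d0 s w * (success w == b)%:R.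
have dev0 w s : 0 <= dev w s by rewrite /dev.
have miss0 b s : 0 <= miss b s.
  by apply: sumr_ge0 => w _; rewrite mulr_ge0// learn_ge0.
have sdev0 s : 0 <= \sum_(w : B) dev w s by apply: sumr_ge0.
have dI : discrete (iid P n) by exact: discrete_iid.
have step1 : (learning_step gamma q B W e0 d0 past Dhat
    (fun hist => (`[< ~ learned gamma q e0 B hstar a hist >]%:R : R)%:E) <=
    iid P n (fun s => (miss false s)%:E + (\sum_(w : B) dev w s)%:E))%E.
  apply: (monotone_discrete _ dI) => s.
    apply: nonneg_pmf; first exact: learn_ge0.
    by move=> w; rewrite /ret lee_fin.
  have devE : \sum_(w : B) dev w s =
      \sum_(v : B) learn W e0 d0 s v * \sum_(w : B) dev w s.
    by rewrite -mulr_suml learn_sum1 mul1r.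
  rewrite -EFinD /pmf /ret [X in (_ + X)%:E]devE.
  rewrite -big_split/= -sumEFin; apply: lee_sum => w _.
  rewrite -EFinM lee_fin -mulrDr ler_wpM2l ?learn_ge0//.
  case: asboolP => [nl|_]; last by rewrite addr_ge0// sumr_ge0.
  have [sw|nsw] := boolP (success w); last first.
    by rewrite lerDl sumr_ge0.
  (* The learner chooses [w] after seeing [s], so a bound for a fixed hypothesis would not cover it:
     a deviation of any member of [B] counts as failure. *)
  have [[w' dw']|ndev] := pselect (exists w' : B,
      a < `|emp_corr R s (val w') - corr mu (val w')|).
    rewrite (bigD1 w')//= /dev dw' addrCA -[leLHS]addr0 lerD//.
    by rewrite addr_ge0// sumr_ge0.
  exfalso; apply: nl; rewrite /learned -/P /next_hyp.
  have close : `|emp_corr R s (val w) - corr mu (val w)| <= a.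
    by rewrite leNgt; apply/negP => dw; apply: ndev; exists w.
  move: close; rewrite ler_norml => /andP[l1 l2].
  have [tw|tw] := ltP (tau q) (emp_corr R s (val w)).
    left; exists (val w); first exact: valP.
    split; first by apply/funext => x; rewrite mulrC.
    by rewrite -corrE; [lra|exact/mB/valP].
  (* After a rejection [corr mu w <= tau + a], while the guarantee gives [gamma * corr mu hstar <=
     gamma * opt_corr mu H <= corr mu w + e0]. *)
  right; split; first by apply/funext => x; rewrite mulN1r.
  rewrite -corrE; last exact: mH.
  have := corr_le_opt mu; rewrite -(ler_pM2l gamma0).
  by move: sw; rewrite /success; lra.
apply: le_trans step1 _; have -> : iid P n (fun s => (miss false s)%:E + (\sum_(w : B) dev w s)%:E)%E =
    (iid P n (fun s => (miss false s)%:E) +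
     iid P n (fun s => (\sum_(w : B) dev w s)%:E))%E.
  by apply: discreteD => // s; exact: miss0.
rewrite EFinD; apply: leeD.
- have mmiss b : measurable_fun [set: n.-tuple (X * bool)] (miss b).
    apply: measurable_sum => w; apply: measurable_funM => //.
    exact: learn_measurable.
  (* The guarantee bounds success from below. Turning it into an upper bound on failure uses
     additivity, available since [P] is finitely supported. *)
  have sumE : (iid P n (fun s => (miss false s)%:E) +
      iid P n (fun s => (miss true s)%:E) = 1)%E.
    transitivity (iid P n (fun s => (miss false s)%:E + (miss true s)%:E)%E).
      by apply/esym/discreteD => // s; exact: miss0.
    transitivity (iid P n (fun=> 1%:E)); last exact: discrete_cst.
    congr (iid P n _); apply/funext => s; rewrite -EFinD -big_split/=.
    rewrite -[in RHS](learn_sum1 W e0 d0 s); congr EFin; apply: eq_bigr => w _.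
    by rewrite -mulrDr; case: (success w); rewrite /= ?addr0 ?add0r mulr1.
  have trueE : ((1 - d0)%:E <= iid P n (fun s => (miss true s)%:E))%E.
    have := learnerW e0 d0 m0 n e00 d00 mE m0_resample mu.
    rewrite /Pr /bind => /le_trans; apply.
    rewrite -(iid_discrete_from P dP mu muE); last 2 first.
    + exact/measurable_EFinP.
    + by move=> s; rewrite lee_fin.
    rewrite le_eqVlt; apply/orP; left; apply/eqP.
    congr (iid _ _ _); apply/funext => s; rewrite /pmf /miss -sumEFin.
    apply: eq_bigr => w _; rewrite EFinM; congr (_ * _%:E)%E.
    by rewrite indicE /success; congr ((_ : bool)%:R); rewrite eqb_id; apply/idP/idP; rewrite inE.
  move: sumE trueE; case: (iid P n _) => [x| |]; case: (iid P n _) => [y| |]//.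
  by rewrite -EFinD => -[xy]; rewrite !lee_fin; lra.
- apply: (upper_markov _ _ _ dI); first by move=> s; rewrite sumr_ge0.
  have -> : #|` B|%:R * (2 * expR (- (n%:R * a ^+ 2 / 64))) =
      \sum_(w : B) (2 * expR (- (n%:R * a ^+ 2 / 64))).
    by rewrite sumr_const cardfE mulr_natl.
  apply: upper_sum => // w.
  have mw := mB _ (valP w).
  have [mv _] := bounded_measurable_agreement (R := R) _ mw.
  have v2 z : `|agreement (val w) z| <= 2 :> R by rewrite norm_agreement; lra.
  have := upper_deviation P mu (dominated_discrete _ _ dP muE) _ mv v2 n a
    resample0 a08.
  rewrite (_ : (fun s : n.-tuple (X * bool) => _) = dev w)//.
  apply/funext => s; rewrite /dev /emp_corr /corr_sum size_tuple.
  by [].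
Qed.

Lemma learned_round past : adm past ->
  upper (boosting_round gamma q D B W e0 d0 past)
    (fun hist => `[< ~ learned gamma q e0 B hstar a hist >]%:R)
    (d0 + #|` B|%:R * (2 * expR (- (n%:R * a ^+ 2 / 64)))).
Proof.
move=> ap.
set v := _ + _.
have v0 : 0 <= v.
  by rewrite addr_ge0 ?(ltW d00)// mulr_ge0// mulr_ge0// expR_ge0.
apply: (upper_boosting_round gamma q D gamma0 eta0 sigmaE sigma1 fresh0 B W
  e0 d0 _ (fun=> v)) => //.
- by move=> Dhat sD; exact: learning_step_success.
- exact: upper_iid_from_cst.
Qed.

End learning_success.

(** * Failure events of a whole run *)

Section boosting_success.
Context {R : realType} {d : measure_display} {X : measurableType d}.
Variables (gamma : R) (q : params R).
Variable D : probability (X * bool)%type R.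
Hypothesis gamma0 : 0 < gamma.
Hypothesis gamma1 : gamma <= 1.
Hypothesis eta0 : 0 < eta q.
Hypothesis sigmaE : sigma q = eta q / gamma.
Hypothesis sigma1 : sigma q <= 1.
Hypothesis fresh0 : (0 < fresh q)%N.
Hypothesis resample0 : (0 < resample q)%N.
Hypothesis post0 : (0 < post q)%N.
Variables (B : {fset (X -> bool)}) (W : learner R B) (e0 d0 : R).
Hypothesis mB : forall g, g \in B -> measurable_fun [set: X] g.
Variables (H : set (X -> bool)) (hstar : X -> bool).
Hypothesis mH : forall g, H g -> measurable_fun [set: X] g.
Hypothesis Hstar : H hstar.
Variables (m : R -> R -> option nat) (m0 : nat).
Hypothesis learnerW : weak_learner gamma H m W.
Hypotheses (e00 : 0 < e0) (d00 : 0 < d0).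
Hypothesis mE : m e0 d0 = Some m0.
Hypothesis m0_resample : (m0 <= resample q)%N.
Variables (eps delta : R) (T0 : nat).
Hypothesis eps0 : 0 < eps.
Hypothesis eps2 : eps <= 2.
Hypothesis delta0 : 0 < delta.
Hypothesis hstar_opt : opt_corr D H <= corr D hstar + eps / 4.
Hypothesis etaE : eta q = gamma ^+ 2 * eps / 64.
Hypothesis tauE : tau q = gamma * eps / 16.
Notation a := (gamma * eps / 128).
Notation T := (rounds q).
Hypothesis T0T : (T0 <= T)%N.
Hypothesis burn_in : 2 * (1 - sigma q) ^+ T0 <= a.
Hypothesis horizon :
  2 + T0%:R * sigma q < (T - T0)%:R * (eta q * eps / 32).
Hypothesis fresh_large : (#|` B|%:R + 1) *
  (2 * expR (- (a ^+ 2 * (fresh q)%:R / (64 * sigma q)))) <= delta.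
Hypothesis resample_large :
  #|` B|%:R * (2 * expR (- ((resample q)%:R * a ^+ 2 / 64))) <= delta.
Hypothesis post_large :
  2 * expR (- ((post q)%:R * (eps / 4) ^+ 2 / 64)) <= delta.
Notation adm := (admissible gamma q).
Notation run n past := (run_rounds (@phi R) gamma q D W e0 d0 n past).
Notation outcome := (history R X * seq (X * bool))%type.

Let a08 : 0 < a <= 8.
Proof.
have ge0 : 0 < gamma * eps by rewrite mulr_gt0.
have : gamma * eps <= 1 * 2 by rewrite ler_pM// ltW.
lra.
Qed.

(** [None] stands for [hstar], so that the union bound ranges over a finite type with one element
    more than [B]. *)
Definition hypothesis_of (g : option B) : X -> bool := oapp val hstar g.

Lemma measurable_hypothesis_of g : measurable_fun [set: X] (hypothesis_of g).
Proof. by case: g => [w|]; [exact: mB (valP w)|exact: mH]. Qed.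

Definition loud (hist : history R X) : R :=
  \sum_(g : option B) ((a < `|noise q D (hypothesis_of g) hist|)%R)%:R.

Definition unlearned (hist : history R X) : R :=
  `[< ~ learned gamma q e0 B hstar a hist >]%:R.

Definition failed_rounds (V : history R X -> R) (o : outcome) : R :=
  \sum_(k < T) V (drop k o.1).

(** Off admissible histories the candidate signs need not be measurable and the deviation bound
    would not apply; those histories are charged to [inadmissible] instead. *)
Definition misjudged (o : outcome) : R :=
  `[< adm o.1 >]%:R * \sum_(k < T)
    ((eps / 4 < `|emp_corr R o.2 (sign (ensemble q (drop k.+1 o.1)))
                  - corr D (sign (ensemble q (drop k.+1 o.1)))|)%R)%:R.

Definition inadmissible (o : outcome) : R :=
  `[< ~ (adm o.1 /\ size o.1 = T) >]%:R.

Lemma run_good_output (o : outcome) :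
  inadmissible o = 0 -> failed_rounds loud o = 0 ->
  failed_rounds unlearned o = 0 -> misjudged o = 0 ->
  labels_valid (@phi R) q o.1 -> forall hbar, outputs q o.1 o.2 hbar ->
  opt_corr D H - 2 * e0 / gamma - eps <= corr D hbar.
Proof.
case: o => hist D0 /=.
rewrite /inadmissible; case: asboolP => [_ /eqP|/contrapT/=[ah sh] _].
  by rewrite oner_eq0.
move=> /eqP; rewrite /failed_rounds psumr_eq0; last first.
  by move=> k _; rewrite sumr_ge0.
move=> /allP quiet0 /eqP; rewrite psumr_eq0; last by move=> k _.
move=> /allP learned0; rewrite /misjudged asboolT// mul1r => /eqP.
rewrite psumr_eq0; last by move=> k _.
move=> /allP judged0 valid hbar [[kb [/andP[kb0 kbs] hbarE]] hmax].
have judged k : (0 < k <= T)%N ->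
    `|emp_corr R D0 (sign (ensemble q (drop k hist)))
      - corr D (sign (ensemble q (drop k hist)))| <= eps / 4.
  case: k => [//|k] /= kT.
  have := judged0 (Ordinal kT) (mem_index_enum _).
  by rewrite /= leNgt; case: (_ < _)%R => //; rewrite oner_eq0.
have learnedk k : (k < T)%N -> learned gamma q e0 B hstar a (drop k hist).
  move=> kT; have := learned0 (Ordinal kT) (mem_index_enum _).
  rewrite /= /unlearned; case: asboolP => [_|/contrapT//].
  by rewrite oner_eq0.
have quietk k : (k < T)%N -> quiet q D B hstar a (drop k hist).
  move=> kT; have := quiet0 (Ordinal kT) (mem_index_enum _).
  rewrite /= /loud psumr_eq0// => /allP q0 g gB.
  suff [g' ->] : exists g', g = hypothesis_of g'.
    have := q0 g' (mem_index_enum _).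
    by rewrite /= leNgt; case: (_ < _)%R => //; rewrite oner_eq0.
  by case: gB => [gB|->]; [exists (Some [` gB]%fset)|exists None].
have progk k : (T0 + k < size hist)%N ->
    progress gamma q D eps e0 hstar (drop k hist).
  move=> kT; have kT' : (k < T)%N by rewrite -sh (leq_ltn_trans (leq_addl _ _) kT).
  have sk : (size (drop k hist) = T - k)%N by rewrite size_drop sh.
  apply: (round_progress gamma q D gamma0 gamma1 eta0 sigmaE sigma1 fresh0
    eps e0 B) => //.
  - exact: mH.
  - by rewrite sk subn_gt0.
  - exact: admissible_drop.
  - exact: labels_valid_drop.
  - apply: le_trans burn_in; rewrite ler_pM2l// sk.
    have s0 := sigma_gt0 gamma q gamma0 eta0 sigmaE.
    apply: ler_wiXn2l; [by rewrite subr_ge0|by rewrite gerBl ltW|].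
    by rewrite -ltnS prednK ?subn_gt0// ltn_subRL addnC -sh.
  - exact: quietk.
  - exact: learnedk.
have [[k kT nk]|] := good_candidate gamma q D eta0 sigmaE eps e0 hstar T0 hist ah progk.
  have kT' : (0 < k <= T)%N by rewrite -sh.
  have kbT : (0 < kb <= T)%N by rewrite kb0 -sh.
  have := judged k kT'; have := judged kb kbT; rewrite -hbarE.
  have : emp_corr R D0 (sign (ensemble q (drop k hist))) <= emp_corr R D0 hbar.
    rewrite /emp_corr ler_wpM2l ?invr_ge0//; apply: hmax.
    by exists k.
  move: nk; rewrite /near_optimal !ler_norml => nk le1 /andP[l1 l2] /andP[l3 l4].
  have := hstar_opt; lra.
(* Without a near-optimal candidate, [horizon] would make the potential negative after [T]
   rounds. *)
rewrite sh (minn_idPr T0T) => pot; exfalso.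
have := potential_ge0 D (ensemble q hist); have := horizon; lra.
Qed.

Let mI := (monotone_iid (from D) (post q) (monotone_from D) (nonneg_from D)).1.
Let nI := (monotone_iid (from D) (post q) (monotone_from D) (nonneg_from D)).2.

Let monotone_runT : monotone_sampler (run T [::]).
Proof. exact: (monotone_run gamma). Qed.

Lemma upper_boost (V : outcome -> R) (c : R) :
  (forall o, 0 <= V o) -> 0 <= c ->
  (forall hist, upper (iid (from D) (post q)) (fun s => V (hist, tval s)) c) ->
  upper (boost (@phi R) gamma q D W e0 d0) V c.
Proof.
move=> V0 c0 UV; apply: (upper_bind _ _ _ (fun=> c) _ monotone_runT) => //.
- by move=> hist; apply: nonneg_bind => // s; exact: nonneg_ret.
- move=> hist f f0; rewrite /bind /ret.
  by apply: (UV hist (fun s => f (hist, tval s))).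
- exact: (upper_run_cst gamma).
Qed.

Lemma upper_boost_history (U : history R X -> R) (v : R) :
  (forall hist, 0 <= U hist) -> upper (run T [::]) U v ->
  upper (boost (@phi R) gamma q D W e0 d0) (fun o => U o.1) v.
Proof.
move=> U0 US; apply: (upper_bind _ _ _ U _ monotone_runT _ _ _ US) => //.
- by move=> hist; apply: nonneg_bind => // s; exact: nonneg_ret.
- move=> hist f f0; rewrite /bind /ret.
  exact: (upper_iid_from_cst D (post q) (U hist) (U0 hist)
    (fun s => f (hist, tval s)) (fun s => f0 _)).
Qed.

Lemma upper_failed_rounds (V : history R X -> R) (v : R) :
  (forall hist, 0 <= V hist) ->
  (forall n, upper (run n.+1 [::]) V v) ->
  upper (boost (@phi R) gamma q D W e0 d0) (failed_rounds V) (T%:R * v).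
Proof.
move=> V0 UV.
have Uk (k : 'I_T) : upper (run T [::]) (fun hist => V (drop k hist)) v.
  rewrite -{1}(subnK (ltnW (ltn_ord k))).
  apply: (upper_run_drop gamma) => //.
  have := ltn_ord k; rewrite -subn_gt0; case: (T - k)%N => [//|n _].
  exact: UV.
have -> : T%:R * v = \sum_(k < T) v by rewrite sumr_const card_ord mulr_natl.
apply: (upper_boost_history (fun hist => \sum_(k < T) V (drop k hist))).
  by move=> hist; apply: sumr_ge0.
by apply: upper_sum.
Qed.

Lemma upper_loud n : upper (run n.+1 [::]) loud delta.
Proof.
have mr : monotone_sampler (run n.+1 [::]) by exact: (monotone_run gamma).
apply: upper_le mr _ (fun=> lexx _) fresh_large _.
  by move=> hist; apply: sumr_ge0.
set v := 2 * _.
have -> : (#|` B|%:R + 1) * v = \sum_(g : option B) v.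
  by rewrite sumr_const card_option -cardfE -[RHS]mulr_natl -[in RHS]natr1.
apply: upper_sum => // g; apply: (noise_deviation gamma) => //.
exact: measurable_hypothesis_of.
Qed.

Lemma upper_unlearned n : upper (run n.+1 [::]) unlearned (d0 + delta).
Proof.
apply: (upper_run_last gamma) => //.
- by apply: addr_ge0; exact: ltW.
- move=> hist ah.
  have mr : monotone_sampler (boosting_round gamma q D B W e0 d0 hist).
    exact: (monotone_boosting_round gamma).
  apply: upper_le mr _ (fun=> lexx _) _ (learned_round gamma q D gamma0 eta0
    sigmaE sigma1 fresh0 resample0 B W e0 d0 mB H hstar mH Hstar m m0 learnerW
    e00 d00 mE m0_resample a a08 hist ah).
    by move=> h; rewrite /unlearned.
  by rewrite lerD2l.
Qed.

Lemma upper_misjudged :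
  upper (boost (@phi R) gamma q D W e0 d0) misjudged (T%:R * delta).
Proof.
have mis0 o : 0 <= misjudged o by rewrite mulr_ge0// sumr_ge0.
apply: upper_boost => //; first by rewrite mulr_ge0// ltW.
move=> hist.
have [ah|nah] := pselect (adm hist); last first.
  have Td : 0 <= T%:R * delta by rewrite mulr_ge0// ltW.
  apply: upper_le mI _ _ Td (upper0 _) => s; first exact: mis0.
  by rewrite /misjudged /= asboolF// mul0r.
have -> : T%:R * delta = \sum_(k < T) delta.
  by rewrite sumr_const card_ord mulr_natl.
have -> : (fun s : (post q).-tuple (X * bool) => misjudged (hist, tval s)) =
    (fun s => \sum_(k < T)
    ((eps / 4 < `|emp_corr R s (sign (ensemble q (drop k.+1 hist)))
       - corr D (sign (ensemble q (drop k.+1 hist)))|)%R)%:R).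
  by apply/funext => s; rewrite /misjudged /= asboolT// mul1r.
apply: upper_sum => // k.
have ms : measurable_fun [set: X] (sign (ensemble q (drop k.+1 hist))).
  by apply/measurable_sign/(measurable_ensemble gamma)/admissible_drop.
have [mv _] := bounded_measurable_agreement (R := R) _ ms.
have v2 z : `|agreement (sign (ensemble q (drop k.+1 hist))) z| <= 2 :> R.
  by rewrite norm_agreement; lra.
have e8 : 0 < eps / 4 <= 8 by have := eps0; have := eps2; lra.
apply: upper_le mI _ _ post_large (upper_deviation (from D) D
  (dominated_from D) _ mv v2 (post q) (eps / 4) post0 e8) => s //.
by rewrite /emp_corr /corr_sum size_tuple.
Qed.

(** The failures add up to [T * delta] for the noise, [T * (d0 + delta)] for learning and
    [T * delta] for post-selection, within the allowed factor 10. As [good] need not be measurable,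
    no complement is taken: its indicator plus all failure counts is at least 1 everywhere, and
    [upper] takes the counts off. *)
Theorem boost_success :
  ((1 - 10 * d0 * T%:R - 10 * delta * T%:R)%:E <=
   Pr (boost (@phi R) gamma q D W e0 d0)
     [set o | labels_valid (@phi R) q o.1 ->
        forall hbar, outputs q o.1 o.2 hbar ->
          (opt_corr D H - 2 * e0 / gamma - eps <= corr D hbar)%R])%E.
Proof.
set good := [set o | _].
have Uadm : upper (boost (@phi R) gamma q D W e0 d0) inadmissible 0.
  apply: (upper_boost_history
    (fun hist => `[< ~ (adm hist /\ size hist = T) >]%:R)) => //.
  exact: (upper_run_admissible gamma).
have loud0 hist : 0 <= loud hist by apply: sumr_ge0.
have unlearned0 hist : 0 <= unlearned hist by rewrite /unlearned.
have inad0 o : 0 <= inadmissible o by rewrite /inadmissible.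
have fail0 V : (forall hist, 0 <= V hist) -> forall o, 0 <= failed_rounds V o.
  by move=> V0 o; apply: sumr_ge0.
have mis0 o : 0 <= misjudged o by rewrite mulr_ge0// sumr_ge0.
have U1 := upperD _ _ _ _ _ inad0 Uadm (upper_failed_rounds loud delta loud0 upper_loud).
have U2 := upperD _ _ _ _ _ (fail0 _ unlearned0)
  (upper_failed_rounds unlearned _ unlearned0 upper_unlearned) upper_misjudged.
have V1 o : 0 <= inadmissible o + failed_rounds loud o.
  by rewrite addr_ge0// fail0.
have V2 o : 0 <= failed_rounds unlearned o + misjudged o.
  by rewrite addr_ge0// fail0.
have U := upperD _ _ _ _ _ V1 U1 U2.
have g0 o : (0 <= (\1_good o)%:E :> \bar R)%E by rewrite lee_fin indicE.
have := U (fun o => (\1_good o)%:E) g0.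
have mass : boost (@phi R) gamma q D W e0 d0 (fun=> 1%E) = 1%E.
  rewrite /boost /bind /ret iid_from_mass.
  exact: (run_mass gamma).
have Pr1 : (1 <= boost (@phi R) gamma q D W e0 d0 (fun o => (\1_good o)%:E +
    (inadmissible o + failed_rounds loud o +
     (failed_rounds unlearned o + misjudged o))%:E))%E.
  rewrite -{1}mass.
  apply: (monotone_bind _ _ monotone_runT) => //.
  - by move=> hist; apply: nonneg_bind => // s; exact: nonneg_ret.
  - move=> hist; apply: monotone_bind => // s; first exact: nonneg_ret.
    exact: monotone_ret.
  move=> o; rewrite -EFinD lee_fin.
  have [go|ngo] := pselect (good o).
    by rewrite indicE mem_set// lerDl; exact: addr_ge0.
  rewrite indicE memNset// add0r.
  (* The failure counts are natural numbers, so a nonzero total is already at least 1. *)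
  have nat_sum (I : finType) (F : I -> R) :
      (forall i, F i \is a Num.nat) -> \sum_i F i \is a Num.nat.
    by move=> FN; apply: rpred_sum => i _.
  have /natrP[n nE] : inadmissible o + failed_rounds loud o +
      (failed_rounds unlearned o + misjudged o) \is a Num.nat.
    apply: rpredD; apply: rpredD.
    - exact: natr_nat.
    - by apply: (@nat_sum _ _) => k; apply: (@nat_sum _ _) => g; exact: natr_nat.
    - by apply: (@nat_sum _ _) => k; exact: natr_nat.
    - apply: rpredM; first exact: natr_nat.
      by apply: (@nat_sum _ _) => k; exact: natr_nat.
  rewrite nE; case: n nE => [/eqP|n _]; last by rewrite ler1n.
  have f1 := fail0 _ loud0 o; have f2 := fail0 _ unlearned0 o.
  rewrite (paddr_eq0 (V1 o) (V2 o)) => /andP[].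
  rewrite (paddr_eq0 (inad0 o) f1) (paddr_eq0 f2 (mis0 o)).
  move=> /andP[/eqP E1 /eqP E2] /andP[/eqP E3 /eqP E4].
  by exfalso; apply: ngo => valid hbar; exact: (run_good_output o).
move=> /(le_trans Pr1) {}Pr1.
rewrite /Pr; move: Pr1.
set P := boost _ _ _ _ _ _ _ _; clearbody P.
case: P => [p| |] //.
rewrite -EFinD !lee_fin.
  have : 0 <= d0 * T%:R by rewrite mulr_ge0// ltW.
  have : 0 <= delta * T%:R by rewrite mulr_ge0// ltW.
  lra.
by move=> _; rewrite leey.
Qed.

End boosting_success.

(** * Choice of the parameters *)

Section tuning.
Context {R : realType}.
Implicit Types x gamma eps delta : R.

Lemma nat_above x : 0 <= x -> exists n : nat, (0 < n)%N /\ x <= n%:R <= x + 1.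
Proof.
move=> x0; exists (Num.truncn x).+1; split => //.
have /andP[l1 l2] := truncn_itv x0.
by rewrite (ltW l2)/= -natr1 lerD2r.
Qed.

Lemma lg_ge1 x : 1 <= lg x.
Proof. by rewrite le_max lexx. Qed.

Lemma lg_ln x : ln x <= lg x.
Proof. by rewrite le_max lexx orbT. Qed.

Lemma expR_lg x : 0 < x -> x <= expR (lg x).
Proof. by move=> x0; rewrite -{1}(lnK x0) ler_expR lg_ln. Qed.

Lemma expR1_ge2 : 2 <= expR 1 :> R.
Proof. by apply: le_trans (expR_ge1Dx _). Qed.

Lemma expRN_lg delta : 0 < delta -> expR (- lg delta^-1) <= delta.
Proof.
move=> d0; rewrite expRN invf_ple ?posrE ?expR_gt0//.
by apply: expR_lg; rewrite invr_gt0.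
Qed.

Lemma post_size delta (t : R) : 0 < delta -> 1 + lg delta^-1 <= t ->
  2 * expR (- t) <= delta.
Proof.
move=> d0 tl; apply: le_trans (expRN_lg _ d0).
apply: (@le_trans _ _ (2 * expR (- (1 + lg delta^-1)))).
  by rewrite ler_pM2l// ler_expR lerN2.
rewrite opprD expRD mulrA ler_piMl ?expR_ge0//.
by rewrite expRN ler_pdivrMr ?expR_gt0// mul1r expR1_ge2.
Qed.

(** Both logarithms are at least 1, so four times their product dominates [2 + l + dl]; the summand
    2 absorbs the constant 4 in [2 * expR l * 2]. A product is used because the parameter bounds are
    products of logarithms. *)
Lemma union_size delta (N : nat) (t : R) : 0 < delta ->
  4 * (lg (N%:R : R) * lg delta^-1) <= t ->
  (N%:R + 1) * (2 * expR (- t)) <= delta.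
Proof.
move=> d0 tl; set l := lg _ in tl *; set dl := lg _ in tl *.
have l1 : 1 <= l by exact: lg_ge1.
have dl1 : 1 <= dl by exact: lg_ge1.
have Nl : N%:R + 1 <= 2 * expR l.
  have e2 : 2 <= expR l by apply: le_trans expR1_ge2 _; rewrite ler_expR.
  have : N%:R <= expR l.
    case: (posnP N) => [->|N0]; first by rewrite expR_ge0.
    by apply: expR_lg; rewrite ltr0n.
  by lra.
have t2 : 2 + l + dl <= t.
  have : 0 <= (l - 1) * (dl - 1) by rewrite mulr_ge0 ?subr_ge0.
  have : 0 <= (l - 1) * dl by rewrite mulr_ge0 ?subr_ge0// (le_trans ler01).
  by move: tl l1 dl1; lra.
apply: le_trans (expRN_lg _ d0); rewrite -/dl.
apply: (@le_trans _ _ (2 * expR l * (2 * expR (- (2 + l + dl))))).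
  apply: ler_pM => //.
  by rewrite ler_pM2l// ler_expR lerN2.
have -> : - (2 + l + dl) = - l + (- dl + - (1 + 1)) by ring.
rewrite !expRD.
have ll : expR l * expR (- l) = 1 by exact: expRxMexpNx_1.
have -> : 2 * expR l * (2 * (expR (- l) * (expR (- dl) * expR (- (1 + 1))))) =
  (expR l * expR (- l)) * expR (- dl) * (4 * expR (- (1 + 1))) by ring.
rewrite ll mul1r ler_piMr ?expR_ge0//.
rewrite expRN ler_pdivrMr ?expR_gt0// mul1r expRD.
rewrite (_ : 4 = 2 * 2); last by ring.
by rewrite ler_pM// expR1_ge2.
Qed.

Lemma burn_in_size (s b : R) (n : nat) : 0 <= s <= 1 -> 0 < b ->
  ln (2 / b) <= n%:R * s -> 2 * (1 - s) ^+ n <= b.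
Proof.
move=> /andP[s0 s1] b0 ns.
have h1 : (1 - s) ^+ n <= expR (- (n%:R * s)).
  rewrite -mulrN expRM_natl lerXn2r ?nnegrE ?subr_ge0 ?expR_ge0//.
  exact: expR_ge1Dx.
have h2 : expR (- (n%:R * s)) <= b / 2.
  apply: (@le_trans _ _ (expR (- ln (2 / b)))).
    by rewrite ler_expR lerN2.
  by rewrite expRN lnK ?posrE ?divr_gt0// invf_div.
have := le_trans h1 h2; lra.
Qed.

Lemma ln_le_lgs gamma eps : 0 < gamma -> 0 < eps ->
  ln (2 ^+ 8 / (gamma * eps)) <= 10 * (lg gamma^-1 * lg eps^-1).
Proof.
move=> g0 e0; have g1 := lg_ge1 gamma^-1; have e1 := lg_ge1 eps^-1.
have i0 : 0 < gamma^-1 by rewrite invr_gt0.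
have j0 : 0 < eps^-1 by rewrite invr_gt0.
have -> : ln (2 ^+ 8 / (gamma * eps)) = ln (2 ^+ 8) + (ln gamma^-1 + ln eps^-1).
  have ij0 : 0 < gamma^-1 * eps^-1 by rewrite mulr_gt0.
  have p0 : 0 < 2 ^+ 8 :> R by rewrite exprn_gt0.
  by rewrite invfM -(lnM i0 j0) -(lnM p0 ij0).
rewrite lnXn//.
have : ln 2 <= 1 :> R by apply: (@le_ln1Dx R 1); lra.
have := lg_ln gamma^-1; have := lg_ln eps^-1.
have : 0 <= (lg gamma^-1 - 1) * (lg eps^-1 - 1) by rewrite mulr_ge0 ?subr_ge0.
rewrite -[ln 2 *+ 8]mulr_natl; lra.
Qed.

Variables (gamma eps delta : R) (N : nat).
Hypotheses (g0 : 0 < gamma) (g1 : gamma <= 1) (e0 : 0 < eps) (e2 : eps <= 2).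
Hypothesis d0 : 0 < delta.
Notation x := (gamma * eps).
Notation P := (lg gamma^-1 * lg eps^-1 * lg delta^-1).
Notation lB := (lg (N%:R : R)).

Let x0 : 0 < x. Proof. exact: mulr_gt0. Qed.

Let x2 : x <= 2.
Proof. by rewrite -[leRHS]mul1r ler_pM// ltW. Qed.

Let lg_mul_ge1 (u v : R) : 1 <= u -> 1 <= v -> [/\ 1 <= u * v, u <= u * v & v <= u * v].
Proof.
move=> u1 v1; have u0 := le_trans ler01 u1; have v0 := le_trans ler01 v1.
by split; [exact: mulr_ege1|rewrite ler_peMr|rewrite ler_peMl].
Qed.

Let P1 : [/\ 1 <= P, lg gamma^-1 * lg eps^-1 <= P & lg delta^-1 <= P].
Proof.
have [a1 _ _] := lg_mul_ge1 _ _ (lg_ge1 gamma^-1) (lg_ge1 eps^-1).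
exact: lg_mul_ge1 a1 (lg_ge1 delta^-1).
Qed.

Let inv_le_max (u : R) : 0 < u -> u <= 2 ->
  [/\ 1 <= Num.max 1 (1 / u ^+ 2), u^-1 <= 2 * Num.max 1 (1 / u ^+ 2),
     (u ^+ 2)^-1 <= Num.max 1 (1 / u ^+ 2) &
     Num.max 1 (1 / u ^+ 2) <= 4 * (u ^+ 2)^-1].
Proof.
move=> u0 u2; have uu : 0 < u ^+ 2 by rewrite exprn_gt0.
have h : 1 <= 4 * (u ^+ 2)^-1.
  rewrite ler_pdivlMr// mul1r (_ : 4 = 2 ^+ 2); last by ring.
  by rewrite lerXn2r// nnegrE ltW.
split.
- by rewrite le_max lexx.
- have : u^-1 <= 2 * (u ^+ 2)^-1.
    by rewrite ler_pdivlMr// expr2 mulrA mulVf ?gt_eqF// mul1r.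
  move=> /le_trans; apply; rewrite ler_pM2l// div1r.
  by rewrite le_max lexx orbT.
- by rewrite div1r le_max lexx orbT.
- rewrite ge_max h/= div1r ler_peMl ?invr_ge0 ?(ltW uu)//; lra.
Qed.

Lemma horizon_parameters : exists T0 T : nat,
  [/\ (T0 <= T)%N, 2 * (1 - x / 64) ^+ T0 <= x / 128,
     2 + T0%:R * (x / 64) < (T - T0)%:R * (x ^+ 2 / 64 / 32) &
     T%:R <= 2 ^+ 15 * P * Num.max 1 (1 / x ^+ 2)].
Proof.
have [P1' gP _] := P1; have [y1 yx yxx _] := inv_le_max _ x0 x2.
set y := Num.max _ _ in y1 yx yxx *.
(* [2 ^ 8 / x] is [2 / (x / 128)], so the burn-in condition reads [Lam <= T0 * (x / 64)]. *)
pose Lam := ln (2 ^+ 8 / x).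
have LP : Lam <= 10 * P.
  by apply: le_trans (ln_le_lgs _ _ g0 e0) _; rewrite ler_pM2l.
have xx0 : 0 < x ^+ 2 by rewrite exprn_gt0.
have L0 : 0 <= Lam.
  apply: ln_ge0; rewrite ler_pdivlMr// mul1r; apply: le_trans x2 _.
  by rewrite -[leLHS]expr1 ler_weXn2l//; lra.
have [T0 [_ /andP[T0l T0u]]] := nat_above (Lam * 64 / x)
  (divr_ge0 (mulr_ge0 L0 (ler0n _ 64)) (ltW x0)).
(* After the burn-in the potential is at most [2 + Lam + x / 64], which a total decrease of
   [Lam + 4] makes negative; each later round contributes [x ^ 2 / (64 * 32)], the value of
   [eta * eps / 32]. *)
have a0 : 0 <= (Lam + 4) * (64 * 32) / x ^+ 2.
  by rewrite divr_ge0 ?(ltW xx0)// mulr_ge0 ?mulr_ge0//; lra.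
have [M [_ /andP[Ml Mu]]] := nat_above _ a0.
exists T0, (T0 + M)%N; rewrite leq_addr addKn; split => //.
- apply: burn_in_size.
  + by apply/andP; split; have := x0; have := x2; lra.
  + by have := x0; lra.
  + have -> : 2 / (x / 128) = 2 ^+ 8 / x by field; rewrite !gt_eqF.
    move: T0l; rewrite ler_pdivrMr// -/Lam; lra.
- have : T0%:R * (x / 64) <= Lam + x / 64.
    have -> : Lam + x / 64 = (Lam * 64 / x + 1) * (x / 64).
      by field; rewrite !gt_eqF.
    by rewrite ler_wpM2r// divr_ge0// ltW.
  have : Lam + 4 <= M%:R * (x ^+ 2 / 64 / 32).
    by move: Ml; rewrite ler_pdivrMr//; lra.
  by have := x2; lra.
- rewrite natrD.
  have i0 : 0 < x^-1 by rewrite invr_gt0.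
  have ii0 : 0 < (x ^+ 2)^-1 by rewrite invr_gt0.
  have P0 : 0 < P by apply: lt_le_trans P1'.
  have y0 : 0 < y by apply: lt_le_trans y1.
  have b1 : Lam * 64 / x <= 20 * 64 * (P * y).
    have : Lam * x^-1 <= (10 * P) * (2 * y) by rewrite ler_pM// ltW.
    by lra.
  have b2 : (Lam + 4) * (64 * 32) / x ^+ 2 <= 14 * (64 * 32) * (P * y).
    have : (Lam + 4) * (x ^+ 2)^-1 <= (14 * P) * y.
      by apply: ler_pM => //; [lra|exact: ltW|lra].
    by lra.
  have Py : 1 <= P * y by exact: mulr_ege1.
  rewrite -mulrA (_ : 2 ^+ 15 = 8 * 64 * 64); last by ring.
  by lra.
Qed.

Lemma fresh_parameter : exists S : nat, [/\ (0 < S)%N,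
  (N%:R + 1) * (2 * expR (- ((x / 128) ^+ 2 * S%:R / (64 * (x / 64))))) <= delta &
  S%:R <= 2 ^+ 16 * P * (lB / x + lB ^+ 3)].
Proof.
have [P1' _ dP] := P1; have l1 := lg_ge1 (N%:R : R); have dl1 := lg_ge1 delta^-1.
have l0 : 0 < lB by apply: lt_le_trans l1.
have i0 : 0 < x^-1 by rewrite invr_gt0.
have Q0 : 0 <= 4 * (lB * lg delta^-1) * 2 ^+ 14 / x.
  rewrite divr_ge0 ?(ltW x0)// mulr_ge0 ?exprn_ge0// mulr_ge0//.
  by rewrite mulr_ge0 ?(le_trans ler01).
have [S [S0 /andP[Sl Su]]] := nat_above _ Q0.
exists S; split => //.
- apply: union_size => //.
  (* The exponent is linear in [x], since dividing by [sigma = x / 64] cancels one of the two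
     factors of the squared accuracy. *)
  have -> : (x / 128) ^+ 2 * S%:R / (64 * (x / 64)) = S%:R * x / 2 ^+ 14.
    by field; rewrite !gt_eqF.
  by rewrite ler_pdivlMr ?exprn_gt0// -ler_pdivrMr.
- apply: le_trans Su _.
  have c1 : 1 <= 4 * 2 ^+ 14 :> R by rewrite mulr_ege1 ?exprn_ege1//; lra.
  have h1 : lg delta^-1 * (lB / x) <= P * (lB / x).
    by rewrite ler_wpM2r// divr_ge0// ltW.
  have h2 : 1 <= P * lB ^+ 3 by rewrite mulr_ege1// exprn_ege1.
  have -> : 2 ^+ 16 * P * (lB / x + lB ^+ 3) =
    4 * 2 ^+ 14 * (P * (lB / x)) + 4 * 2 ^+ 14 * (P * lB ^+ 3) by ring.
  have -> : 4 * (lB * lg delta^-1) * 2 ^+ 14 / x =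
    4 * 2 ^+ 14 * (lg delta^-1 * (lB / x)) by ring.
  apply: lerD; last exact: mulr_ege1.
  by rewrite ler_wpM2l// (le_trans ler01).
Qed.

(** The learner's [m0] is known only after the parameters are chosen, so the bound is required for
    every size from [m1] on, in particular for [m0 + m1]. *)
Lemma resample_parameter : exists m1 : nat, [/\ (0 < m1)%N,
  forall n, (m1 <= n)%N ->
    N%:R * (2 * expR (- (n%:R * (x / 128) ^+ 2 / 64))) <= delta &
  m1%:R <= 2 ^+ 23 * (P * lB) * Num.max 1 (1 / x ^+ 2)].
Proof.
have [P1' _ dP] := P1; have l1 := lg_ge1 (N%:R : R); have dl1 := lg_ge1 delta^-1.
have l0 : 0 < lB by apply: lt_le_trans l1.
have xx0 : 0 < x ^+ 2 by rewrite exprn_gt0.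
have [y1 _ yxx _] := inv_le_max _ x0 x2.
set y := Num.max _ _ in y1 yxx *.
have Q0 : 0 <= 4 * (lB * lg delta^-1) * 2 ^+ 20 / x ^+ 2.
  rewrite divr_ge0 ?(ltW xx0)// mulr_ge0 ?exprn_ge0// mulr_ge0//.
  by rewrite mulr_ge0 ?(le_trans ler01).
have [m1 [m10 /andP[ml mu]]] := nat_above _ Q0.
exists m1; split => //.
- move=> n mn.
  apply: le_trans (union_size delta N (n%:R * (x / 128) ^+ 2 / 64) d0 _).
    apply: ler_wpM2r; first by rewrite mulr_ge0// expR_ge0.
    by rewrite lerDl.
  have -> : n%:R * (x / 128) ^+ 2 / 64 = n%:R * x ^+ 2 / 2 ^+ 20 by field.
  rewrite ler_pdivlMr ?exprn_gt0// -ler_pdivrMr//.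
  by apply: le_trans ml _; rewrite ler_nat.
- apply: le_trans mu _.
  have c1 : 1 <= 4 * 2 ^+ 20 :> R by rewrite mulr_ege1 ?exprn_ege1//; lra.
  have c0 : 0 <= 4 * 2 ^+ 20 :> R by rewrite (le_trans ler01).
  have h1 : lB * lg delta^-1 * (x ^+ 2)^-1 <= P * lB * y.
    apply: ler_pM => //; last by rewrite mulrC ler_pM2r.
    - by rewrite mulr_ge0 ?(le_trans ler01).
    - by rewrite invr_ge0 ltW.
  have h2 : 1 <= P * lB * y by apply: mulr_ege1 => //; exact: mulr_ege1.
  have -> : 2 ^+ 23 * (P * lB) * y =
    4 * 2 ^+ 20 * (P * lB * y) + 4 * 2 ^+ 20 * (P * lB * y) by ring.
  have -> : 4 * (lB * lg delta^-1) * 2 ^+ 20 / x ^+ 2 =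
    4 * 2 ^+ 20 * (lB * lg delta^-1 * (x ^+ 2)^-1) by ring.
  apply: lerD; last exact: mulr_ege1.
  by rewrite ler_wpM2l.
Qed.

Lemma post_parameter : exists S0 : nat, [/\ (0 < S0)%N,
  2 * expR (- (S0%:R * (eps / 4) ^+ 2 / 64)) <= delta &
  S0%:R <= 2 ^+ 12 * P * Num.max 1 (1 / eps ^+ 2)].
Proof.
have [P1' _ dP] := P1; have dl1 := lg_ge1 delta^-1.
have ee0 : 0 < eps ^+ 2 by rewrite exprn_gt0.
have [y1 _ yee _] := inv_le_max _ e0 e2.
set y := Num.max _ _ in y1 yee *.
have Q0 : 0 <= (1 + lg delta^-1) * 2 ^+ 10 / eps ^+ 2.
  rewrite divr_ge0 ?(ltW ee0)// mulr_ge0 ?exprn_ge0// addr_ge0//.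
  by rewrite (le_trans ler01).
have [S0 [S00 /andP[Sl Su]]] := nat_above _ Q0.
exists S0; split => //.
- apply: post_size => //.
  have -> : S0%:R * (eps / 4) ^+ 2 / 64 = S0%:R * eps ^+ 2 / 2 ^+ 10 by field.
  by rewrite ler_pdivlMr ?exprn_gt0// -ler_pdivrMr.
- apply: le_trans Su _.
  have c1 : 1 <= 2 ^+ 10 :> R by rewrite exprn_ege1//; lra.
  have c0 : 0 <= 2 ^+ 10 :> R by rewrite (le_trans ler01).
  have h1 : (1 + lg delta^-1) * (eps ^+ 2)^-1 <= 2 * P * y.
    apply: ler_pM => //; first by rewrite addr_ge0// (le_trans ler01).
    - by rewrite invr_ge0 ltW.
    - by lra.
  have h2 : 1 <= P * y by rewrite mulr_ege1.
  have -> : 2 ^+ 12 * P * y =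
    2 ^+ 10 * (2 * P * y) + 2 ^+ 10 * (P * y) + 2 ^+ 10 * (P * y) by ring.
  have -> : (1 + lg delta^-1) * 2 ^+ 10 / eps ^+ 2 =
    2 ^+ 10 * ((1 + lg delta^-1) * (eps ^+ 2)^-1) by ring.
  rewrite -addrA; apply: lerD; first by rewrite ler_wpM2l.
  have h3 : 1 <= 2 ^+ 10 * (P * y) by exact: mulr_ege1.
  by rewrite -[leLHS]addr0 lerD// (le_trans ler01).
Qed.

Lemma total_sample_bound (T S S0 : R) : 0 <= T -> 0 <= S ->
  T <= 2 ^+ 15 * P * Num.max 1 (1 / x ^+ 2) ->
  S <= 2 ^+ 16 * P * (lB / x + lB ^+ 3) ->
  S0 <= 2 ^+ 12 * P * Num.max 1 (1 / eps ^+ 2) ->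
  T * S + S0 <= 2 ^+ 34 * P ^+ 2 *
    Num.max 1 (lB / x ^+ 3 + lB ^+ 3 / x ^+ 2).
Proof.
move=> T0 S0' Tl Sl S0l.
have [P1' _ _] := P1; have l1 := lg_ge1 (N%:R : R).
have l0 : 0 < lB by apply: lt_le_trans l1.
have P0 : 0 < P by apply: lt_le_trans P1'.
have xx0 : 0 < x ^+ 2 by rewrite exprn_gt0.
have [_ _ _ y4] := inv_le_max _ x0 x2.
set F := _ / x ^+ 3 + _; set M := Num.max 1 F.
have FM : F <= M by rewrite le_max lexx orbT.
have F0 : 0 <= F by rewrite addr_ge0// divr_ge0 ?exprn_ge0// ltW.
have c0 n : 0 <= 2 ^+ n :> R by rewrite exprn_ge0.
have M1 : 1 <= M by rewrite le_max lexx.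
have PP : P <= P ^+ 2 by rewrite expr2 ler_peMr// ltW.
have TS : T * S <= 2 ^+ 33 * (P ^+ 2 * F).
  apply: (@le_trans _ _ (2 ^+ 15 * P * (4 * (x ^+ 2)^-1) *
      (2 ^+ 16 * P * (lB / x + lB ^+ 3)))).
    apply: ler_pM => //; apply: le_trans Tl _.
    by rewrite ler_wpM2l// mulr_ge0// ltW.
  rewrite le_eqVlt; apply/orP; left; apply/eqP; rewrite /F.
  by field; rewrite !gt_eqF.
have S0M : S0 <= 2 ^+ 33 * (P ^+ 2 * M).
  apply: le_trans S0l _; rewrite -mulrA.
  apply: ler_pM => //.
  - by rewrite mulr_ge0 ?(ltW P0)// le_max ler01.
  - by rewrite ler_weXn2l//; lra.
  apply: ler_pM => //; [exact: ltW|by rewrite le_max ler01|].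
  rewrite ge_max M1/=; apply: le_trans FM; rewrite /F div1r.
  apply: (@le_trans _ _ (lB ^+ 3 / x ^+ 2)).
    rewrite -[leLHS]mul1r; apply: ler_pM => //.
    - by rewrite invr_ge0 exprn_ge0// ltW.
    - by rewrite exprn_ege1.
    rewrite lef_pV2 ?posrE ?exprn_gt0//.
    apply: lerXn2r; rewrite ?nnegrE; [exact: ltW|exact: ltW|].
    by rewrite -[leRHS]mul1r ler_pM2r.
  by rewrite lerDr divr_ge0 ?exprn_ge0// ltW.
have : 2 ^+ 33 * (P ^+ 2 * F) <= 2 ^+ 33 * (P ^+ 2 * M).
  by rewrite ler_wpM2l// ler_wpM2l// sqr_ge0.
rewrite (exprS 2 33) => h; apply: le_trans (lerD (le_trans TS h) S0M) _.
by rewrite le_eqVlt; apply/orP; left; apply/eqP; ring.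
Qed.

End tuning.

(** * The range of correlations, and near-maximizers *)

Section large_eps.
Context {R : realType} {d : measure_display} {X : measurableType d}.
Variable D : probability (X * bool)%type R.

(* [h] need not be measurable: an output is only known to come from some
   history, and the integral is bounded all the same. *)
Lemma corr_ge_opp1 (h : X -> bool) : -1 <= corr D h.
Proof.
rewrite /corr /Rintegral integralE.
have one (f : X * bool -> \bar R) : (forall z, 0 <= f z)%E ->
    (forall z, f z <= 1)%E ->
    (0 <= \int[D]_z f z <= 1)%E.
  move=> f0 f1; apply/andP; split; first exact: integral_ge0.
  apply: (@le_trans _ _ (\int[D]_z 1)%E); first exact: le_integral_nonneg.
  by rewrite integral_cst//= probability_setT mule1.
set f := fun z : X * bool => (pm R z.2 * pm R (h z.1))%:E.
have fE z : f z = 1%E \/ f z = (-1)%E.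
  by rewrite /f; case: z.2; case: (h z.1); rewrite /= ?mulrNN ?mulr1 ?mul1r;
    [left|right|right|left].
have /andP[n0 n1] : (0 <= \int[D]_z f^\- z <= 1)%E.
  apply: one => z; rewrite funenegE; case: (fE z) => ->;
    rewrite ?ge_max ?le_max ?lexx ?orbT ?lee01 ?andbT ?oppeK//.
  by rewrite -EFinN lee_fin; lra.
have /andP[p0 p1] : (0 <= \int[D]_z f^\+ z <= 1)%E.
  apply: one => z; rewrite funeposE; case: (fE z) => ->;
    rewrite ?ge_max ?le_max ?lexx ?orbT ?lee01 ?andbT//.
  by rewrite lee_fin; lra.
move: n0 n1 p0 p1.
case: (\int[D]_z f^\- z)%E => [a| |]//.
case: (\int[D]_z f^\+ z)%E => [b| |]//.
by rewrite !lee_fin /=; lra.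
Qed.

Lemma opt_corr_le1 (H : set (X -> bool)) : H !=set0 ->
  (forall h, H h -> measurable_fun [set: X] h) -> opt_corr D H <= 1.
Proof.
move=> [h0 H0] mH; apply: ge_sup; first by exists (corr D h0); exists h0.
move=> _ [h Hh <-]; have := corr_norm D h (mH _ Hh).
by rewrite ler_norml => /andP[].
Qed.

(** The supremum over an arbitrary class need not be attained; the slack [e] buys an actual member
    to compare with. *)
Lemma near_opt (H : set (X -> bool)) (e : R) : H !=set0 -> 0 < e ->
  (forall h, H h -> measurable_fun [set: X] h) ->
  exists2 h, H h & opt_corr D H <= corr D h + e.
Proof.
move=> [h0 H0] e0 mH.
have hs : has_sup [set corr D h | h in H].
  split; first by exists (corr D h0); exists h0.
  exists 1 => _ [h Hh <-]; have := corr_norm D h (mH _ Hh).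
  by rewrite ler_norml => /andP[].
have [_ [h Hh <-] lt] := sup_adherent e0 hs.
by exists h => //; rewrite -lerBlDr ltW.
Qed.

End large_eps.

Theorem theorem9 :
  exists C k : nat,
  forall (R : realType) (d : measure_display) (X : measurableType d)
    (B : {fset (X -> bool)}) (H : set (X -> bool))
    (D : probability (X * bool)%type R) (gamma eps delta : R),
  (forall h, h \in B -> measurable_fun [set: X] h) ->
  (forall h, H h -> measurable_fun [set: X] h) ->
  H !=set0 ->
  0 < gamma <= 1 -> 0 < eps -> 0 < delta ->
  let L := polylog k gamma eps delta in
  let lB := lg (#|` B|%:R : R) in
  exists (eta sigma tau : R) (T S S0 m1 : nat),
    [/\ (0 < T)%N, (0 < S)%N, (0 < S0)%N, (0 < m1)%N &
        [/\ 0 < eta, 0 < tau & sigma <= 1]] /\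
    [/\ T%:R <= C%:R * L * Num.max 1 (1 / (gamma ^+ 2 * eps ^+ 2)),
        eta <= C%:R * L * (gamma ^+ 2 * eps),
        sigma = eta / gamma &
        tau <= C%:R * L * (gamma * eps)] /\
    [/\ S%:R <= C%:R * L * (lB / (gamma * eps) + lB ^+ 3),
        S0%:R <= C%:R * L * Num.max 1 (1 / eps ^+ 2),
        m1%:R <= C%:R * (L * lB ^+ k)
                 * Num.max 1 (1 / (gamma ^+ 2 * eps ^+ 2)) &
        (T * S + S0)%:R <= C%:R * L *
          Num.max 1 (lB / (gamma ^+ 3 * eps ^+ 3)
                     + lB ^+ 3 / (gamma ^+ 2 * eps ^+ 2))] /\
    forall (m : R -> R -> option nat) (W : learner R B) (e0 d0 : R) (m0 : nat),
      weak_learner gamma H m W ->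
      0 < e0 -> 0 < d0 -> m e0 d0 = Some m0 ->
      let q := Params eta sigma tau T S (m0 + m1) S0 in
      ((1 - 10 * d0 * T%:R - 10 * delta * T%:R)%:E <=
         Pr (boost (@phi R) gamma q D W e0 d0)
            [set o | labels_valid (@phi R) q o.1 ->
               forall hbar, outputs q o.1 o.2 hbar ->
                 (opt_corr D H - 2 * e0 / gamma - eps <= corr D hbar)%R])%E.

Proof.
(* [C] is kept opaque so that the unary numeral [2 ^ 34] is never computed. *)
have [C CE] : exists C : nat, C = (2 ^ 34)%N by eexists.
(* Exponent and constant are those of [total_sample_bound]: [T] and [S] each carry one factor [P],
   and [2 ^ 34] exceeds the constants of all other bounds. *)
exists C, 2%N => R d X B H D gamma eps delta mB mH H0 /andP[g0 g1] e0 d0 L lB.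
have CR : C%:R = 2 ^+ 34 :> R by rewrite CE natrX.
have c1 n : 1 <= 2 ^+ n :> R by rewrite exprn_ege1//; lra.
have gl := lg_ge1 gamma^-1; have el := lg_ge1 eps^-1; have dl := lg_ge1 delta^-1.
have Bl : 1 <= lB by exact: lg_ge1.
pose P := lg gamma^-1 * lg eps^-1 * lg delta^-1.
have P1 : 1 <= P by rewrite mulr_ege1// mulr_ege1.
have LE : L = P ^+ 2 by [].
have P0 : 0 < P by apply: lt_le_trans P1.
have PL : P <= L by rewrite LE expr2 ler_peMr// ltW.
have L1 : 1 <= L by apply: le_trans PL.
have CL1 : 1 <= C%:R * L by rewrite CR mulr_ege1.
have scale n (u v : R) : (n <= 34)%N -> 0 <= v -> u <= 2 ^+ n * P * v ->
    u <= C%:R * L * v.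
  move=> n34 v0 /le_trans; apply; apply: ler_wpM2r => //; rewrite CR.
  apply: ler_pM => //; first exact: ltW.
  by apply: ler_weXn2l => //; lra.
have CL0 : 0 < C%:R * L by apply: lt_le_trans CL1.
have ge_CL (u : R) : 0 <= u -> u <= C%:R * L * u.
  by move=> u0; rewrite ler_peMl.
(* The deviation and parameter estimates work for [eps <= 2]. Beyond that the conclusion is trivial,
   two correlations differing by at most 2. *)
have [e2|e2] := leP eps 2.
- have [T0 [T [T0T burn hor Tl]]] :=
    horizon_parameters gamma eps delta g0 g1 e0 e2.
  have [S [S0 Sd Sl]] := fresh_parameter gamma eps delta #|` B| g0 e0 d0.
  have [m1 [m10 md ml]] :=
    resample_parameter gamma eps delta #|` B| g0 g1 e0 e2 d0.
  have [S' [S'0 S'd S'l]] := post_parameter gamma eps delta e0 e2 d0.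
  have tot := total_sample_bound gamma eps delta #|` B| g0 g1 e0 e2 _ _ _
    (ler0n R T) (ler0n R S) Tl Sl S'l.
  rewrite -/lB in Sl ml tot.
  have ge0 : 0 < gamma * eps by rewrite mulr_gt0.
  have gge0 : 0 < gamma ^+ 2 * eps by rewrite mulr_gt0// exprn_gt0.
  have ge2 : gamma * eps <= 2 by rewrite -[leRHS]mul1r ler_pM// ltW.
  have lB0 : 0 < lB by apply: lt_le_trans Bl.
  have max0 (u : R) : 0 <= Num.max 1 u by rewrite le_max ler01.
  exists (gamma ^+ 2 * eps / 64), (gamma * eps / 64), (gamma * eps / 16).
  exists T, S, S', m1.
  have T_gt0 : (0 < T)%N.
    case: (posnP T) hor => // -> hor.
    by have : 0 <= T0%:R * (gamma * eps / 64) by [rewrite mulr_ge0// divr_ge0// ltW];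
      move: hor; rewrite sub0n mul0r; lra.
  have sE : gamma * eps / 64 = gamma ^+ 2 * eps / 64 / gamma.
    by field; rewrite gt_eqF.
  split; last split; last split.
  + split => //; split; [by rewrite divr_gt0|by rewrite divr_gt0|lra].
  + split => //.
    * by rewrite -exprMn; apply: scale Tl.
    * by apply: le_trans (ge_CL _ (ltW gge0)); lra.
    * by apply: le_trans (ge_CL _ (ltW ge0)); lra.
  + split.
    * apply: scale Sl => //.
      by rewrite addr_ge0 ?divr_ge0 ?exprn_ge0// ltW.
    * exact: scale S'l.
    * rewrite -[gamma ^+ 2 * _]exprMn.
      have ml' : m1%:R <= 2 ^+ 23 * P * (lB * Num.max 1 (1 / (gamma * eps) ^+ 2)).
        by apply: le_trans ml _; rewrite !mulrA.
      have H1 : 0 <= lB * Num.max 1 (1 / (gamma * eps) ^+ 2).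
        by rewrite mulr_ge0// ltW.
      apply: le_trans (scale 23%N _ _ isT H1 ml') _.
      set M := Num.max _ _.
      have -> : C%:R * L * (lB * M) = C%:R * L * M * lB by ring.
      have -> : C%:R * (L * lB ^+ 2) * M = C%:R * L * M * (lB * lB) by ring.
      apply: ler_wpM2l; last by rewrite ler_peMl// ltW.
      exact: mulr_ge0 (ltW CL0) (max0 _).
    * rewrite -[gamma ^+ 3 * _]exprMn -[gamma ^+ 2 * _]exprMn.
      rewrite natrD natrM; apply: le_trans tot _.
      by rewrite CR LE !mulrA.
  + move=> m W e1 d1 m0 WL e10 d10 mE; cbv zeta.
    have [hstar Hh ho] := near_opt D H (eps / 4) H0 (divr_gt0 e0 (ltr0n _ 4)) mH.
    have N0 : (0 < m0 + m1)%N by rewrite addn_gt0 m10 orbT.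
    apply: (boost_success gamma (Params (gamma ^+ 2 * eps / 64) (gamma * eps / 64)
      (gamma * eps / 16) T S (m0 + m1) S') D g0 g1 _ sE _ S0 N0 S'0 B W e1 d1 mB H hstar
      mH Hh m m0 WL e10 d10 mE (leq_addr _ _) eps delta T0) => //=.
    * by rewrite divr_gt0.
    * lra.
    * move: hor; rewrite (_ : (gamma * eps) ^+ 2 / 64 / 32 =
        gamma ^+ 2 * eps / 64 * eps / 32)//; by field.
    * by apply: md; exact: leq_addl.
- have g2 : 0 < gamma ^+ 2 by rewrite exprn_gt0.
  have ee0 : 1 <= eps by lra.
  have sE : gamma = gamma ^+ 2 / gamma by field; rewrite gt_eqF.
  (* Any values within the bounds do: [eta = gamma ^ 2] makes [sigma = eta / gamma = gamma <= 1],
     and [eps >= 1] keeps [eta] and [tau] below their bounds. *)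
  exists (gamma ^+ 2), gamma, gamma, 1%N, 1%N, 1%N, 1%N.
  have max1 (u : R) : 1 <= C%:R * L * Num.max 1 u.
    by rewrite mulr_ege1// le_max lexx.
  have lB3 : 1 <= lB ^+ 3 by rewrite exprn_ege1.
  have lBg : 0 <= lB / (gamma * eps).
    by apply: divr_ge0; [exact: le_trans ler01 Bl|apply: mulr_ge0; exact: ltW].
  split; last split; last split.
  + by [].
  + split => //.
    * apply: le_trans (ge_CL _ (ltW g2)) _; rewrite ler_pM2l//.
      by rewrite ler_peMr// ltW.
    * apply: le_trans (ge_CL _ (ltW g0)) _; rewrite ler_pM2l//.
      by rewrite ler_peMr// ltW.
  + split => //.
    * by rewrite mulr_ege1//; lra.
    * have LlB : 1 <= C%:R * (L * lB ^+ 2).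
        by rewrite mulrA mulr_ege1// exprn_ege1.
      by rewrite mulr_ege1// le_max lexx.
    * have C2 : 2 <= C%:R * L.
        rewrite CR (exprS 2 33) -mulrA -[leLHS]mulr1 ler_pM2l//.
        by rewrite mulr_ege1.
      rewrite mul1n addn1; apply: le_trans C2 _.
      by rewrite ler_peMr ?(ltW CL0)// le_max lexx.
  + move=> m W e1 d1 m0 WL e10 d10 mE; cbv zeta.
    set A := [set o | _].
    have -> : A = setT.
      apply/seteqP; split => // o _ _ hbar _.
      have := corr_ge_opp1 D hbar; have := opt_corr_le1 D H H0 mH.
      have : 0 <= 2 * e1 / gamma by rewrite divr_ge0 ?mulr_ge0// ltW.
      by lra.
    set Q := boost _ _ _ _ _ _ _; have -> : Pr Q setT = 1%E.
      rewrite /Pr /Q /boost /bind /ret.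
      transitivity (run_rounds (@phi R) gamma
        (Params (gamma ^+ 2) gamma gamma 1 1 (m0 + 1) 1) D W e1 d1 1 [::]
        (fun=> 1%E)).
        congr (run_rounds _ _ _ _ _ _ _ _ _ _); apply/funext => hist.
        rewrite -[RHS](iid_from_mass D 1); congr (iid _ _ _).
        by apply/funext => s; rewrite indicT.
      by apply: (run_mass gamma).
    by rewrite lee_fin; lra.
Qed.
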